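(* Let $\Sigma$ be an $n\times n$ positive definite Hermitian matrix, let $G$ be an $n\times p$ complex Ginibre matrix associated with $\Sigma$, and let $G^-=(g^{ij})_{1\le i\le p,1\le j\le n}$ be its pseudo-inverse. Put $q=p-n$, let $k\ge1$ be an integer, and suppose $n\ge k$ and $q\ge k$. Then for any four sequences $\mathbf{i}=(i_1,\dots,i_k)$, $\mathbf{i}'=(i_1',\dots,i_k')$ in $\{1,\dots,p\}$ and $\mathbf{j}=(j_1,\dots,j_k)$, $\mathbf{j}'=(j_1',\dots,j_k')$ in $\{1,\dots,n\}$, $$E[g^{i_1j_1}\cdots g^{i_kj_k}\,\overline{g^{i_1'j_1'}\cdots g^{i_k'j_k'}}]=(-1)^k\sum_{\sigma,\rho\in S_k}\delta_\sigma(\mathbf{i},\mathbf{i}')\,\mathrm{Wg}^{\mathrm U}(\sigma^{-1}\rho;p,-q)\,\overline{(\Sigma^{-1})_{j_{\rho(1)}j_1'}\cdots(\Sigma^{-1})_{j_{\rho(k)}j_k'}}.$$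
   Context: An $n\times p$ complex Ginibre matrix associated with $\Sigma$ is a random matrix whose columns are i.i.d. with the $n$-dimensional (centered, circularly symmetric) complex normal distribution $\mathrm{N}_{\mathbb C}(0,\Sigma)$ (covariance $E[xx^*]=\Sigma$); equivalently it has the law of $\Sigma^{1/2}Z$ with $Z$ an $n\times p$ matrix of i.i.d. standard complex normal variables $\mathrm{N}_{\mathbb C}(0,1)$ ($E|z|^2=1$). $G^-$ is the Moore–Penrose pseudo-inverse: if $G=UDV^*$ is a singular value decomposition then $G^-=VD^-U^*$, with $D^-$ the $p\times n$ diagonal matrix obtained by inverting the nonzero diagonal entries of $D$ (zero entries stay zero). $S_k$ is the symmetric group on $\{1,\dots,k\}$, and $\kappa(\pi)$ is the number of cycles of $\pi\in S_k$. For sequences $\mathbf{i},\mathbf{i}'$ of length $k$ and $\pi\in S_k$, $\delta_\pi(\mathbf{i},\mathbf{i}')=\prod_{s=1}^k\delta_{i_{\pi(s)},i'_s}$ (Kronecker deltas). Functions on $S_k$ are multiplied by convolution $(f_1*f_2)(\pi)=\sum_{\tau\in S_k}f_1(\tau)f_2(\tau^{-1}\pi)$. For $z\in\mathbb{C}$, the unitary Weingarten function $\mathrm{Wg}^{\mathrm U}(\cdot;z)$ on $S_k$ is the pseudo-inverse of the central function $z^{\kappa(\cdot)}:\pi\mapsto z^{\kappa(\pi)}$, i.e. the unique class function satisfying $z^{\kappa(\cdot)}*\mathrm{Wg}^{\mathrm U}(\cdot;z)*z^{\kappa(\cdot)}=z^{\kappa(\cdot)}$ and $\mathrm{Wg}^{\mathrm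 U}(\cdot;z)*z^{\kappa(\cdot)}*\mathrm{Wg}^{\mathrm U}(\cdot;z)=\mathrm{Wg}^{\mathrm U}(\cdot;z)$. The double-parameter version is, for $z,w\in\mathbb{C}$, $\mathrm{Wg}^{\mathrm U}(\cdot;z,w)=\mathrm{Wg}^{\mathrm U}(\cdot;z)*\mathrm{Wg}^{\mathrm U}(\cdot;w)$. Explicitly, $$\mathrm{Wg}^{\mathrm U}(\cdot;z)=\frac1{k!}\sum_{\lambda\vdash k,\ C_\lambda(z)\ne0}\frac{f^\lambda}{C_\lambda(z)}\chi^\lambda,\qquad \mathrm{Wg}^{\mathrm U}(\cdot;z,w)=\frac1{k!}\sum_{\lambda\vdash k,\ C_\lambda(z)C_\lambda(w)\ne0}\frac{f^\lambda}{C_\lambda(z)C_\lambda(w)}\chi^\lambda,$$ where $C_\lambda(z)=\prod_{i=1}^{\ell(\lambda)}\prod_{j=1}^{\lambda_i}(z+j-i)$, $\chi^\lambda$ is the irreducible character of $S_k$ indexed by the partition $\lambda$ of $k$, $\ell(\lambda)$ is the length of $\lambda$, and $f^\lambda=\chi^\lambda(e)$. *)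

(* Defs.v *)
From HB Require Import structures.
From mathcomp Require Import all_boot all_order all_algebra all_fingroup.
From mathcomp Require Import complex.
From mathcomp Require Import all_classical all_reals all_analysis.

Set Implicit Arguments.
Unset Strict Implicit.
Unset Printing Implicit Defensive.

Import Order.TTheory GRing.Theory Num.Theory.

Local Open Scope classical_set_scope.
Local Open Scope ring_scope.
Local Open Scope complex_scope.
Local Open Scope sesquilinear_scope.

Section ComplexMatrices.
Context {R : realType}.
Local Notation C := R[i].

Definition posdefmx (n : nat) (S : 'M[C]_n) : Prop :=
  S \is hermsymmx /\
  forall x : 'cV[C]_n, x != 0 -> 0 < (x^t* *m S *m x) 0 0.

Definition possemidefmx (n : nat) (S : 'M[C]_n) : Prop :=
  S \is hermsymmx /\
  forall x : 'cV[C]_n, 0 <= (x^t* *m S *m x) 0 0.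

(* H = S^{1/2}; for S positive semidefinite there is exactly one such H. *)
Definition is_sqrtmx (n : nat) (S H : 'M[C]_n) : Prop :=
  possemidefmx H /\ H *m H = S.

Definition is_svd (m n : nat) (A : 'M[C]_(m, n))
    (U : 'M[C]_m) (D : 'M[C]_(m, n)) (V : 'M[C]_n) : Prop :=
  [/\ U \is unitarymx, V \is unitarymx, is_diag_mx D,
      (forall i j, 0 <= D i j) & A = U *m D *m V^t*].

(* The zero entries of D stay zero because 0^-1 = 0 in a fieldType. *)
Definition diag_pinv (m n : nat) (D : 'M[C]_(m, n)) : 'M[C]_(n, m) :=
  \matrix_(i, j) (D j i)^-1.

(* B = A^-; existence is the existence of a singular value decomposition, and
   B does not depend on the decomposition. *)
Definition is_pseudo_inverse (m n : nat)
    (A : 'M[C]_(m, n)) (B : 'M[C]_(n, m)) : Prop :=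
  exists U D V, is_svd A U D V /\ B = V *m diag_pinv D *m U^t*.

End ComplexMatrices.

Section ComplexNormal.
Context {R : realType}.
Local Notation C := R[i].

(* The 2n real coordinates of a vector of C^n: real parts are indexed by
   (i, false), imaginary parts by (i, true). *)
Definition rcoord (n : nat) (c : 'I_n * bool) (x : 'cV[C]_n) : R :=
  if c.2 then complex.Im (x c.1 0) else complex.Re (x c.1 0).

Definition cvec_borel (n : nat) : set (set 'cV[C]_n) :=
  <<s \bigcup_(c in [set: 'I_n * bool])
        preimage_set_system [set: 'cV[C]_n] (rcoord c) measurable >>.

Section RandomVectors.
Context {d : measure_display} {T : measurableType d}.

Definition random_cvec (n : nat) (X : T -> 'cV[C]_n) : Prop :=
  forall c : 'I_n * bool, measurable_fun setT (rcoord c \o X).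

(* The product rule for subfamilies follows by taking A i to be the full set
   for the remaining indices. *)
Definition mutually_independent (P : probability T R) (I : finType) (E : Type)
    (M : set (set E)) (X : I -> T -> E) : Prop :=
  forall A : I -> set E, (forall i, M (A i)) ->
    P (\bigcap_(i in [set: I]) (X i @^-1` A i)) =
    \big[*%E/1%E]_(i : I) P (X i @^-1` A i).

(* n i.i.d. N_C(0,1) components: the real and imaginary parts are independent
   and N(0,1/2), so that E|z|^2 = 1.  The last parameter of normal_prob is the
   standard deviation. *)
Definition std_complex_normal (P : probability T R) (n : nat)
    (Z : T -> 'cV[C]_n) : Prop :=
  [/\ random_cvec Z,
      mutually_independent P measurable (fun c => rcoord c \o Z) &
      forall (c : 'I_n * bool) (A : set R), measurable A ->
        P ((rcoord c \o Z) @^-1` A) = normal_prob 0 (Num.sqrt 2^-1) A].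

End RandomVectors.

(* X ~ N_C(0,S): X has the law of S^{1/2} Z with Z standard. *)
Definition complex_normal (d : measure_display) (T : measurableType d)
    (P : probability T R) (n : nat) (S : 'M[C]_n) (X : T -> 'cV[C]_n) : Prop :=
  random_cvec X /\
  exists (H : 'M[C]_n) (d' : measure_display) (T' : measurableType d')
         (P' : probability T' R) (Z : T' -> 'cV[C]_n),
    [/\ is_sqrtmx S H, std_complex_normal P' Z &
        forall B, cvec_borel B ->
          P (X @^-1` B) = P' ((fun t => H *m Z t) @^-1` B)].

Definition ginibre (d : measure_display) (T : measurableType d)
    (P : probability T R) (n p : nat) (S : 'M[C]_n)
    (G : T -> 'M[C]_(n, p)) : Prop :=
  mutually_independent P (@cvec_borel n) (fun j t => col j (G t)) /\
  forall j : 'I_p, complex_normal P S (fun t => col j (G t)).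

Definition cintegrable (d : measure_display) (T : measurableType d)
    (P : probability T R) (f : T -> C) : Prop :=
  P.-integrable setT (EFin \o (fun t => complex.Re (f t))) /\
  P.-integrable setT (EFin \o (fun t => complex.Im (f t))).

Definition cexpectation (d : measure_display) (T : measurableType d)
    (P : probability T R) (f : T -> C) : C :=
  fine 'E_P[fun t => complex.Re (f t)]%E
    +i* fine 'E_P[fun t => complex.Im (f t)]%E.

End ComplexNormal.

Section Weingarten.
Context {R : realType} {k : nat}.
Local Notation C := R[i].
Implicit Types (s t pi : 'S_k) (f g h : {ffun 'S_k -> C}).

(* s o t, the product of S_k used below: (s * t)%g is "s first, then t". *)
Definition comp_perm s t : 'S_k := (t * s)%g.

Definition convol f g : {ffun 'S_k -> C} :=
  [ffun pi => \sum_(t : 'S_k) f t * g (comp_perm t^-1%g pi)].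

Definition class_function f : Prop := forall s t, f (s ^ t)%g = f s.

Definition cycle_power (z : C) : {ffun 'S_k -> C} :=
  [ffun pi => z ^+ #|porbits pi|].

Definition is_weingarten (z : C) (W : {ffun 'S_k -> C}) : Prop :=
  [/\ class_function W,
      convol (convol (cycle_power z) W) (cycle_power z) = cycle_power z &
      convol (convol W (cycle_power z)) W = W].

(* Class functions on 'S_k form a commutative semisimple algebra, so there is
   exactly one W with is_weingarten z W; the default value 0 is never used. *)
Definition Wg (z : C) : {ffun 'S_k -> C} := xget 0 [set W | is_weingarten z W].

Definition Wg2 (z w : C) : {ffun 'S_k -> C} := convol (Wg z) (Wg w).

Definition delta_perm (I : eqType) s (i i' : 'I_k -> I) : C :=
  \prod_(r < k) (i (s r) == i' r)%:R.

End Weingarten.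

(* Main.v *)
Require Import Defs.
From HB Require Import structures.
From mathcomp Require Import all_boot all_order all_algebra all_fingroup.
From mathcomp Require Import complex.
From mathcomp Require Import all_classical all_reals all_analysis.
From mathcomp Require Import measurable_realfun ring lra.

Set Implicit Arguments.
Unset Strict Implicit.
Unset Printing Implicit Defensive.

Import Order.TTheory GRing.Theory Num.Theory.
Local Open Scope ring_scope.
Local Open Scope sesquilinear_scope.

(* Put H = Sigma^(1/2) and Z = H^-1 G, a matrix of i.i.d. standard entries; put
   W = Z Z^*.  Almost surely G^- H = Y := Z^* W^-1, and everything reduces to the
   tensor M(i,i',j,j') = E[prod Y_{i_s j_s} conj(prod Y_{i'_s j'_s})].
   (1) Gaussian integration by parts along the rotations Z -> Z U shows that M is
   invariant under gl_p in (i,i').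
   (2) Contracting i with a permutation of i' turns M into moments of
   W^-1.  Integration by parts gives a recursion between the moments of
   orders m and m + 1, whose operator is q - J_m with J_m a Jucys-Murphy element;
   the product of these operators is (-1)^k (-q)^kappa, so Wg(.; -q) appears.
   (3) For k <= p an invariant tensor is determined by its contractions, because
   p + J_m is injective; Wg(.; p) comes from inverting the contraction.
   Integration by parts is legitimate for W + e in place of W.  The
   recursion itself bounds E[(tr (W + e)^-1)^m] by n^m for m <= q, uniformly
   in e, which yields both the almost sure invertibility of W and the
   domination needed to let e tend to 0. *)

(** * Jucys-Murphy elements and invariant tensors *)

(** The obstacle is integrability: neither the invertibility of W nor any negative moment is known
    beforehand. Since |Y_ij|^2 <= tr W^-1, a monomial with 2k factors is controlled by (tr W^-1)^k,
    and this is the moment that k <= q provides. The one term of the recursion with a higher degree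
    carries the factor e tr (W + e)^-1, which is at most n, so it costs no further moment.
    Invariance under rotations enters only to first order, as the vanishing expectation of a
    derivation, so that integration by parts in one real coordinate at a time is the only
    probabilistic tool. Both inversions, of p + J_m and of q - J_m, rest on one elementary fact: J_m
    is a sum of m < k <= |z| transpositions, hence z + J_m is strictly diagonally dominant for z = p
    and z = -q. *)

Section Dominance.
Variable K : numFieldType.

(** Strict diagonal dominance in the l1 norm: every [phi s] preserves the sum of [|f t|] over [T],
    so [|z|] times this sum is at most [#|A|] times it. It is used with the transpositions of a
    Jucys-Murphy element, both on functions on the symmetric group and on tensors. *)
Lemma dominated_eq0 (T J : finType) (A : {pred J}) (z : K)
    (phi : J -> T -> T) (f : T -> K) :
  #|A|%:R < `|z| -> (forall s, s \in A -> bijective (phi s)) ->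
  (forall t, z * f t + \sum_(s in A) f (phi s t) = 0) -> forall t, f t = 0.
Proof.
move=> Az bphi hf.
have le t : `|z| * `|f t| <= \sum_(s in A) `|f (phi s t)|.
  rewrite -normrM.
  have -> : z * f t = - \sum_(s in A) f (phi s t) by apply/eqP; rewrite -addr_eq0 hf.
  by rewrite normrN ler_norm_sum.
pose S := \sum_t `|f t|.
have S_ge0 : 0 <= S by apply: sumr_ge0.
have leS : `|z| * S <= #|A|%:R * S.
  rewrite {1}/S mulr_sumr (le_trans (ler_sum _ (fun t _ => le t)))//.
  rewrite exchange_big /= mulr_natl -sumr_const ler_sum// => s sA.
  by rewrite /S [leRHS](reindex (phi s)) /=; [apply: lexx|apply: onW_bij; apply: bphi].
have S0 : S = 0.
  apply/eqP; rewrite eq_le S_ge0 andbT -(@pmulr_rle0 _ (`|z| - #|A|%:R)) ?subr_gt0 //.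
  by rewrite mulrBl subr_le0.
move=> t; apply/eqP; rewrite -normr_le0 -S0 /S (bigD1 t) //= lerDl.
by apply: sumr_ge0.
Qed.

End Dominance.

Section Jucys.
Variables (K : numFieldType) (k : nat).
Implicit Types (s t pi : 'S_k).

(** The copy of the symmetric group on the first [m] letters inside ['S_k]. *)
Definition fixes_above m : {pred 'S_k} :=
  [pred pi : 'S_k | [forall r : 'I_k, (m <= r)%N ==> (pi r == r)]].

Lemma fixes_aboveP m pi :
  reflect (forall r : 'I_k, (m <= r)%N -> pi r = r) (pi \in fixes_above m).
Proof.
apply: (iffP forallP) => [h r mr|h r]; first by have /implyP/(_ mr)/eqP := h r.
by apply/implyP => /h ->.
Qed.

(** The fixed point [y] is a cycle of its own, and the transposition merges it into the cycle of
    [x]. *)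
Lemma card_porbits_tperm_mul (x y : 'I_k) pi :
  x != y -> pi y = y -> #|porbits pi| = #|porbits (tperm x y * pi)%g|.+1.
Proof.
move=> xy piy; have := porbits_mul_tperm pi x y.
have -> : x \notin porbit pi y.
  apply/porbitP => -[m]; rewrite permX iter_fix// => /eqP.
  by rewrite (negbTE xy).
by rewrite xy /= addn1 addn2 => -[->].
Qed.

(** Coset decomposition: representatives are 1 and the transpositions [tperm s m], and the coset of
    [pi] is read off the preimage of [m]. *)
Lemma sum_fixes_aboveS (V : nmodType) (m : 'I_k) (F : 'S_k -> V) :
  \sum_(pi in fixes_above m.+1) F pi =
  \sum_(pi in fixes_above m)
     (F pi + \sum_(s < k | (s < m)%N) F (tperm s m * pi)%g).
Proof.
rewrite (partition_big (fun pi : 'S_k => pi^-1 m)%g (fun s : 'I_k => s <= m)%N) /=;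
  last first.
  move=> pi /fixes_aboveP hpi; rewrite leqNgt; apply/negP => lt.
  by have := hpi _ lt; rewrite permKV => e; move: lt; rewrite -e ltnn.
rewrite big_split /= exchange_big /= (bigD1 m) //=; congr (_ + _).
  apply: eq_bigl => pi; apply/andP/fixes_aboveP => [[/fixes_aboveP h /eqP e] r|h].
    rewrite leq_eqVlt => /orP[/eqP/val_inj <-|/h//].
    by rewrite -{1}e permKV.
  split; first by apply/fixes_aboveP => r /ltnW /h.
  by rewrite -{1}(h m (leqnn m)) permK.
apply: eq_big => [s|s]; first by rewrite ltn_neqAle andbC.
move=> /andP[sm nsm].
rewrite (reindex_inj (mulgI (tperm s m))) /=; apply: eq_bigl => pi.
apply/andP/fixes_aboveP => [[/fixes_aboveP h /eqP e] r|h].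
  have pim : pi m = m.
    have := permKV (tperm s m * pi)%g m; rewrite e permM tpermL //.
  rewrite leq_eqVlt => /orP[/eqP/val_inj <-//|mr].
  have := h r mr; rewrite permM tpermD // -val_eqE /= ltn_eqF //.
  by apply: leq_ltn_trans mr.
split.
  apply/fixes_aboveP => r mr; rewrite permM tpermD ?h ?(ltnW mr) //.
    by rewrite -val_eqE /= ltn_eqF // (leq_ltn_trans sm).
  by rewrite -val_eqE /= ltn_eqF.
apply/eqP; apply: (canLR (permK _)).
by rewrite permM tpermL h.
Qed.

(* The factorisation [z^kappa = prod_(m < k) (z + J_m)] in the group algebra,
   [J_m] being the Jucys-Murphy element [sum_(s < m) (s m)]. *)
Lemma jucys_step (z : K) (m : 'I_k) (g : 'S_k -> K) :
  z * \sum_(pi in fixes_above m.+1) z ^+ #|porbits pi| * g pi =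
  \sum_(pi in fixes_above m) z ^+ #|porbits pi| *
    (z * g pi + \sum_(s < k | (s < m)%N) g (tperm s m * pi)%g).
Proof.
rewrite sum_fixes_aboveS mulr_sumr; apply: eq_bigr => pi /fixes_aboveP hpi.
rewrite !mulrDr mulrCA; congr (_ + _).
rewrite !mulr_sumr; apply: eq_bigr => s sm.
have sm' : s != m by rewrite -val_eqE /= ltn_eqF.
by rewrite (card_porbits_tperm_mul sm' (hpi _ (leqnn m))) exprS mulrA.
Qed.

Lemma fixes_above0 pi : (pi \in fixes_above 0) = (pi == 1%g).
Proof.
apply/fixes_aboveP/eqP => [h|-> r _]; last by rewrite perm1.
by apply/permP => r; rewrite perm1 h.
Qed.

Lemma fixes_abovek pi : pi \in fixes_above k.
Proof. by apply/fixes_aboveP => r; rewrite leqNgt ltn_ord. Qed.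

Lemma card_porbits1 : #|porbits (1%g : 'S_k)| = k.
Proof.
rewrite -[RHS]card_ord /porbits card_imset // => x y /eqP.
rewrite eq_porbit_mem => /porbitP[m]; rewrite expg1n perm1 => ->//.
Qed.

Lemma cycle_power_inj (z : K) (f : 'S_k -> K) : (k%:R <= `|z|) ->
  (forall t, \sum_pi z ^+ #|porbits pi| * f (pi * t)%g = 0) ->
  forall t, f t = 0.
Proof.
move=> kz hf.
have z0 : (0 < k)%N -> z != 0.
  by move=> k0; rewrite -normr_gt0 (lt_le_trans _ kz) // ltr0n.
(* Factors are peeled off one at a time: [h'] is [z + J_m] applied to [h], and the induction
   hypothesis kills it. As [J_m] has [m < k <= |z|] terms, dominance gives [h = 0]. *)
have inj (m : nat) (h : 'S_k -> K) : (m <= k)%N ->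
  (forall t, \sum_(pi in fixes_above m) z ^+ #|porbits pi| * h (pi * t)%g = 0) ->
  forall t, h t = 0.
  elim: m h => [|m IH] h mk hh t.
    have := hh t; under eq_bigl do rewrite fixes_above0.
    rewrite big_pred1_eq mul1g => /eqP; rewrite card_porbits1 mulf_eq0 expf_eq0.
    by case/orP => [/andP[/z0/negbTE->]|/eqP].
  pose m' := Ordinal mk.
  pose h' t := z * h t + \sum_(s < k | (s < m')%N) h (tperm s m' * t)%g.
  have h'0 t' : h' t' = 0.
    apply: (IH h' (ltnW mk)) => {}t'.
    have := congr1 ( *%R z) (hh t'); rewrite mulr0.
    rewrite (@jucys_step z m' (fun pi => h (pi * t')%g)) => e.
    rewrite -[RHS]e.
    apply: eq_bigr => pi _; rewrite /h'; congr (_ * (_ + _)).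
    by apply: eq_bigr => s _; rewrite mulgA.
  have dom := @dominated_eq0 K {perm 'I_k} 'I_k [pred s : 'I_k | (s < m')%N] z
            (fun (s : 'I_k) (t : 'S_k) => (tperm s m' * t)%g) h.
  apply: dom h'0 t; last first.
    by move=> s _; exists (fun t => (tperm s m' * t)%g) => u; rewrite tpermKg.
  apply: lt_le_trans kz; rewrite ltr_nat.
  rewrite -[X in (_ < X)%N]card_ord; apply/proper_card/properP.
  split; first exact/fintype.subsetP.
  by exists m' => //; rewrite !inE ltnn.
apply: (inj k f) => // t; rewrite -[RHS](hf t); apply: eq_bigl => pi.
by rewrite fixes_abovek.
Qed.

End Jucys.

(** * Invariant tensors and their contractions *)

Section Contraction.
Variables (K : numFieldType) (A : finType).

Definition upd m (i : {ffun 'I_m -> A}) s c : {ffun 'I_m -> A} :=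
  [ffun r => if r == s then c else i r].

Definition ins m (s : 'I_m.+1) c (i : {ffun 'I_m -> A}) : {ffun 'I_m.+1 -> A} :=
  [ffun r => if unlift s r is Some r' then i r' else c].

Definition del m (s : 'I_m.+1) (i : {ffun 'I_m.+1 -> A}) : {ffun 'I_m -> A} :=
  [ffun r => i (lift s r)].

Definition permf m (i : {ffun 'I_m -> A}) (pi : 'S_m) : {ffun 'I_m -> A} :=
  [ffun r => i (pi r)].

Lemma ins_id m s c (i : {ffun 'I_m -> A}) : ins s c i s = c.
Proof. by rewrite ffunE unlift_none. Qed.

Lemma ins_lift m s c (i : {ffun 'I_m -> A}) r : ins s c i (lift s r) = i r.
Proof. by rewrite ffunE liftK. Qed.

Lemma ins_del m s c (i : {ffun 'I_m.+1 -> A}) : ins s c (del s i) = upd i s c.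
Proof.
apply/ffunP => r; rewrite !ffunE; case: unliftP => [r'|] ->; last by rewrite eqxx.
by rewrite ffunE eq_sym (negbTE (neq_lift _ _)).
Qed.

Lemma upd_ins m s c c' (i : {ffun 'I_m -> A}) : upd (ins s c i) s c' = ins s c' i.
Proof.
apply/ffunP => r; rewrite !ffunE; case: unliftP => [r'|] ->; last by rewrite eqxx.
by rewrite eq_sym (negbTE (neq_lift _ _)).
Qed.

Lemma upd_ins_lift m s r c c' (i : {ffun 'I_m -> A}) :
  upd (ins s c i) (lift s r) c' = ins s c (upd i r c').
Proof.
apply/ffunP => x; rewrite !ffunE; case: unliftP => [r'|] ->.
  by rewrite !ffunE (inj_eq lift_inj).
by rewrite (negbTE (neq_lift _ _)).
Qed.

Lemma big_lift (V : nmodType) m (s : 'I_m.+1) (F : 'I_m.+1 -> V) :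
  \sum_r F r = F s + \sum_r F (lift s r).
Proof.
rewrite (bigD1 s) //=; congr (_ + _).
rewrite (reindex_omap (lift s) (unlift s)) => [|r rs] /=; last first.
  by case: unliftP rs => [r' ->//|->]; rewrite eqxx.
by apply: eq_bigl => r; rewrite liftK eqxx andbT eq_sym neq_lift.
Qed.

(* Invariance of a form on tensors under the Lie algebra action of the
   elementary matrix [E_cb]. *)
Definition gl_invariant m (f : {ffun 'I_m -> A} -> {ffun 'I_m -> A} -> K) :=
  forall (i i' : {ffun 'I_m -> A}) (b c : A), \sum_s (i s == b)%:R * f (upd i s c) i' =
                   \sum_s (i' s == c)%:R * f i (upd i' s b).

Lemma sum_pred1 (V : pzRingType) (T : finType) (x : T) (F : T -> V) :
  \sum_b (x == b)%:R * F b = F x.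
Proof.
rewrite (bigD1 x) //= eqxx mul1r big1 ?addr0 // => b bx.
by rewrite eq_sym (negbTE bx) mul0r.
Qed.

(** Overwrite slot 0 of [i] by [b], apply invariance for the matrix unit taking [b] to [i ord0], and
    sum over [b]. Slot 0 contributes [#|A|] copies of [f i i']; another slot [s] only sees
    [b = i s], and the entries of slots 0 and [s] are then exchanged. *)
Lemma gl_invariant_transp m (f : {ffun 'I_m.+1 -> A} -> _ -> K) i i' :
  gl_invariant f ->
  #|A|%:R * f i i' + \sum_(s | s != ord0) f (permf i (tperm ord0 s)) i' =
  \sum_s (i' s == i ord0)%:R * \sum_c f (upd i ord0 c) (upd i' s c).
Proof.
move=> finv.
transitivity (\sum_b \sum_s (upd i ord0 b s == b)%:R * f (upd (upd i ord0 b) s (i ord0)) i').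
  rewrite [RHS]exchange_big /= [RHS](bigD1 ord0) //=; congr (_ + _).
    rewrite mulr_natl -sumr_const; apply: eq_bigr => b _.
    rewrite ffunE !eqxx mul1r; congr f; apply/ffunP => r; rewrite !ffunE.
    by case: eqP => [->|].
  apply: eq_bigr => s s0; under eq_bigr do rewrite ffunE (negbTE s0).
  rewrite (sum_pred1 _ (fun b => f (upd (upd i ord0 b) s (i ord0)) i')).
  congr f; apply/ffunP => r; rewrite !ffunE.
  by case: tpermP => [->|->|/eqP/negbTE -> /eqP/negbTE ->] //; rewrite ?eqxx // eq_sym (negbTE s0).
under eq_bigr do rewrite finv.
by rewrite exchange_big /=; apply: eq_bigr => s _; rewrite mulr_sumr.
Qed.

Definition contr m (f : {ffun 'I_m.+1 -> A} -> {ffun 'I_m.+1 -> A} -> K)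
    (s : 'I_m.+1) (i i' : {ffun 'I_m -> A}) :=
  \sum_c f (ins ord0 c i) (ins s c i').

(** The contracted index [x] occurs in both arguments. Invariance of [f] produces one extra term for
    each occurrence, and after summation over [x] both equal [f (ins ord0 c i) (ins s b i')]. *)
Lemma contr_gl_invariant m (f : {ffun 'I_m.+1 -> A} -> _ -> K) s :
  gl_invariant f -> gl_invariant (contr f s).
Proof.
move=> finv i i' b c.
have key x : (x == b)%:R * f (ins ord0 c i) (ins s x i') +
    \sum_r (i r == b)%:R * f (ins ord0 x (upd i r c)) (ins s x i') =
    (x == c)%:R * f (ins ord0 x i) (ins s b i') +
    \sum_r (i' r == c)%:R * f (ins ord0 x i) (ins s x (upd i' r b)).
  have := finv (ins ord0 x i) (ins s x i') b c.
  rewrite (big_lift ord0) (big_lift s) !ins_id !upd_ins.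
  under eq_bigr do rewrite ins_lift upd_ins_lift.
  by move=> ->; congr (_ + _); apply: eq_bigr => r _; rewrite ins_lift upd_ins_lift.
have := eq_bigr (op := +%R) (idx := 0) (r := index_enum A) (P := xpredT) _ (fun x _ => key x).
rewrite !big_split /=.
under eq_bigr do rewrite eq_sym.
under [X in _ = X + _]eq_bigr do rewrite eq_sym.
rewrite !sum_pred1 => /addrI.
by rewrite exchange_big [RHS]exchange_big /= => e; rewrite /contr;
  (under eq_bigr do rewrite mulr_sumr); rewrite e;
  under [RHS]eq_bigr do rewrite mulr_sumr.
Qed.

Lemma permf_ins m (s : 'I_m.+1) c (l : {ffun 'I_m -> A}) (pi : 'S_m) :
  permf (ins ord0 c l) (lift_perm s ord0 pi) = ins s c (permf l pi).
Proof.
apply/ffunP => r; rewrite ffunE [RHS]ffunE; case: unliftP => [r'|] ->.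
  by rewrite lift_perm_lift ins_lift ffunE.
by rewrite lift_perm_id ins_id.
Qed.

(** Full contractions of a contraction are full contractions of [f]; this hands the vanishing
    hypothesis down in [gl_invariant_eq0]. *)
Lemma sum_contr m (f : {ffun 'I_m.+1 -> A} -> {ffun 'I_m.+1 -> A} -> K) s (pi : 'S_m) :
  \sum_l contr f s l (permf l pi) = \sum_l f l (permf l (lift_perm s ord0 pi)).
Proof.
rewrite /contr pair_big /= [RHS](reindex (fun u : {ffun 'I_m -> A} * A => ins ord0 u.2 u.1)) /=.
  by apply: eq_bigr => -[l c] _ /=; rewrite permf_ins.
apply: onW_bij; exists (fun l : {ffun 'I_m.+1 -> A} => (del ord0 l, l ord0)) => [[l c]|l].
  by rewrite /= ins_id; congr pair; apply/ffunP => r; rewrite ffunE ins_lift.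
by rewrite /= ins_del; apply/ffunP => r; rewrite ffunE; case: eqP => [->|].
Qed.

(* The contractions of [f] against a slot of [i'] are again invariant, hence 0 by
   induction; invariance in slot 0 then says that [f] is killed by
   [#|A| + J], [J] a sum of [m - 1] transpositions. *)
Lemma gl_invariant_eq0 m (f : {ffun 'I_m -> A} -> {ffun 'I_m -> A} -> K) :
  (m <= #|A|)%N -> gl_invariant f ->
  (forall pi : 'S_m, \sum_l f l (permf l pi) = 0) ->
  forall i i', f i i' = 0.
Proof.
elim: m f => [|m IH] f mA finv f0 i i'.
  rewrite -[RHS](f0 1%g) (big_pred1 i) => [|l]; last first.
    by apply/esym/eqP/ffunP => -[].
  by congr f; apply/ffunP => -[].
have c0 s u u' : contr f s u u' = 0.
  apply: IH; [exact: ltnW|exact: contr_gl_invariant|] => pi.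
  by rewrite sum_contr f0.
have h u : #|A|%:R * f u i' +
    \sum_(s in [pred s | s != ord0]) f (permf u (tperm ord0 s)) i' = 0.
  rewrite (gl_invariant_transp u i' finv) big1 // => s _.
  under eq_bigr do rewrite -!ins_del.
  by have := c0 s (del ord0 u) (del s i'); rewrite /contr => ->; rewrite mulr0.
apply: (dominated_eq0 (phi := fun s u => permf u (tperm ord0 s)) (f := f ^~ i') _ _ h).
  rewrite normr_nat ltr_nat (leq_trans _ mA) // ltnS.
  rewrite cardC1 card_ord //.
move=> s _; exists (fun u => permf u (tperm ord0 s)) => u;
  by apply/ffunP => r; rewrite !ffunE tpermK.
Qed.

End Contraction.

(** * Weingarten functions *)

Section CycleCount.
Variables (k : nat) (A : finType).
Implicit Types (s t u pi : 'S_k).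

Lemma card_porbitsJ s t : #|porbits (s ^ t)%g| = #|porbits s|.
Proof.
have pj x : porbit (s ^ t)%g (t x) = [set t y | y in porbit s x].
  apply/setP => y; apply/porbitP/imsetP => [[i ->]|[z /porbitP[i ->] ->]].
    exists ((s ^+ i)%g x); first exact: mem_porbit.
    by rewrite -conjXg conjgE !permM permK.
  by exists i; rewrite -conjXg conjgE !permM permK.
rewrite -(card_imset (mem (porbits s)) (imset_inj (@perm_inj _ t))).
congr #|pred_of_set _|; apply/setP => B; apply/imsetP/imsetP.
  move=> [x _ ->]; exists (porbit s (t^-1 x)%g); last by rewrite -pj permKV.
  exact: imset_f.
by move=> [_ /imsetP[x _ ->] ->]; exists (t x) => //; rewrite pj.
Qed.

(** A tuple is invariant under [u] exactly when it is constant on the cycles of [u]; [F] identifies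
    such tuples with the functions on the set of cycles. *)
Lemma card_invariant_ffun u :
  #|[set l : {ffun 'I_k -> A} | permf l u == l]| = (#|A| ^ #|porbits u|)%N.
Proof.
pose B := {x : {set 'I_k} | x \in porbits u}.
have por r : porbit u r \in porbits u by apply: imset_f.
pose b r : B := exist _ (porbit u r) (por r).
pose F (h : {ffun B -> A}) : {ffun 'I_k -> A} :=
  [ffun r => h (b r)].
have Finj : injective F.
  move=> h h' e; apply/ffunP => -[x xu].
  have /imsetP[r _ xr] := xu; move/ffunP/(_ r): e; rewrite !ffunE.
  by have -> : exist _ x xu = b r :> B by apply: val_inj.
have -> : (#|A| ^ #|porbits u|)%N = #|F @: {: {ffun B -> A}}|.
  by rewrite [RHS]card_imset // card_ffun card_sig.
congr #|pred_of_set _|; apply/setP => l; rewrite inE; apply/eqP/imsetP; last first.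
  move=> [h _ ->]; apply/ffunP => r; rewrite !ffunE; congr (h _); apply: val_inj => /=.
  by have := porbit_perm u 1 r; rewrite expg1.
move=> lu.
have inv r (y : 'I_k) : y \in porbit u r -> l y = l r.
  move=> /porbitP[i ->]; elim: i => [|i IH]; first by rewrite expg0 perm1.
  by rewrite expgSr permM -IH -{2}lu ffunE.
have ne (x : B) : exists r, val x == porbit u r.
  by case: x => x /= /imsetP[r _ ->]; exists r.
exists [ffun x : B => l (xchoose (ne x))]; first by rewrite inE.
apply/ffunP => r; rewrite !ffunE.
by apply/esym/inv; rewrite -eq_porbit_mem eq_sym; have /= := xchooseP (ne (b r)).
Qed.

End CycleCount.

Section GroupAlgebra.
Context {R : realType} {k : nat}.
Local Notation C := R[i].
Implicit Types (s t pi : 'S_k) (f g h : {ffun 'S_k -> C}).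

Definition convol_one : {ffun 'S_k -> C} := [ffun pi => (pi == 1%g)%:R].

Lemma convolE f g pi : convol f g pi = \sum_t f t * g (pi * t^-1)%g.
Proof. by rewrite ffunE. Qed.

Lemma convolA : associative (@convol R k).
Proof.
move=> f g h; apply/ffunP => pi; rewrite !convolE.
under eq_bigr do rewrite convolE mulr_sumr.
under [RHS]eq_bigr do rewrite convolE mulr_suml.
rewrite [RHS]exchange_big /=; apply: eq_bigr => t _.
rewrite [RHS](reindex_inj (mulIg t)) /=; apply: eq_bigr => u _.
by rewrite mulrA mulgK invMg mulgA.
Qed.

Lemma convol1f f : convol convol_one f = f.
Proof.
apply/ffunP => pi; rewrite convolE (bigD1 1%g) //= ffunE eqxx mul1r invg1 mulg1.
by rewrite big1 ?addr0 // => t t1; rewrite ffunE (negbTE t1) mul0r.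
Qed.

Lemma convolf1 f : convol f convol_one = f.
Proof.
apply/ffunP => pi; rewrite convolE (bigD1 pi) //= ffunE mulgV eqxx mulr1.
by rewrite big1 ?addr0 // => t t1; rewrite ffunE -eq_mulgV1 eq_sym (negbTE t1) mulr0.
Qed.

Lemma class_functionC f s t : class_function f -> f (s * t)%g = f (t * s)%g.
Proof. by move=> cf; rewrite -(cf (s * t)%g s) conjgE -!mulgA mulKg. Qed.

Lemma convol_class f g : class_function f -> convol f g = convol g f.
Proof.
move=> cf; apply/ffunP => pi; rewrite !convolE.
rewrite [RHS](reindex_inj (inj_comp (mulgI pi) invg_inj)) /=; apply: eq_bigr => t _.
by rewrite invMg invgK (class_functionC _ _ cf) mulgKV mulrC.
Qed.

Lemma convol_class_function f g :
  class_function f -> class_function g -> class_function (convol f g).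
Proof.
move=> cf cg s t; rewrite !convolE (reindex_inj (conjg_inj t)) /=.
by apply: eq_bigr => u _; rewrite -conjVg -conjMg cf cg.
Qed.

Lemma convolV f g : class_function g ->
  (forall pi, f pi^-1%g = f pi) -> (forall pi, g pi^-1%g = g pi) ->
  forall pi, convol f g pi^-1%g = convol f g pi.
Proof.
move=> cg fV gV pi; rewrite !convolE (reindex_inj invg_inj) /=.
apply: eq_bigr => u _; rewrite fV invgK -gV invMg invgK.
by rewrite (class_functionC _ _ cg).
Qed.

Lemma cycle_power_class (z : C) : class_function (@cycle_power R k z).
Proof. by move=> s t; rewrite !ffunE card_porbitsJ. Qed.

Lemma cycle_powerV (z : C) pi : cycle_power z pi^-1%g = cycle_power z pi.
Proof. by rewrite !ffunE porbitsV. Qed.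

Lemma convol_cycle_power_inj (z : C) f : k%:R <= `|z| ->
  convol f (cycle_power z) = 0 -> f = 0.
Proof.
move=> kz f0; apply/ffunP => t; rewrite [RHS]ffunE.
apply: (cycle_power_inj kz) => {}t.
have := congr1 (fun h => h t) f0; rewrite convolE [RHS]ffunE => e; rewrite -[RHS]e.
rewrite [RHS](reindex_inj (mulIg t)) /=; apply: eq_bigr => u _.
by rewrite mulrC invMg mulKVg cycle_powerV ffunE.
Qed.

(** Convolution with [z^kappa] is linear and injective on a finite-dimensional space, hence onto;
    [M] is its matrix in the basis of permutations. *)
Lemma cycle_power_inv (z : C) : k%:R <= `|z| ->
  exists V, convol V (cycle_power z) = convol_one.
Proof.
move=> kz; pose M : 'M[C]_#|{perm 'I_k}| :=
  \matrix_(a, b) cycle_power z (enum_val b * (enum_val a)^-1)%g.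
pose fn (v : 'rV[C]_#|{perm 'I_k}|) : {ffun 'S_k -> C} := [ffun s => v 0 (enum_rank s)].
have fnM v : convol (fn v) (cycle_power z) = fn (v *m M).
  apply/ffunP => pi; rewrite convolE ffunE mxE [RHS](reindex _ (onW_bij _ (enum_rank_bij _))) /=.
  by apply: eq_bigr => t _; rewrite mxE !enum_rankK ffunE.
have Munit : M \in unitmx.
  rewrite -row_free_unit; apply: inj_row_free => v vM.
  have /(convol_cycle_power_inj kz) v0 : convol (fn v) (cycle_power z) = 0.
    by rewrite fnM vM; apply/ffunP => pi; rewrite !ffunE mxE.
  apply/rowP => a; have := congr1 (fun h => h (enum_val a)) v0.
  by rewrite !ffunE enum_valK mxE.
exists (fn ((\row_a convol_one (enum_val a)) *m invmx M)).
rewrite fnM mulmxKV //; apply/ffunP => pi; by rewrite ffunE mxE enum_rankK.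
Qed.

(** Once [z^kappa] is invertible, the first identity of [is_weingarten] forces [Wg z = V].
    Uniqueness of the inverse also gives the symmetries of [V], because conjugating or inverting its
    argument yields another inverse of the symmetric class function [z^kappa]. *)
Lemma Wg_inverse (z : C) : k%:R <= `|z| ->
  [/\ convol (Wg z) (cycle_power z) = convol_one :> {ffun 'S_k -> C},
      class_function (Wg z : {ffun 'S_k -> C}) &
      forall pi, Wg z pi^-1%g = Wg z pi :> C].
Proof.
move=> kz; have [V VC] := cycle_power_inv kz.
have inj f g : convol f (cycle_power z) = convol g (cycle_power z) -> f = g.
  move=> e; apply/eqP; rewrite -subr_eq0; apply/eqP/(convol_cycle_power_inj kz).
  apply/ffunP => pi; have := congr1 (fun h => h pi) e; rewrite !convolE ffunE.
  by move/eqP; rewrite -subr_eq0 -sumrB => /eqP e'; rewrite -[RHS]e';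
    apply: eq_bigr => t _; rewrite !ffunE mulrBl.
have Vcl : class_function V.
  move=> s t; pose V' := [ffun pi => V (pi ^ t)%g].
  suff e : V' = V by rewrite -{2}e ffunE.
  apply: inj; rewrite VC; apply/ffunP => pi.
  transitivity (convol_one (pi ^ t)%g); last first.
    by rewrite !ffunE (can2_eq (conjgK t) (conjgKV t)) conj1g.
  rewrite -VC !convolE [RHS](reindex_inj (conjg_inj t)) /=.
  apply: eq_bigr => u _; rewrite ffunE -conjVg -conjMg.
  by rewrite (cycle_power_class _ _ t).
have Vinv pi : V pi^-1%g = V pi.
  pose V' := [ffun pi => V (pi^-1)%g].
  suff e : V' = V by rewrite -{2}e ffunE.
  apply: inj; rewrite VC; apply/ffunP => {}pi.
  transitivity (convol_one pi^-1%g); last by rewrite !ffunE eq_invg1.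
  rewrite -VC !convolE [RHS](reindex_inj invg_inj) /=.
  apply: eq_bigr => u _; rewrite ffunE invgK -(cycle_powerV _ (_ * u)%g) invMg invgK.
  by rewrite (class_functionC _ _ (@cycle_power_class z)).
have CV : convol (cycle_power z) V = convol_one.
  by rewrite convol_class //; exact: cycle_power_class.
have VP : is_weingarten z V.
  by split; rewrite ?CV ?convol1f ?VC ?convol1f.
suff -> : Wg z = V by split.
have [_ e _] := @xgetPex _ 0 [set W | is_weingarten z W] (ex_intro _ V VP).
rewrite -/(Wg z) in e; rewrite -[LHS]convol1f -[LHS]convolf1 -{1}VC -CV convolA.
by rewrite -(convolA V _ (Wg z)) -(convolA V _ (cycle_power z)) e VC convol1f.
Qed.

End GroupAlgebra.

(** * From moment relations to the Weingarten formula *)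

Section WeingartenFromRelations.
Context {R : realType}.
Local Notation C := R[i].
Variables (n p k : nat).
Implicit Types (pi s t u : 'S_k).
Notation I := {ffun 'I_k -> 'I_p}.
Notation J := {ffun 'I_k -> 'I_n}.

Lemma permfM m (A : finType) (i : {ffun 'I_m -> A}) (s t : 'S_m) :
  permf (permf i s) t = permf i (t * s)%g.
Proof. by apply/ffunP => r; rewrite !ffunE permM. Qed.

Lemma permf1 m (A : finType) (i : {ffun 'I_m -> A}) : permf i 1%g = i.
Proof. by apply/ffunP => r; rewrite !ffunE perm1. Qed.

(** Permuting slots commutes with the action of matrices on them; the two sums agree term by term
    once slots are renumbered by [s]. *)
Lemma delta_gl_invariant s :
  gl_invariant (fun i i' : I => (permf i s == i')%:R : C).
Proof.
move=> i i' b c; rewrite (reindex_inj (@perm_inj _ s)) /=; apply: eq_bigr => r _.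
rewrite -!natrM !mulnb; congr (_%:R : C); congr nat_of_bool.
apply/andP/andP => -[/eqP e1 /eqP/ffunP e2]; split; apply/eqP.
- by have := e2 r; rewrite !ffunE eqxx.
- apply/ffunP => x; have := e2 x; rewrite !ffunE (inj_eq perm_inj).
  by case: eqP => [->|//].
- by have := e2 r; rewrite !ffunE eqxx.
- apply/ffunP => x; have := e2 x; rewrite !ffunE (inj_eq perm_inj).
  by case: eqP => [->|//].
Qed.

Lemma sum_delta_permf s pi :
  \sum_(l : I) (permf l s == permf l pi)%:R = p%:R ^+ #|porbits (s^-1 * pi)%g| :> C.
Proof.
rewrite -natrX -[in RHS](card_ord p) -card_invariant_ffun -sum1_card natr_sum.
rewrite [RHS]big_mkcond; apply: eq_bigr => l _ /=; rewrite inE.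
suff -> : (permf l (s^-1 * pi) == l)%g = (permf l s == permf l pi) by case: eqP.
apply/eqP/eqP => e.
  by rewrite -{1}e permfM mulKVg.
by rewrite -permfM -e permfM mulVg permf1.
Qed.

(** [M] will be the moments of the pseudo-inverse and [S m] those of order [m] of the inverse Gram
    matrix, in the slots below [m]. The last relation reads [(q - J_m) S (m+1) = delta * S m], with
    [J_m] permuting the slots of [j']. *)
Lemma weingarten_of_relations (q : nat)
    (M : I -> I -> J -> J -> C) (S : nat -> J -> J -> C) :
  (0 < k)%N -> (k <= p)%N -> (k <= q)%N ->
  (forall j j', gl_invariant (fun i i' => M i i' j j')) ->
  (forall j j' pi, \sum_l M l (permf l pi) j j' = S k j (permf j' pi^-1%g)) ->
  (forall j j', S 0 j j' = 1) ->
  (forall (m : 'I_k) j j',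
     q%:R * S m.+1 j j' - \sum_(s < k | (s < m)%N) S m.+1 j (permf j' (tperm s m))
     = (j m == j' m)%:R * S m j j') ->
  forall i i' j j', M i i' j j' =
    (-1) ^+ k * \sum_(sigma : 'S_k) \sum_(rho : 'S_k)
      (permf i sigma == i')%:R * Wg2 p%:R (- q%:R) (comp_perm sigma^-1%g rho)
      * (permf j rho == j')%:R.
Proof.
move=> k0 kp kq Minv MS S0 SB.
pose z : C := - q%:R.
have kz : k%:R <= `|z| by rewrite normrN normr_nat ler_nat.
have kpC : k%:R <= `|p%:R : C| by rewrite normr_nat ler_nat.
have z0 : z != 0 by rewrite -normr_gt0 (lt_le_trans _ kz) // ltr0n.
(* In ['S_k] an element of [fixes_above m] has at least [k - m] fixed points, so the sum over it is
   [z^(k-m)] times the product of the first [m] factors [z + J_r]; the prefactor [z^m] makes the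
   power of [z] independent of [m]. *)
have SJ (m : nat) j j' : (m <= k)%N ->
    (-1) ^+ m * (z ^+ m * \sum_(pi : 'S_k | pi \in fixes_above m) z ^+ #|porbits pi| * S m j (permf j' pi))
    = z ^+ k * (\prod_(s < k | (s < m)%N) (j s == j' s)%:R).
  elim: m => [|m IH] mk.
    rewrite !mul1r (big_pred1 1%g) => [|pi]; last exact: fixes_above0.
    by rewrite card_porbits1 S0 mulr1 big_pred0 // mulr1.
  have := IH (ltnW mk); pose m' := Ordinal mk => IHm.
  rewrite (bigD1 m') ?leqnn //=.
  rewrite (eq_bigl (fun s : 'I_k => (s < m)%N)); last first.
    by move=> s; rewrite ltnS -val_eqE /= andbC -ltn_neqAle.
  rewrite [RHS]mulrCA -IHm [z ^+ m.+1]exprSr -mulrA.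
  rewrite (@jucys_step _ _ z m' (fun pi => S m.+1 j (permf j' pi))).
  rewrite !mulr_sumr; apply: eq_bigr => pi /fixes_aboveP fpi.
  have := SB m' j (permf j' pi); rewrite ffunE fpi // => e.
  have -> : z * S m.+1 j (permf j' pi) +
      \sum_(s < k | (s < m')%N) S m.+1 j (permf j' (tperm s m' * pi)%g) =
      - ((j m' == j' m')%:R * S m j (permf j' pi)).
    rewrite -e opprB addrC mulNr; congr (_ - _).
    by apply: eq_bigr => s _; rewrite permfM.
  rewrite exprS mulN1r !mulrN mulNr opprK [RHS]mulrCA; congr (_ * _).
  by rewrite [RHS]mulrCA; congr (_ * _); rewrite mulrCA.
have prod_eq (u v : J) : \prod_s (u s == v s)%:R = (u == v)%:R :> C.
  case: eqP => [->|/eqP uv]; first by rewrite big1 // => s _; rewrite eqxx.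
  have /existsP[s us] : [exists s, u s != v s].
    rewrite -negb_forall; apply: contra uv => /forallP e.
    by apply/eqP/ffunP => s; apply/eqP.
  by rewrite (bigD1 s) //= (negbTE us) mul0r.
move=> i i' j j'.
(* The inverse in [sf] matches the contraction of [M] by [pi], and [d] is the product of deltas as a
   function on the group. The recursion becomes: [z^kappa] convolved with [sf] is [(-1)^k d]. *)
pose sf : {ffun 'S_k -> C} := [ffun pi => S k j (permf j' pi^-1%g)].
pose d : {ffun 'S_k -> C} := [ffun tau => (permf j tau == j')%:R].
have [Vz _ _] := @Wg_inverse R k z kz.
have [Vp Wpcl Wpinv] := @Wg_inverse R k p%:R kpC.
have Vp' : convol (cycle_power p%:R) (Wg p%:R) = convol_one :> {ffun 'S_k -> C}.
  by rewrite convol_class //; exact: cycle_power_class.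
have [_ Wzcl Wzinv] := @Wg_inverse R k z kz.
have Csf tau : convol (cycle_power z) sf tau = (-1) ^+ k * d tau.
  have := SJ k j (permf j' tau^-1%g) (leqnn k).
  rewrite mulrCA => /(mulfI (expf_neq0 _ z0)).
  rewrite [X in _ = X -> _](eq_bigl xpredT) => [|s]; last by rewrite ltn_ord.
  rewrite prod_eq [d _]ffunE (eq_bigl xpredT) => [|s]; last exact: fixes_abovek.
  have -> : (j == permf j' tau^-1%g) = (permf j tau == j').
    apply/eqP/eqP => [->|<-]; by rewrite permfM (mulgV, mulVg) permf1.
  move=> <-; rewrite mulrA -exprMn mulrNN mulr1 expr1n mul1r convolE.
  apply: eq_bigr => pi _; rewrite !ffunE permfM; congr (_ * S k j (permf j' _)).
  by rewrite invMg invgK.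
have sfE tau : sf tau = (-1) ^+ k * convol (Wg z) d tau.
  rewrite -[sf]convol1f -Vz -convolA !convolE mulr_sumr; apply: eq_bigr => t _.
  by rewrite Csf mulrCA.
pose c := convol (Wg p%:R) sf.
have cE s : c s = (-1) ^+ k * \sum_rho Wg2 p%:R z (comp_perm s^-1%g rho) * d rho.
  rewrite /c.
  have -> : convol (Wg p%:R) sf s = (-1) ^+ k * convol (Wg2 p%:R z) d s.
    rewrite /Wg2 -convolA !convolE mulr_sumr; apply: eq_bigr => t _.
    by rewrite sfE mulrCA.
  have Wcl : class_function (Wg2 p%:R z : {ffun 'S_k -> C}) by exact: convol_class_function.
  have WV pi : Wg2 p%:R z pi^-1%g = Wg2 p%:R z pi :> C by exact: convolV.
  congr (_ * _); rewrite convolE.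
  rewrite (reindex_inj (inj_comp (mulIg s) invg_inj)) /=; apply: eq_bigr => r _.
  rewrite invMg invgK mulKVg /comp_perm -(WV (r * s^-1)%g) invMg invgK.
  by rewrite (class_functionC _ _ Wcl).
(* The candidate: a combination of the invariant tensors [delta_s], with coefficients [c] chosen so
   that its contractions, the convolution of [c] with [p^kappa], equal [sf]. *)
pose N (u u' : I) := \sum_s (permf u s == u')%:R * c s.
have Ninv : gl_invariant N.
  move=> u u' b a; rewrite /N.
  under eq_bigr do rewrite mulr_sumr.
  under [RHS]eq_bigr do rewrite mulr_sumr.
  rewrite exchange_big [RHS]exchange_big /=; apply: eq_bigr => s _.
  under eq_bigr do rewrite mulrA; under [RHS]eq_bigr do rewrite mulrA.
  by rewrite -!mulr_suml delta_gl_invariant.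
have MN : M i i' j j' - N i i' = 0.
  pose D (u u' : I) := M u u' j j' - N u u'.
  suff D0 : forall u u' : I, D u u' = 0 by exact: D0.
  apply: gl_invariant_eq0; rewrite /D.
  - by rewrite card_ord.
  - move=> u u' b a.
    under eq_bigr do rewrite mulrBr; under [RHS]eq_bigr do rewrite mulrBr.
    by rewrite !sumrB Minv Ninv.
  - move=> pi; rewrite sumrB MS exchange_big /=.
    apply/eqP; rewrite subr_eq0; apply/eqP.
    rewrite [RHS](eq_bigr (fun s => c s * p%:R ^+ #|porbits (s^-1 * pi)%g|)); last first.
      by move=> s _; rewrite -mulr_suml sum_delta_permf mulrC.
    transitivity (convol c (cycle_power p%:R) pi).
      rewrite -convol_class; last exact: cycle_power_class.
      by rewrite /c convolA Vp' convol1f ffunE.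
    rewrite convolE; apply: eq_bigr => s _; rewrite [cycle_power _ _]ffunE.
    by rewrite -(card_porbitsJ (s^-1 * pi)%g s^-1%g) conjgE invgK !mulgA mulgV mul1g.
move/eqP: MN; rewrite subr_eq0 => /eqP ->.
rewrite /N mulr_sumr; apply: eq_bigr => s _.
rewrite cE mulrCA; congr (_ * _); rewrite mulr_sumr; apply: eq_bigr => r _.
by rewrite [d _]ffunE mulrA.
Qed.
End WeingartenFromRelations.

(** * Regularised inverses and pseudo-inverses *)

Section Adjoint.
Context {C : numClosedFieldType}.

Lemma adjmxE m n (A : 'M[C]_(m, n)) i j : (A^t*) i j = (A j i)^*.
Proof. by rewrite !mxE. Qed.

Lemma adjmxM m n p (A : 'M[C]_(m, n)) (B : 'M[C]_(n, p)) : (A *m B)^t* = B^t* *m A^t*.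
Proof. by rewrite trmx_mul map_mxM. Qed.

Lemma adjmxD m n (A B : 'M[C]_(m, n)) : (A + B)^t* = A^t* + B^t*.
Proof. by rewrite linearD /= map_mxD. Qed.

Lemma adjmxZ m n (a : C) (A : 'M[C]_(m, n)) : (a *: A)^t* = a^* *: A^t*.
Proof. by rewrite linearZ /= map_mxZ. Qed.

Lemma adjmxK m n (A : 'M[C]_(m, n)) : (A^t*)^t* = A.
Proof. by apply/matrixP => i j; rewrite !adjmxE conjCK. Qed.

Lemma adjmx_inv n (A : 'M[C]_n) : (invmx A)^t* = invmx (A^t*).
Proof. by rewrite trmx_inv map_invmx. Qed.

Lemma adj_mul_diag m n (A : 'M[C]_(m, n)) j : (A^t* *m A) j j = \sum_i `|A i j| ^+ 2.
Proof. by rewrite mxE; apply: eq_bigr => i _; rewrite adjmxE normCK mulrC. Qed.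

Lemma adj_mul_ge0 m n (A : 'M[C]_(m, n)) j : 0 <= (A^t* *m A) j j.
Proof. by rewrite adj_mul_diag sumr_ge0 // => i _; rewrite exprn_ge0. Qed.

End Adjoint.

Section Resolvent.
Context {C : numClosedFieldType} {n p : nat}.
Implicit Types (M : 'M[C]_(n, p)) (e : C).

(* At [e = 0] these are the inverse and the pseudo-inverse only if [M M^*] is
   invertible: [invmx] returns a singular matrix unchanged. *)
Definition shifted_gram e M : 'M[C]_n := M *m M^t* + e%:M.
Definition resolvent e M : 'M[C]_n := invmx (shifted_gram e M).
Definition reg_pinv e M : 'M[C]_(p, n) := M^t* *m resolvent e M.

Lemma shifted_gram_adj e M : 0 <= e -> (shifted_gram e M)^t* = shifted_gram e M.
Proof.
move=> e0; rewrite /shifted_gram adjmxD adjmxM adjmxK; congr (_ + _).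
by rewrite tr_scalar_mx map_scalar_mx /= geC0_conj.
Qed.

Lemma shifted_gram_unit e M : 0 < e -> shifted_gram e M \in unitmx.
Proof.
move=> e0; rewrite -row_free_unit; apply: inj_row_free => v vA.
have : (v *m shifted_gram e M *m v^t*) 0 0 = 0 by rewrite vA mul0mx mxE.
rewrite /shifted_gram mulmxDr mulmxDl mxE mul_mx_scalar -scalemxAl [X in _ + X]mxE.
have h m (w : 'rV[C]_m) : (w *m w^t*) 0 0 = \sum_j `|w 0 j| ^+ 2.
  by rewrite mxE; apply: eq_bigr => j _; rewrite adjmxE normCK.
have -> : v *m (M *m M^t*) *m v^t* = (v *m M) *m (v *m M)^t* by rewrite adjmxM !mulmxA.
have h0 m (w : 'rV[C]_m) : 0 <= \sum_j `|w 0 j| ^+ 2.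
  by apply: sumr_ge0 => *; rewrite exprn_ge0.
rewrite !h => /eqP; rewrite paddr_eq0 ?mulr_ge0 ?(ltW e0) //.
move=> /andP[_]; rewrite mulf_eq0 gt_eqF //= psumr_eq0 => [|j _]; last by rewrite exprn_ge0.
move=> /allP v0; apply/rowP => j; rewrite mxE.
by have := v0 j (mem_index_enum _); rewrite /= expf_eq0 /= normr_eq0 => /eqP.
Qed.

Section Fixed.
Variables (e : C) (M : 'M[C]_(n, p)).
(** Two situations are covered at once: [e > 0], where [uA] is automatic, and [e = 0] with an
    invertible Gram matrix. *)
Hypotheses (e0 : 0 <= e) (uA : shifted_gram e M \in unitmx).
Local Notation R := (resolvent e M).
Local Notation Y := (reg_pinv e M).

Lemma resolvent_adj : R^t* = R.
Proof. by rewrite adjmx_inv shifted_gram_adj. Qed.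

Lemma resolventJ i j : (R i j)^* = R j i.
Proof. by rewrite -adjmxE resolvent_adj. Qed.

Lemma reg_pinv_adj : Y^t* = R *m M.
Proof. by rewrite adjmxM resolvent_adj adjmxK. Qed.

Lemma gram_resolvent : M *m Y = 1%:M - e *: R.
Proof.
rewrite mulmxA; apply/eqP; rewrite -(inj_eq (addIr (e *: R))) subrK; apply/eqP.
by rewrite -mul_scalar_mx -mulmxDl mulmxV.
Qed.

(** From [R = R (M M^* + e) R]: the resolvent is a sum of two positive semidefinite matrices, the
    source of all the positivity below. *)
Lemma resolventE : R = Y^t* *m Y + e *: (R *m R).
Proof.
by rewrite reg_pinv_adj -mulmxA gram_resolvent mulmxBr mulmx1 -scalemxAr subrK.
Qed.

Lemma resolvent_diag j : R j j = \sum_i `|Y i j| ^+ 2 + e * \sum_l `|R l j| ^+ 2.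
Proof.
rewrite {1}resolventE mxE adj_mul_diag mxE; congr (_ + _ * _).
by rewrite -{1}resolvent_adj adj_mul_diag.
Qed.

Lemma reg_pinv_col_ge0 j : 0 <= \sum_i `|Y i j| ^+ 2.
Proof. by apply: sumr_ge0 => *; rewrite exprn_ge0. Qed.

Lemma resolvent_col_ge0 j : 0 <= \sum_l `|R l j| ^+ 2.
Proof. by apply: sumr_ge0 => *; rewrite exprn_ge0. Qed.

Lemma resolvent_diag_ge0 j : 0 <= R j j.
Proof. by rewrite resolvent_diag addr_ge0 ?reg_pinv_col_ge0 ?mulr_ge0 ?resolvent_col_ge0. Qed.

Lemma reg_pinv_le_diag i j : `|Y i j| ^+ 2 <= R j j.
Proof.
rewrite resolvent_diag (bigD1 i) //= -addrA lerDl addr_ge0 ?mulr_ge0 ?resolvent_col_ge0 //.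
by apply: sumr_ge0 => *; rewrite exprn_ge0.
Qed.

Lemma resolvent_psd (x : 'cV[C]_n) : 0 <= (x^t* *m R *m x) 0 0.
Proof.
rewrite resolventE mulmxDr mulmxDl mxE -scalemxAr -scalemxAl [X in _ + X]mxE.
rewrite addr_ge0 //.
  have -> : x^t* *m (Y^t* *m Y) *m x = (Y *m x)^t* *m (Y *m x) by rewrite adjmxM !mulmxA.
  exact: adj_mul_ge0.
rewrite mulr_ge0 //.
have -> : x^t* *m (R *m R) *m x = (R *m x)^t* *m (R *m x).
  by rewrite adjmxM resolvent_adj !mulmxA.
exact: adj_mul_ge0.
Qed.

Lemma resolvent_diag0 l j : R j j = 0 -> R l j = 0.
Proof.
rewrite resolvent_diag => /eqP; rewrite paddr_eq0 ?reg_pinv_col_ge0 ?mulr_ge0 ?resolvent_col_ge0 //.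
move=> /andP[/eqP Y0 /eqP R0].
have Yj i : Y i j = 0.
  have : \sum_i `|Y i j| ^+ 2 == 0 by rewrite Y0.
  rewrite psumr_eq0 => [|*]; last by rewrite exprn_ge0.
  by move=> /allP /(_ i (mem_index_enum _)); rewrite /= expf_eq0 /= normr_eq0 => /eqP.
(* As [e] may be 0, only the product of [e] with the entries of [R] is known to vanish, which is
   enough for [resolventE]. *)
have eR m : e * R m j = 0.
  move/eqP: R0; rewrite mulf_eq0 => /orP[/eqP -> //|]; first by rewrite mul0r.
  rewrite psumr_eq0 => [|*]; last by rewrite exprn_ge0.
  move=> /allP /(_ m (mem_index_enum _)); rewrite /= expf_eq0 /= normr_eq0 => /eqP ->.
  by rewrite mulr0.
rewrite resolventE !mxE big1 => [|i _]; last by rewrite Yj mulr0.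
rewrite add0r mulr_sumr big1 // => m _; by rewrite mulrCA eR mulr0.
Qed.

Lemma resolvent_cauchy l j : `|R l j| ^+ 2 <= R l l * R j j.
Proof.
have [lj|lj] := eqVneq l j.
  by rewrite lj -normrX ger0_norm ?expr2 // mulr_ge0 // resolvent_diag_ge0.
have [j0|j0] := eqVneq (R j j) 0.
  by rewrite resolvent_diag0 // normr0 expr0n j0 mulr0.
have jgt : 0 < R j j by rewrite lt_neqAle eq_sym j0 resolvent_diag_ge0.
have psd2 (a b : C) : 0 <= a^* * a * R l l + a^* * b * R l j + b^* * a * R j l + b^* * b * R j j.
  pose x : 'cV[C]_n := \col_m (if m == l then a else if m == j then b else 0).
  have := resolvent_psd x; set lhs := _ 0 0; suff -> : lhs = a^* * a * R l l +
    a^* * b * R l j + b^* * a * R j l + b^* * b * R j j by [].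
  have sum2 (f : 'I_n -> C) : (forall m, m != l -> m != j -> f m = 0) ->
      \sum_m f m = f l + f j.
    move=> f0; rewrite (bigD1 l) //= (bigD1 j) 1?eq_sym //= big1 ?addr0 // => m /andP[? ?].
    exact: f0.
  have xl : x l 0 = a by rewrite mxE eqxx.
  have xj : x j 0 = b by rewrite mxE eq_sym (negbTE lj) eqxx.
  have xo m : m != l -> m != j -> x m 0 = 0 by rewrite mxE => /negbTE -> /negbTE ->.
  have rowE m : (x^t* *m R) 0 m = a^* * R l m + b^* * R j m.
    rewrite mxE sum2 => [|m' ml mj]; first by rewrite !adjmxE xl xj.
    by rewrite adjmxE xo // conjC0 mul0r.
  rewrite /lhs mxE sum2 => [|m ml mj]; last by rewrite xo // mulr0.
  rewrite !rowE xl xj; clear; ring.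
(* Up to scale, the minimising vector of the 2 by 2 form: its value is [R j j] times the
   determinant. *)
have := psd2 (R j j) (- R j l).
rewrite geC0_conj ?resolvent_diag_ge0 // rmorphN /= resolventJ.
set rjj := R j j; set rll := R l l; set rlj := R l j; set rjl := R j l.
have -> : rjj * rjj * rll + rjj * - rjl * rlj + - rlj * rjj * rjl +
    - rlj * - rjl * rjj = rjj * (rll * rjj - rlj * rjl) by clear; ring.
rewrite pmulr_rge0 // subr_ge0 => h.
by rewrite normCK resolventJ.
Qed.

Definition rtr := \sum_j R j j.

Lemma rtr_ge0 : 0 <= rtr.
Proof. by apply: sumr_ge0 => j _; exact: resolvent_diag_ge0. Qed.

Lemma resolvent_diag_le_rtr j : R j j <= rtr.
Proof.
by rewrite /rtr (bigD1 j) //= lerDl sumr_ge0 // => *; exact: resolvent_diag_ge0.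
Qed.

Lemma resolvent_le_rtr l j : `|R l j| <= rtr.
Proof.
rewrite -(@ler_pXn2r _ 2) ?nnegrE ?rtr_ge0 // (le_trans (resolvent_cauchy l j)) //.
by rewrite expr2 ler_pM ?resolvent_diag_ge0 ?resolvent_diag_le_rtr.
Qed.

Lemma reg_pinv_le_rtr i j : `|Y i j| ^+ 2 <= rtr.
Proof. exact: le_trans (reg_pinv_le_diag i j) (resolvent_diag_le_rtr j). Qed.

Lemma tr_resolvent2 : \tr (R *m R) <= rtr ^+ 2.
Proof.
have -> : \tr (R *m R) = \sum_j \sum_l `|R l j| ^+ 2.
  by apply: eq_bigr => j _; rewrite -{1}resolvent_adj adj_mul_diag.
rewrite expr2 {2}/rtr mulr_sumr ler_sum // => j _.
by rewrite mulr_suml ler_sum // => l _; exact: resolvent_cauchy.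
Qed.

Lemma tr_resolvent3 : 0 <= \tr (R *m R *m R).
Proof.
apply: sumr_ge0 => j _; have := resolvent_psd (col j R).
congr (_ <= _); rewrite !mxE; apply: eq_bigr => m _; rewrite [col _ _ _ _]mxE; congr (_ * _).
by rewrite !mxE; apply: eq_bigr => l _; rewrite adjmxE mxE resolventJ.
Qed.

(** Multiply by [R j j]: the right side of [resolvent_diag] contains the term [e * R j j ^ 2]. *)
Lemma resolvent_diag_le j : e * R j j <= 1.
Proof.
have [j0|j0] := eqVneq (R j j) 0; first by rewrite j0 mulr0.
have jgt : 0 < R j j by rewrite lt_neqAle eq_sym j0 resolvent_diag_ge0.
rewrite -(ler_pM2r jgt) mul1r -mulrA -expr2 [leRHS]resolvent_diag.
rewrite ler_wpDl ?reg_pinv_col_ge0 // ler_wpM2l // (bigD1 j) //= ler_wpDr //.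
  by apply: sumr_ge0 => *; rewrite exprn_ge0.
by rewrite ger0_norm ?resolvent_diag_ge0.
Qed.

Lemma e_rtr_le : e * rtr <= n%:R.
Proof.
rewrite mulr_sumr -[n in leRHS]card_ord -sum1_card natr_sum ler_sum // => j _.
exact: resolvent_diag_le.
Qed.

End Fixed.
End Resolvent.

Section ResolventLimit.
Context {C : numClosedFieldType} {n p : nat}.
Variables (e : C) (M : 'M[C]_(n, p)).
Hypothesis e0 : 0 < e.
Let uA : shifted_gram e M \in unitmx. Proof. exact: shifted_gram_unit. Qed.
Local Notation Re := (resolvent e M).
Local Notation R0 := (resolvent 0 M).

Lemma shifted_gram_add : shifted_gram e M = shifted_gram 0 M + e%:M.
Proof. by rewrite /shifted_gram raddf0 addr0. Qed.

Section Invertible.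
Hypothesis uW : shifted_gram 0 M \in unitmx.

Lemma resolvent_diff : R0 - Re = e *: (R0 *m Re).
Proof.
have h : R0 *m shifted_gram e M *m Re = R0 by rewrite -mulmxA mulmxV ?mulmx1.
rewrite -{1}h shifted_gram_add mulmxDr mulVmx // mulmxDl mul1mx addrAC subrr add0r.
by rewrite mul_mx_scalar -scalemxAl.
Qed.

Lemma reg_pinv_diff : reg_pinv 0 M - reg_pinv e M = e *: (reg_pinv 0 M *m Re).
Proof. by rewrite -mulmxBr resolvent_diff -scalemxAr mulmxA. Qed.

(** By the resolvent identity the difference is [e] times the trace of [R0 *m Re], a sum of values
    of the form [Re] at the rows of [reg_pinv 0 M]. The trace at [e = 0] thereby dominates all the
    regularised ones. *)
Lemma le_rtr0 : rtr e M <= rtr 0 M.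
Proof.
rewrite -subr_ge0 /rtr -sumrB.
have -> : \sum_i (R0 i i - Re i i) = \tr (R0 - Re) by apply: eq_bigr => i _; rewrite !mxE.
rewrite resolvent_diff mxtraceZ; apply: mulr_ge0; first exact: ltW.
have {1}-> := resolventE (lexx 0) uW; rewrite scale0r addr0 -mulmxA mxtrace_mulC.
apply: sumr_ge0 => i _.
have := resolvent_psd (ltW e0) uA ((row i (reg_pinv 0 M))^t*).
rewrite adjmxK; congr (_ <= _).
rewrite -row_mul !mxE; apply: eq_bigr => j _; rewrite mxE adjmxE; congr (_ * _).
by rewrite mxE adjmxE.
Qed.

End Invertible.

End ResolventLimit.

(** A left null vector [v] of the Gram matrix satisfies [v R = v / e], so its nonzero entry [v 0 l]
    is, in modulus, at most [e * rtr e M] times the l1 norm of [v]. *)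
Lemma singular_gram_rtr (C : numClosedFieldType) n p (M : 'M[C]_(n, p)) :
  shifted_gram 0 M \notin unitmx ->
  exists2 c : C, 0 < c & forall e, 0 < e -> c <= e * rtr e M.
Proof.
rewrite -row_free_unit => /negP nu.
have [v vW v0] : exists2 v : 'rV[C]_n, v *m shifted_gram 0 M = 0 & v != 0.
  apply: contrapT => h; apply: nu; apply: inj_row_free => v vW.
  by apply/eqP; apply/negPn/negP => v0; apply: h; exists v.
have [l vl] : exists l, v 0 l != 0.
  apply: contrapT => h; move/eqP: v0; apply; apply/rowP => l; rewrite mxE.
  by apply/eqP/negPn/negP => vl; apply: h; exists l.
pose s := \sum_m `|v 0 m|.
have s0 : 0 < s.
  rewrite (lt_le_trans (y := `|v 0 l|)) ?normr_gt0 // /s (bigD1 l) //= lerDl.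
  by apply: sumr_ge0.
exists (`|v 0 l| / s); first by rewrite divr_gt0 ?normr_gt0.
move=> e e0; have uA := shifted_gram_unit M e0.
have vA : v *m resolvent e M = e^-1 *: v.
  have : v *m shifted_gram e M = e *: v.
    by rewrite (shifted_gram_add e) mulmxDr vW add0r mul_mx_scalar.
  move=> /(congr1 (fun x => e^-1 *: (x *m resolvent e M))).
  by rewrite mulmxK // -scalemxAl scalerA mulVf ?gt_eqF // scale1r => <-.
have vl' : v 0 l = e * \sum_m v 0 m * resolvent e M m l.
  have := congr1 (fun x : 'rV_n => x 0 l) vA; rewrite !mxE => ->.
  by rewrite mulrA divff ?gt_eqF // mul1r.
rewrite ler_pdivrMr // vl' normrM (ger0_norm (ltW e0)) -mulrA ler_pM2l //.
rewrite (le_trans (ler_norm_sum _ _ _)) // mulrC /s mulr_suml ler_sum // => m _.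
by rewrite normrM ler_wpM2l // resolvent_le_rtr // ltW.
Qed.

(** * Singular values, pseudo-inverses and square roots *)

Section PseudoInverse.
Context {R : realType}.
Local Notation C := R[i].

(** Functional calculus on singular values; the inverse and the inverse cube are the two instances
    used. *)
Lemma diag_fun_gram m n (D : 'M[C]_(m, n)) (f : C -> C) : f 0 = 0 -> is_diag_mx D ->
  (\matrix_(a, i) f (D i a) : 'M[C]_(n, m)) *m D *m D^t* =
  \matrix_(a, b) (f (D b a) * D b a * (D b a)^*).
Proof.
move=> f0 /is_diag_mxP Dd; apply/matrixP => a b.
have nz i (j : 'I_n) : D i j != 0 -> i = j :> nat.
  by move=> Dij; apply/eqP; apply: contraNT Dij => /Dd ->.
rewrite !mxE (bigD1 a) //= big1 => [|c ca]; last first.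
  rewrite mxE big1 ?mul0r // => i _; rewrite mxE.
  have [Dia|Dia] := eqVneq (D i a) 0; first by rewrite Dia f0 mul0r.
  have [Dic|Dic] := eqVneq (D i c) 0; first by rewrite Dic mulr0.
  by move: ca; rewrite -val_eqE /= -(nz _ _ Dia) -(nz _ _ Dic) eqxx.
rewrite addr0 mxE adjmxE.
have [Dba|Dba] := eqVneq (D b a) 0; first by rewrite Dba conjC0 !mulr0.
congr (_ * _); rewrite (bigD1 b) //= mxE big1 ?addr0 // => i ib; rewrite mxE.
have [->|Dia] := eqVneq (D i a) 0; first by rewrite mulr0.
by move: ib; rewrite -val_eqE /= (nz _ _ Dia) -(nz _ _ Dba) eqxx.
Qed.

Lemma svd_fun_gram m n (A : 'M[C]_(m, n)) U D V (f : C -> C) : f 0 = 0 -> is_svd A U D V ->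
  V *m (\matrix_(a, i) f (D i a)) *m U^t* *m (A *m A^t*) =
  V *m (\matrix_(a, b) (f (D b a) * D b a * (D b a)^*)) *m U^t*.
Proof.
move=> f0 [uU uV Dd D0 ->]; rewrite -diag_fun_gram // !adjmxM adjmxK !mulmxA.
by rewrite (mulmxKtV _ uU) // (mulmxKtV _ uV).
Qed.

Lemma pinv_mul_gram m n (A : 'M[C]_(m, n)) (B : 'M[C]_(n, m)) :
  is_pseudo_inverse A B -> B *m (A *m A^t*) = A^t*.
Proof.
move=> [U [D [V [svd ->]]]]; rewrite (svd_fun_gram (invr0 _) svd).
have -> : \matrix_(a, b) ((D b a)^-1 * D b a * (D b a)^*) = D^t*.
  apply/matrixP => a b; rewrite mxE adjmxE.
  by have [->|D_neq0] := eqVneq (D b a) 0; rewrite ?conjC0 ?mulr0 // mulVf // mul1r.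
by case: svd => _ _ _ _ ->; rewrite adjmxM adjmxM adjmxK mulmxA.
Qed.

(** The inverse cube of the singular values works, since [d^-3 * d * d = d^-1]. The factorisation
    controls [B] even where the Gram matrix is singular and gives the rate in [pinv_limit]. *)
Lemma pinv_factor_gram m n (A : 'M[C]_(m, n)) (B : 'M[C]_(n, m)) :
  is_pseudo_inverse A B -> exists K, B = K *m (A *m A^t*).
Proof.
move=> [U [D [V [svd ->]]]].
exists (V *m (\matrix_(a, i) (D i a) ^- 3) *m U^t*).
rewrite (svd_fun_gram (f := fun x => x ^- 3) _ svd) ?expr0n ?invr0 //.
congr (_ *m _ *m _); apply/matrixP => a b; rewrite !mxE.
case: svd => _ _ _ D0 _; rewrite geC0_conj //.
have [->|D_neq0] := eqVneq (D b a) 0; first by rewrite !mulr0 invr0.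
by rewrite !exprS expr0 mulr1 !invfM -!mulrA mulKf // mulVf // mulr1.
Qed.

(** The form at [x - t H x] is [t^2 c - 2 t N] with [N] the squared norm of [H x]; its nonnegativity
    for small [t > 0] forces [N = 0]. *)
Lemma psd_null n (H : 'M[C]_n) (x : 'cV[C]_n) : possemidefmx H ->
  (x^t* *m H *m x) 0 0 = 0 -> H *m x = 0.
Proof.
move=> [/is_hermitianmxP]; rewrite expr0 scale1r => Hh Hpos Hx.
pose y := H *m x; have yE : y^t* = x^t* *m H by rewrite adjmxM -Hh.
pose N := (y^t* *m y) 0 0; pose c := (y^t* *m H *m y) 0 0.
have N0 : 0 <= N by exact: adj_mul_ge0.
have c0 : 0 <= c by exact: Hpos.
have key (t : C) : 0 <= t -> 0 <= t ^+ 2 * c - 2 * t * N.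
  move=> t0; have := Hpos (x - t *: y).
  congr (_ <= _); rewrite adjmxD -scaleNr adjmxZ rmorphN /= geC0_conj //.
  rewrite mulmxDl mulmxDr !mulmxDl -!scalemxAr -!scalemxAl.
  rewrite -!mulmxA -/y.
  have -> : x^t* *m (H *m y) = y^t* *m y by rewrite mulmxA -yE.
  have -> : x^t* *m y = 0 by apply/matrixP => a b; rewrite !ord1 mulmxA Hx mxE.
  have -> : y^t* *m (H *m y) = c%:M by rewrite mulmxA; apply/matrixP => a b; rewrite !ord1 [RHS]mxE eqxx.
  have -> : y^t* *m y = N%:M by apply/matrixP => a b; rewrite !ord1 [RHS]mxE eqxx.
  rewrite !mxE !eqxx !mulr1n; clear; ring.
have N_eq0 : N = 0.
  apply/eqP; rewrite eq_le N0 andbT.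
  have c1 : 0 < 1 + c by rewrite ltr_wpDr.
  (* The denominator [1 + c] keeps this choice of [t] valid when [c = 0]. *)
  have t0 : 0 <= N / (1 + c) by rewrite divr_ge0 // ltW.
  have := key _ t0; clear key.
  have -> : (N / (1 + c)) ^+ 2 * c - 2 * (N / (1 + c)) * N =
     - (N ^+ 2 * (2 + c)) / (1 + c) ^+ 2.
    by field; rewrite gt_eqF.
  rewrite pmulr_lge0 ?invr_gt0 ?exprn_gt0 // oppr_ge0 pmulr_lle0 ?ltr_wpDr // => N2.
  by move: N2; rewrite real_exprn_even_le0 ?ger0_real //= => /eqP ->.
apply/colP => i; rewrite [RHS]mxE; apply/eqP; rewrite -normr_eq0.
suff : `|y i 0| ^+ 2 == 0 by rewrite expf_eq0.
move: N_eq0; rewrite /N adj_mul_diag => /eqP; rewrite psumr_eq0 => [/allP|j _].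
  by move=> /(_ i (mem_index_enum _)).
by rewrite exprn_ge0.
Qed.

(** With [D = H - K] one has [H D + D K = 0]; multiplying by [D^*] and taking traces gives a
    vanishing sum of two nonnegative traces. Needed because each column of a Ginibre matrix comes
    with its own square root. *)
Lemma sqrtmx_unique n (S H K : 'M[C]_n) : S \in unitmx ->
  is_sqrtmx S H -> is_sqrtmx S K -> H = K.
Proof.
move=> uS [psdH HS] [psdK KS].
have [/is_hermitianmxP] := psdH; rewrite expr0 scale1r => Hh Hpos.
have [/is_hermitianmxP] := psdK; rewrite expr0 scale1r => Kh Kpos.
pose D := H - K.
have HK : H *m D + D *m K = 0.
  by rewrite mulmxBr mulmxBl HS KS addrA subrK subrr.
have t1 j : 0 <= (D^t* *m H *m D) j j.
  have := Hpos (col j D); congr (_ <= _).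
  by rewrite !mxE; apply: eq_bigr => l _; rewrite [col _ _ _ _]mxE; congr (_ * _);
    rewrite !mxE; apply: eq_bigr => m _; rewrite !adjmxE mxE.
have t2 j : 0 <= (D *m K *m D^t*) j j.
  have := Kpos ((row j D)^t*); rewrite adjmxK; congr (_ <= _).
  by rewrite -row_mul !mxE; apply: eq_bigr => l _; rewrite !adjmxE !mxE.
have tr0 : \tr (D^t* *m H *m D) + \tr (D *m K *m D^t*) = 0.
  by rewrite (mxtrace_mulC (D *m K)) -mxtraceD -mulmxA -mulmxDr HK mulmx0 mxtrace0.
move/eqP: tr0; rewrite paddr_eq0; [|exact: sumr_ge0|exact: sumr_ge0].
move=> /andP[+ _]; rewrite /mxtrace psumr_eq0 => [/allP tD|j _]; last exact: t1.
have HD : H *m D = 0.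
  apply/matrixP => a j; have := psd_null psdH (x := col j D).
  rewrite [_ 0 0](_ : _ = (D^t* *m H *m D) j j); last first.
    by rewrite !mxE; apply: eq_bigr => l _; rewrite [col _ _ _ _]mxE; congr (_ * _);
      rewrite !mxE; apply: eq_bigr => m _; rewrite !adjmxE mxE.
  move=> /(_ (eqP (tD j (mem_index_enum _)))) /colP /(_ a).
  rewrite !mxE => h; rewrite -[RHS]h; by apply: eq_bigr => l _; rewrite [col _ _ _ _]mxE !mxE.
have uH : H \in unitmx by move: uS; rewrite -HS unitmx_mul => /andP[].
have D0 : D = 0 by rewrite -(mulKmx uH D) HD mulmx0.
by apply/eqP; rewrite -subr_eq0 -/D D0.
Qed.

Lemma posdefmx_unit n (S : 'M[C]_n) : posdefmx S -> S \in unitmx.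
Proof.
move=> [_ Spos]; rewrite -unitmx_tr -row_free_unit; apply: inj_row_free => v vS.
apply/eqP/negPn/negP => v0.
have : 0 < (v^T^t* *m S *m v^T) 0 0 by apply: Spos; rewrite trmx_eq0.
by rewrite -mulmxA -[S *m _]trmxK trmx_mul trmxK vS trmx0 mulmx0 mxE ltxx.
Qed.

End PseudoInverse.

Import numFieldNormedType.Exports.
Local Open Scope classical_set_scope.

(** * Gaussian integration by parts *)

Section NormalIBP.
Context {R : realType}.
Local Notation mu := (@lebesgue_measure R).
Local Notation sigma := (Num.sqrt (2^-1 : R)).
Local Notation N := (normal_prob 0 sigma).
Local Notation phi := (normal_pdf 0 sigma : R -> R).

Lemma sigma_neq0 : sigma != 0.
Proof. by rewrite gt_eqF // sqrtr_gt0 invr_gt0. Qed.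

Lemma phiE x : phi x = normal_peak sigma * expR (- x ^+ 2).
Proof.
rewrite normal_pdfE ?sigma_neq0 // /normal_fun subr0 sqr_sqrtr ?invr_ge0 //.
by congr (_ * expR _); field.
Qed.

Local Open Scope ereal_scope.

Lemma ge0_integral_normal (f : R -> \bar R) : (forall x, 0 <= f x) ->
  measurable_fun setT f -> \int[N]_x f x = \int[mu]_x (f x * (phi x)%:E).
Proof.
move=> f0 mf; have dom := normal_prob_dominates (0%R : R) sigma.
rewrite -(Radon_Nikodym_SigmaFinite.change_of_variables dom) //.
have mphi : measurable_fun setT (EFin \o phi).
  by apply/measurable_EFinP; exact: measurable_normal_pdf.
have iRN := Radon_Nikodym_SigmaFinite.f_integrable dom.
apply: ae_eq_integral => //.
- by apply: emeasurable_funM => //; exact: measurable_int iRN.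
- exact: emeasurable_funM.
- apply: ae_eqe_mul2l => /=.
  apply: integral_ae_eq => //.
  by move=> E _ mE; rewrite -Radon_Nikodym_SigmaFinite.f_integral.
Qed.

Lemma integral_normal (f : R -> R) : measurable_fun setT f ->
  \int[N]_x (f x)%:E = \int[mu]_x (f x * phi x)%:E.
Proof.
move=> mf; rewrite [LHS]integralE [RHS]integralE.
have phi0 x : (0 <= phi x)%R by exact: normal_pdf_ge0.
have mEf : measurable_fun setT (EFin \o f) by exact/measurable_EFinP.
congr (_ - _); rewrite ge0_integral_normal //.
- apply: eq_integral => x _; rewrite !funeposE -!EFin_max -EFinM maxr_pMl//.
  by rewrite mul0r.
- exact: measurable_funepos.
- apply: eq_integral => x _; rewrite !funenegE -!EFinN -!EFin_max -EFinM maxr_pMl//.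
  by rewrite mul0r mulNr.
- exact: measurable_funeneg.
Qed.

Local Close Scope ereal_scope.

Lemma phi_ge0 x : 0 <= phi x. Proof. exact: normal_pdf_ge0. Qed.

Lemma poly_le_expR (r : nat) : exists2 c : R, 0 <= c &
  forall x : R, (1 + x ^+ 2) ^+ r <= c * expR (x ^+ 2 / 2).
Proof.
(* The scale [s] makes the exponents of [r+1] copies of [1 + y <= exp y], at [y = (1 + x^2) / s],
   add up to [(1 + x^2) / 2]. Using [r+1] instead of [r] keeps [s] positive. *)
pose s : R := 2 * r.+1%:R.
have s0 : 0 < s by rewrite mulr_gt0.
exists (s ^+ r.+1 * expR 2^-1); first by rewrite mulr_ge0 ?exprn_ge0 ?expR_ge0 // ltW.
move=> x; have x1 : 1 <= 1 + x ^+ 2 by rewrite lerDl sqr_ge0.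
apply: (@le_trans _ _ ((1 + x ^+ 2) ^+ r.+1)); first by rewrite ler_weXn2l.
rewrite -mulrA -expRD.
have -> : 2^-1 + x ^+ 2 / 2 = ((1 + x ^+ 2) / s) *+ r.+1.
  rewrite -mulr_natr /s; set m : R := r.+1%:R.
  have m0 : m != 0 by rewrite pnatr_eq0.
  by field.
rewrite -mulr_natl expRM_natl -exprMn lerXn2r ?nnegrE ?mulr_ge0 ?expR_ge0 ?(ltW s0)//.
  by rewrite (le_trans _ x1).
rewrite -ler_pdivrMl // mulrC (le_trans _ (expR_ge1Dx _)) // lerDr //.
Qed.

(** [phi] decays like [exp (- x^2)]: half of the exponent absorbs the polynomial, the other half is
    the density of variance 1. *)
Lemma poly_phi_bound (r : nat) : exists2 c : R, 0 <= c &
  forall x : R, (1 + x ^+ 2) ^+ r * phi x <= c * normal_pdf 0 1 x.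
Proof.
have [c c0 hc] := poly_le_expR r.
have p1 : 0 < normal_peak (1 : R) by rewrite normal_peak_gt0 ?oner_eq0.
exists (c * normal_peak sigma / normal_peak 1).
  by rewrite divr_ge0 ?mulr_ge0 // ?normal_peak_ge0 // ltW.
move=> x; rewrite phiE normal_pdfE ?oner_eq0 // /normal_fun subr0 expr1n.
rewrite [leRHS]mulrA mulfVK ?gt_eqF // mulrCA -[leRHS]mulrA [leRHS]mulrCA.
rewrite ler_wpM2l ?normal_peak_ge0 //.
apply: (le_trans (ler_wpM2r (expR_ge0 _) (hc x))).
rewrite -mulrA ler_wpM2l // -expRD ler_expR.
rewrite -[1 *+ 2]/2; lra.
Qed.

Definition poly_growth1 (f : R -> R) :=
  exists r c, forall x, `|f x| <= c * (1 + x ^+ 2) ^+ r.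

Lemma poly_growth1_bound f : poly_growth1 f ->
  exists2 c : R, 0 <= c & forall x, `|f x * phi x| <= c * normal_pdf 0 1 x.
Proof.
move=> [r [c fc]]; have [c' c'0 hc'] := poly_phi_bound r.
have c0 : 0 <= c by have := le_trans (normr_ge0 _) (fc 0); rewrite expr0n addr0 expr1n mulr1.
exists (c * c'); first by rewrite mulr_ge0.
move=> x; rewrite normrM (ger0_norm (phi_ge0 x)).
apply: (le_trans (ler_wpM2r (phi_ge0 _) (fc x))).
by rewrite -!mulrA ler_wpM2l.
Qed.

Lemma integrable_poly_phi f : measurable_fun setT f -> poly_growth1 f ->
  mu.-integrable setT (fun x => (f x * phi x)%:E).
Proof.
move=> mf /poly_growth1_bound[c c0 hc].
apply: (@le_integrable _ _ _ mu _ measurableT _ (fun x => (c * normal_pdf 0 1 x)%:E)) => //.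
- apply/measurable_EFinP; apply: measurable_funM => //; exact: measurable_normal_pdf.
- move=> x _ /=; rewrite lee_fin (le_trans (hc x)) // ler_norm //.
- under eq_fun do rewrite EFinM.
  apply: integrableZl => //; exact: integrable_normal_pdf.
Qed.

Lemma integrable_normal f : measurable_fun setT f -> poly_growth1 f ->
  (N : probability _ _).-integrable setT (EFin \o f).
Proof.
move=> mf gf; apply/integrableP; split; first exact/measurable_EFinP.
rewrite ge0_integral_normal //; last first.
  by apply: measurableT_comp => //; exact/measurable_EFinP.
have /integrableP[_] := integrable_poly_phi mf gf.
apply: le_lt_trans; rewrite le_eqVlt; apply/orP; left; apply/eqP.
apply: eq_integral => x _.
by rewrite -EFinM /= normrM (ger0_norm (phi_ge0 _)).
Qed.

(** [e] is a sign, so that both ends of the real line are treated together. *)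
Lemma phi_cvg0 (e : R) : e ^+ 2 = 1 ->
  normal_pdf 0 1 (e * n%:R) @[n --> \oo] --> (0 : R).
Proof.
move=> e2.
apply: (@squeeze_cvgr _ _ _ _ (cst 0) (fun n => normal_peak 1 * (2 * n.+1%:R^-1))).
- apply: nearW => n; rewrite normal_pdf_ge0 /=.
  rewrite normal_pdfE ?oner_eq0 // ler_wpM2l ?normal_peak_ge0 //.
  rewrite /normal_fun subr0 exprMn e2 mul1r expr1n mulNr expRN.
  rewrite -[leRHS]invrK invfM invrK lef_pV2 ?posrE ?expR_gt0 ?mulr_gt0 ?invr_gt0 //.
  apply: le_trans (expR_ge1Dx _); rewrite -[1 *+ 2]/(2 : R) (_ : n.+1%:R = n%:R + 1 :> R) ?natr1 //.
  have := sqr_ge0 (n%:R - 1 / 2 : R); nra.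
- exact: cvg_cst.
- rewrite -[0](mulr0 (normal_peak 1)) -{1}[0](mulr0 (2:R)).
  by apply: cvgM; [exact: cvg_cst|apply: cvgM; [exact: cvg_cst|exact: cvg_harmonic]].
Qed.

Lemma integral_itv_cvg (g : R -> R) : mu.-integrable setT (EFin \o g) ->
  (\int[mu]_(x in `[(- n%:R)%R, n%:R%R]) (g x)%:E)%E @[n --> \oo] --> (\int[mu]_x (g x)%:E)%E.
Proof.
move=> ig; have mg : measurable_fun setT (EFin \o g) by exact: measurable_int ig.
under eq_fun do rewrite integral_mkcond.
have := @dominated_convergence _ _ _ mu _ measurableT
  (fun n => (EFin \o g) \_ `[- n%:R, n%:R]) (EFin \o g) (abse \o (EFin \o g)).
case=> //.
- move=> n; apply/(measurable_restrictT _ _).1 => //.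
  exact: measurable_funTS.
- apply: aeW => x _; apply: cvg_near_cst; near=> n.
  rewrite patchE ifT // inE /= in_itv /= -ler_norml.
  near: n; exact: nbhs_infty_ger.
- by apply: integrable_abse.
- apply: aeW => x n _ /=; rewrite patchE; case: ifPn => // _.
  by rewrite abse0.
Unshelve. all: by end_near.
Qed.

(** [f * phi / 2] has derivative [(f' / 2 - x f) phi], because variance 1/2 gives
    [phi' = - 2 x phi]. The fundamental theorem of calculus is applied on growing intervals, and the
    decay of [phi] kills the boundary terms. *)
Lemma ibp_normal (f f' : R -> R) : (forall x : R, is_derive x 1 f (f' x)) ->
  continuous f' -> poly_growth1 f -> poly_growth1 f' ->
  (\int[N]_x (x * f x)%:E = \int[N]_x (2^-1 * f' x)%:E)%E.
Proof.
move=> df cf' gf gf'.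
have cf : continuous f.
  by move=> x; apply: differentiable_continuous; apply/derivable1_diffP; case: (df x).
have mf : measurable_fun setT f by exact: continuous_measurable_fun.
have mf' : measurable_fun setT f' by exact: continuous_measurable_fun.
have dphi (x : R) : is_derive x 1 phi (- 2 * x * phi x).
  have -> : phi = (fun x => normal_peak sigma * expR (- x ^+ 2)).
    by apply/funext => y; exact: phiE.
  by apply: is_derive_eq; rewrite /GRing.scale /=; ring.
pose h x := 2^-1 * f' x - x * f x.
have dg (x : R) : is_derive x 1 (fun x => 2^-1 * (f x * phi x)) (h x * phi x).
  by apply: is_derive_eq; rewrite /h /GRing.scale /=; field.
have gxf : poly_growth1 (fun x => x * f x).
  have [r [c fc]] := gf; exists r.+1; exists c; move=> x.
  have c0 : 0 <= c by have := le_trans (normr_ge0 _) (fc 0); rewrite expr0n addr0 expr1n mulr1.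
  rewrite exprS normrM mulrCA; apply: ler_pM => //.
  by rewrite ler_norml; apply/andP; split; nra.
have gf2 : poly_growth1 (fun x => 2^-1 * f' x).
  have [r [c fc]] := gf'; exists r; exists (2^-1 * c); move=> x.
  by rewrite normrM ger0_norm ?invr_ge0 // -mulrA ler_wpM2l ?invr_ge0.
have mxf : measurable_fun setT (fun x : R => x * f x) by exact: measurable_funM.
have mf2 : measurable_fun setT (fun x : R => 2^-1 * f' x) by exact: measurable_funM.
have mh : measurable_fun setT h by exact: measurable_funB.
have gh : poly_growth1 h.
  have [r [c hc]] := gxf; have [r' [c' hc']] := gf2.
  have c0 : 0 <= c by have := le_trans (normr_ge0 _) (hc 0); rewrite expr0n addr0 expr1n mulr1.
  have c'0 : 0 <= c' by have := le_trans (normr_ge0 _) (hc' 0); rewrite expr0n addr0 expr1n mulr1.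
  exists (r + r')%N; exists (c + c'); move=> x; rewrite (le_trans (ler_normB _ _)) //.
  have x1 : 1 <= 1 + x ^+ 2 by rewrite lerDl sqr_ge0.
  rewrite mulrDl addrC lerD //.
    by rewrite (le_trans (hc x)) // ler_wpM2l // ler_weXn2l // leq_addr.
  by rewrite (le_trans (hc' x)) // ler_wpM2l // ler_weXn2l // leq_addl.
have ih : mu.-integrable setT (EFin \o (fun x => h x * phi x)).
  exact: integrable_poly_phi.
pose g x := 2^-1 * (f x * phi x).
have ch : continuous (fun x => h x * phi x).
  move=> x; apply: cvgM; last exact: (continuous_normal_pdf sigma_neq0).
  apply: cvgB; apply: cvgM => //; [exact: cvg_cst|exact: cf'|exact: cf].
(* The index [n.+1] keeps the interval nondegenerate. *)
have FTC (n : nat) : (\int[mu]_(x in `[(- n.+1%:R)%R, n.+1%:R%R]) (h x * phi x)%:E =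
    (g n.+1%:R - g (- n.+1%:R))%:E)%E.
  rewrite (@continuous_FTC2 _ _ g) //.
  - by rewrite (lt_le_trans (y:=0)) // oppr_lt0.
  - exact: continuous_subspaceT.
  - have cg : continuous g.
      move=> x; apply: differentiable_continuous; apply/derivable1_diffP; case: (dg x) => //.
    split; [by move=> x _; case: (dg x)|by apply: cvg_at_right_filter; exact: cg|].
    by apply: cvg_at_left_filter; exact: cg.
  - by move=> x _; rewrite derive1E; apply: derive_val.
have gcvg (e : R) : e ^+ 2 = 1 -> g (e * n.+1%:R) @[n --> \oo] --> (0 : R).
  move=> e2; have [c c0 hc] := poly_growth1_bound gf.
  have lim0 : c * normal_pdf 0 1 (e * n.+1%:R) @[n --> \oo] --> (0 : R).
    suff : c * normal_pdf 0 1 (e * n.+1%:R) @[n --> \oo] --> c * 0 by rewrite mulr0.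
    apply: cvgM; first exact: cvg_cst.
    have := phi_cvg0 e2; rewrite -(cvg_shiftS (fun n => normal_pdf 0 1 (e * n%:R))).
    exact.
  apply/cvgr0Pnorm_le => eps eps0.
  move/cvgr0Pnorm_le : lim0 => /(_ _ eps0); apply: filterS => n; apply: le_trans.
  rewrite /g normrM ger0_norm ?invr_ge0 // (le_trans (ler_wpM2l _ (hc _))) ?invr_ge0 //.
  rewrite (le_trans _ (ler_norm _)) // ler_piMl ?mulr_ge0 ?normal_pdf_ge0 //.
  by rewrite invf_le1 // ler1n.
have h0 : (\int[mu]_x (h x * phi x)%:E = 0)%E.
  have l1 := integral_itv_cvg ih.
  rewrite -(cvg_shiftS (fun n => (\int[mu]_(x in `[(- n%:R)%R, n%:R%R]) (h x * phi x)%:E)%E)) /= in l1.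
  have l2 : (g n.+1%:R - g (- n.+1%:R))%:E @[n --> \oo] --> 0%E.
    apply: cvg_EFin; first exact: nearW.
    rewrite /= -[0](subr0 0); apply: cvgB.
      by have := gcvg 1 (expr1n _ _); under eq_fun do rewrite mul1r.
    have := gcvg (-1); rewrite sqrrN expr1n => /(_ erefl).
    by under eq_fun do rewrite mulN1r.
  apply: (cvg_unique _ l1) => //.
  apply: cvg_trans l2; apply: near_eq_cvg; apply: nearW => n.
  exact/esym/FTC.
have : (\int[N]_x (h x)%:E = 0)%E.
  by rewrite integral_normal //; exact: measurable_funB.
rewrite /h; under eq_integral do rewrite EFinB.
rewrite integralB //=; [|exact: integrable_normal|exact: integrable_normal].
have fin1 : (\int[N]_x (x * f x)%:E)%E \is a fin_num.
  by apply: integrable_fin_num => //; exact: integrable_normal.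
have fin2 : (\int[N]_x (2^-1 * f' x)%:E)%E \is a fin_num.
  by apply: integrable_fin_num => //; exact: integrable_normal.
rewrite -(fineK fin1) -(fineK fin2) -EFinB => -[] /eqP.
by rewrite subr_eq0 => /eqP ->.
Qed.

End NormalIBP.

Section SameLaw.
Context d1 d2 d (X1 : measurableType d1) (X2 : measurableType d2)
  (Y : measurableType d) (R : realType).
Variables (m1 : {measure set X1 -> \bar R}) (m2 : {measure set X2 -> \bar R}).
Variables (phi1 : X1 -> Y) (phi2 : X2 -> Y) (f : Y -> \bar R).

Lemma same_law_integral : measurable_fun setT phi1 -> measurable_fun setT phi2 ->
  (forall B, measurable B -> pushforward m1 phi1 B = pushforward m2 phi2 B) ->
  measurable_fun setT f -> m1.-integrable setT (f \o phi1) ->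
  m2.-integrable setT (f \o phi2) /\
  (\int[m1]_x f (phi1 x) = \int[m2]_x f (phi2 x))%E.
Proof.
move=> mphi1 mphi2 same mf if1.
pose p1 : {measure set Y -> \bar R} :=
  measure_function_pushforward__canonical__measure_function_Measure m1 mphi1.
pose p2 : {measure set Y -> \bar R} :=
  measure_function_pushforward__canonical__measure_function_Measure m2 mphi2.
have mabs : measurable_fun setT (abse \o f).
  by apply: measurableT_comp mf; exact: abse_measurable.
have abs0 : {in [set: Y], forall y, (0 <= (abse \o f) y)%E} by move=> y _; exact: abse_ge0.
have if2 : m2.-integrable setT (f \o phi2).
  apply/integrableP; split; first exact: measurableT_comp.
  rewrite -(preimage_setT phi2) -(@ge0_integral_pushforward _ _ _ _ R _ mphi2 m2 setT (abse \o f)) //.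
  rewrite (@eq_measure_integral _ _ _ setT p1); last by move=> A mA _; exact/esym/same.
  rewrite ge0_integral_pushforward // ?preimage_setT.
  by case/integrableP : if1.
split=> //.
have e1 := @integral_pushforward _ _ _ _ R _ mphi1 m1 setT f mf if1 measurableT.
have e2 := @integral_pushforward _ _ _ _ R _ mphi2 m2 setT f mf if2 measurableT.
rewrite preimage_setT in e1; rewrite preimage_setT in e2.
rewrite -[LHS]e1 -[RHS]e2; apply: (@eq_measure_integral _ _ _ setT p2 p1).
by move=> A mA _; exact: same.
Qed.

End SameLaw.

HB.instance Definition _ (R : realType) := isPointed.Build R[i] 0.

(** * Gaussian matrices and the resampling of one coordinate *)

Section MatrixSpace.
Context {R : realType} {n p : nat}.
Local Notation C := R[i].
Local Notation I := ('I_n * 'I_p * bool)%type.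
Local Notation mx := 'M[C]_(n, p).
Implicit Types (c : I) (M : mx) (A : I -> set R).

Definition rpart (b : bool) (z : C) : R := if b then complex.Im z else complex.Re z.
Definition unit_dir (b : bool) : C := if b then 'i%C else 1.

Definition rcoordmx c M : R := rpart c.2 (M c.1.1 c.1.2).
Definition dirmx c : mx := unit_dir c.2 *: delta_mx c.1.1 c.1.2.

Lemma rpartD b : {morph rpart b : x y / x + y}.
Proof. by move: b => [] [a b] [c d]. Qed.

Lemma rpart_real_dir b b' (u : R) : rpart b (u%:C%C * unit_dir b') = u *+ (b == b').
Proof. by case: b b' => -[] /=; rewrite ?mulr0 ?mul0r ?mulr1 ?subr0 ?addr0. Qed.

Lemma rcoordmx_line c c' M (u : R) :
  rcoordmx c' (M + u%:C%C *: dirmx c) = rcoordmx c' M + u *+ (c' == c).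
Proof.
rewrite /rcoordmx !mxE rpartD; congr (_ + _).
case: c c' => [[a b] e] [[a' b'] e'] /=; rewrite !xpair_eqE.
case: (a' == a); case: (b' == b); rewrite /= ?mulr1 ?mulr0 ?rpart_real_dir //;
  by case: (e').
Qed.

Definition set_coord c (u : R) M : mx := M + (u - rcoordmx c M)%:C%C *: dirmx c.

Lemma rcoordmx_set c c' u M :
  rcoordmx c' (set_coord c u M) = if c' == c then u else rcoordmx c' M.
Proof.
rewrite rcoordmx_line; case: eqP => [->|_]; last by rewrite addr0.
by rewrite mulr1n addrC subrK.
Qed.

Lemma set_coord_line c u M : set_coord c u M = set_coord c 0 M + u%:C%C *: dirmx c.
Proof.
rewrite /set_coord -addrA -scalerDl; congr (_ + _ *: _).
by apply/eqP; rewrite eq_complex /= sub0r addrC addr0 !eqxx.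
Qed.

Definition box A : set mx := [set M | forall c, A c (rcoordmx c M)].
(** A generating family closed under intersection, so a probability law on [mxspace] is determined
    by its values on boxes. *)
Definition boxes : set (set mx) :=
  [set B | exists2 A, (forall c, measurable (A c)) & B = box A].

Local Notation mxspace := (g_sigma_algebraType boxes).

Lemma measurable_box A : (forall c, measurable (A c)) ->
  measurable (box A : set mxspace).
Proof. by move=> mA; apply: sub_sigma_algebra; exists A. Qed.

Lemma measurable_rcoordmx c : measurable_fun setT (rcoordmx c : mxspace -> R).
Proof.
move=> _ B mB; rewrite setTI.
have -> : rcoordmx c @^-1` B = box (fun c' => if c' == c then B else setT).
  apply/seteqP; split=> [M /= MB c'|M /(_ c)] /=; last by rewrite eqxx.
  by case: eqP => [->|].
by apply: measurable_box => c'; case: ifP.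
Qed.

Lemma measurable_to_mxspace d (T : measurableType d) (Z : T -> mxspace) :
  (forall c, measurable_fun setT (rcoordmx c \o Z)) -> measurable_fun setT Z.
Proof.
move=> mZ; apply: (@measurability _ _ T mxspace setT Z boxes erefl) => _ [B [A mA ->] <-].
rewrite setTI.
have -> : Z @^-1` box A = \bigcap_(c in [set: I]) ((rcoordmx c \o Z) @^-1` A c).
  by apply/seteqP; split=> [t h c _|t h c]; [exact: h|exact: (h c Logic.I)].
apply: fin_bigcap_measurable => [|c _].
  exact: finite_finset.
by rewrite -[X in measurable X]setTI; exact: mZ.
Qed.

Section Law.
Context {d : measure_display} {T : measurableType d} (P : probability T R).
Variable Z : T -> mxspace.
Local Notation N := (normal_prob 0 (Num.sqrt (2^-1 : R))).

(* [A c] constrains the real coordinate [c = (row, column, imaginary?)]; the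
   standard deviation gives E|z|^2 = 1. *)
Definition gaussian_mx :=
  measurable_fun setT Z /\
  forall A, (forall c, measurable (A c)) ->
    P (Z @^-1` box A) = \big[*%E/1%E]_c N (A c).

Hypothesis gZ : gaussian_mx.

Let mZ : measurable_fun setT Z. Proof. by case: gZ. Qed.

Definition resample c (ut : measurableTypeR R * T) : mxspace := set_coord c ut.1 (Z ut.2).

Lemma measurable_resample c : measurable_fun setT (resample c).
Proof.
apply: measurable_to_mxspace => c'.
have -> : rcoordmx c' \o resample c =
    if c' == c then fst else rcoordmx c' \o Z \o snd.
  apply/funext => ut; rewrite /= rcoordmx_set; by case: eqP.
case: eqP => _; first exact: measurable_fst.
apply: measurableT_comp; last exact: measurable_snd.
by apply: measurableT_comp => //; exact: measurable_rcoordmx.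
Qed.

(** Both measures agree on boxes, where independence splits off the factor of coordinate [c]. It
    lets Fubini integrate out a single coordinate although [T] carries no product structure. *)
Lemma pushforward_resample c (B : set mxspace) : measurable B ->
  pushforward P Z B = pushforward (N \x P)%E (resample c) B.
Proof.
move=> mB; have mr := measurable_resample c.
pose m1 : {measure set mxspace -> \bar R} := measure_function_pushforward__canonical__measure_function_Measure P mZ.
pose m2 : {measure set mxspace -> \bar R} := measure_function_pushforward__canonical__measure_function_Measure (N \x P)%E mr.
apply: (@measure_unique _ R mxspace boxes (fun _ => setT) erefl _ _ _ m1 m2) => //=.
- move=> _ _ [A mA ->] [A' mA' ->]; exists (fun c => A c `&` A' c).
    by move=> c'; exact: measurableI.
  apply/seteqP; split=> [M [h h'] c'|M h]; first by split.
  by split=> c'; have [] := h c'.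
- move=> _; exists (fun=> setT) => //.
  by apply/seteqP; split.
- by rewrite bigcup_const.
- move=> _ [A mA ->].
  pose A' c' := if c' == c then setT else A c'.
  have mA' c' : measurable (A' c') by rewrite /A'; case: ifP.
  have pre : resample c @^-1` box A = A c `*` (Z @^-1` box A').
    apply/seteqP; split=> -[u t] /=.
      move=> h; split; first by have := h c; rewrite rcoordmx_set eqxx.
      by move=> c' /=; have := h c'; rewrite rcoordmx_set /A'; case: eqP.
    move=> [hu ht] c' /=; have := ht c'; rewrite rcoordmx_set /A'.
    by case: eqP => [->|].
  transitivity (P (Z @^-1` box A)) => //.
  transitivity ((N \x P)%E (resample c @^-1` box A)) => //.
  have mZA : measurable (Z @^-1` box A').
    by rewrite -[X in measurable X]setTI; apply: mZ => //; exact: measurable_box.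
  have e := @product_measure1E _ _ _ _ R N P _ _ (mA c) mZA.
  rewrite pre; transitivity (N (A c) * P (Z @^-1` box A'))%E; last exact/esym/e.
  case: gZ => _ hZ.
  transitivity (\big[*%E/1%E]_c N (A c)); first exact: hZ.
  transitivity (N (A c) * \big[*%E/1%E]_c N (A' c))%E; last by congr (_ * _)%E; exact/esym/hZ.
  rewrite (bigD1 c) //= [in RHS](bigD1 c) //=.
  have -> : N (A' c) = 1%E by rewrite /A' eqxx; exact: probability_setT.
  rewrite mul1e; congr (_ * _)%E.
  by apply: eq_bigr => c' /negbTE c'c; rewrite /A' c'c.
- by move=> _; rewrite /m1 /= /pushforward preimage_setT probability_setT ltry.
Qed.

Lemma integral_resample c (f : mxspace -> R) : measurable_fun setT f ->
  P.-integrable setT (EFin \o f \o Z) ->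
  (\int[P]_t (f (Z t))%:E = \int[P]_t \int[N]_u (f (set_coord c u (Z t)))%:E)%E.
Proof.
move=> mf iff; have mr := measurable_resample c.
have mEf : measurable_fun setT (EFin \o f) by exact/measurable_EFinP.
have [ir ->] := same_law_integral mZ mr (pushforward_resample c) mEf iff.
by rewrite -(integral21_prod_meas1 ir).
Qed.

End Law.
End MatrixSpace.

Section GaussianIBP.
Context {R : realType} {n p : nat}.
Local Notation C := R[i].
Local Notation coordT := ('I_n * 'I_p * bool)%type.
Local Notation mx := 'M[C]_(n, p).
Local Notation mxspace := (g_sigma_algebraType (@boxes R n p)).
Local Notation N := (normal_prob 0 (Num.sqrt (2^-1 : R))).
Implicit Types (c : coordT) (M : mx).

Definition normsq M : R := \sum_c rcoordmx c M ^+ 2.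

Definition poly_growth (F : mx -> R) :=
  exists r K, forall M, `|F M| <= K * (1 + normsq M) ^+ r.

Lemma normsq_ge0 M : 0 <= normsq M.
Proof. by apply: sumr_ge0 => c _; exact: sqr_ge0. Qed.

Lemma normsq1_ge1 M : 1 <= 1 + normsq M.
Proof. by rewrite lerDl normsq_ge0. Qed.

Lemma poly_growth_ge0 (F : mx -> R) r K :
  (forall M, `|F M| <= K * (1 + normsq M) ^+ r) -> 0 <= K.
Proof.
move=> h; have := le_trans (normr_ge0 _) (h 0).
by rewrite pmulr_lge0 // exprn_gt0 // (lt_le_trans ltr01) // normsq1_ge1.
Qed.

Lemma poly_growthW (F : mx -> R) r r' K : (r <= r')%N ->
  (forall M, `|F M| <= K * (1 + normsq M) ^+ r) ->
  (forall M, `|F M| <= K * (1 + normsq M) ^+ r').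
Proof.
move=> rr' h M; rewrite (le_trans (h M)) // ler_wpM2l ?(poly_growth_ge0 h) //.
by rewrite ler_weXn2l // normsq1_ge1.
Qed.

Lemma poly_growthD F G : poly_growth F -> poly_growth G -> poly_growth (fun M => F M + G M).
Proof.
move=> [r [K h]] [r' [K' h']]; exists (r + r')%N; exists (K + K'); move=> M.
rewrite (le_trans (ler_normD _ _)) // mulrDl lerD //.
  exact: (poly_growthW (leq_addr _ _) h).
exact: (poly_growthW (leq_addl _ _) h').
Qed.

Lemma poly_growthM F G : poly_growth F -> poly_growth G -> poly_growth (fun M => F M * G M).
Proof.
move=> [r [K h]] [r' [K' h']]; exists (r + r')%N; exists (K * K'); move=> M.
by rewrite exprD mulrACA normrM ler_pM.
Qed.

Lemma poly_growth_bounded F K : (forall M, `|F M| <= K) -> poly_growth F.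
Proof. by move=> h; exists 0%N; exists K => M; rewrite mulr1. Qed.

Lemma poly_growthN F : poly_growth F -> poly_growth (fun M => - F M).
Proof. by move=> [r [K h]]; exists r; exists K; move=> M; rewrite normrN. Qed.

Lemma poly_growth_coord c : poly_growth (rcoordmx c).
Proof.
exists 1%N; exists 1; move=> M; rewrite mul1r expr1 /normsq (bigD1 c) //=.
set s := \sum_(_ | _) _; have s0 : 0 <= s by apply: sumr_ge0 => *; exact: sqr_ge0.
by rewrite ler_norml; apply/andP; split; nra.
Qed.

(** Each term is at most the largest one. Powers of a sum become sums of powers, so moments of
    single coordinates suffice for integrability. *)
Lemma sum_expr_le (J : finType) (y : J -> R) r : (forall j, 0 <= y j) -> (0 < #|J|)%N ->
  (\sum_j y j) ^+ r <= #|J|%:R ^+ r * \sum_j y j ^+ r.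
Proof.
move=> y0 /card_gt0P[j0 _].
pose j1 := [arg max_(j > j0) y j]%O.
have j1P j : y j <= y j1 by rewrite /j1; case: arg_maxP => // i _; apply.
apply: (@le_trans _ _ ((#|J|%:R * y j1) ^+ r)).
  rewrite lerXn2r ?nnegrE ?mulr_ge0 ?sumr_ge0 //.
  by rewrite mulr_natl -sumr_const ler_sum.
rewrite exprMn ler_wpM2l ?exprn_ge0 // (bigD1 j1) //= lerDl sumr_ge0 // => j _.
by rewrite exprn_ge0.
Qed.

Context {d : measure_display} {T : measurableType d} (P : probability T R).
Variable Z : T -> mxspace.
Hypothesis gZ : gaussian_mx P Z.

Let mZ : measurable_fun setT Z. Proof. by case: gZ. Qed.

Lemma integrable_coord_pow c r :
  P.-integrable setT (fun t => (rcoordmx c (Z t) ^+ (2 * r))%:E).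
Proof.
have mpow : measurable_fun setT (fun u : measurableTypeR R => (u ^+ (2 * r))%:E).
  by apply/measurable_EFinP; exact: measurable_funX.
have mrc : measurable_fun setT (rcoordmx c \o Z).
  by apply: measurableT_comp => //; exact: measurable_rcoordmx.
apply: (proj1 (@same_law_integral _ _ _ _ _ _ R N P id (rcoordmx c \o Z) _ _ mrc _ mpow _)).
- exact: measurable_id.
- move=> B mB; rewrite /pushforward preimage_id.
  case: gZ => _ /(_ (fun c' => if c' == c then B else setT)) => hB.
  rewrite -[RHS]/(P ((rcoordmx c \o Z) @^-1` B)).
  have -> : (rcoordmx c \o Z) @^-1` B =
      Z @^-1` box (fun c' => if c' == c then B else setT).
    apply/seteqP; split=> [t /= tB c'|t /(_ c)] /=; last by rewrite eqxx.
    by case: eqP => [->|].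
  rewrite hB; last by move=> c'; case: ifP.
  rewrite (bigD1 c) //= eqxx big1 ?mule1 // => c' /negbTE ->.
  exact: probability_setT.
- apply: integrable_normal; first exact: measurable_funX.
  exists r; exists 1; move=> u; rewrite mul1r exprM ger0_norm; last by apply: exprn_ge0; exact: sqr_ge0.
  by rewrite lerXn2r ?nnegrE ?addr_ge0 ?sqr_ge0 // lerDr.
Qed.

Lemma integrable_gaussian (F : mxspace -> R) : measurable_fun setT F ->
  poly_growth F -> P.-integrable setT (EFin \o (F \o Z)).
Proof.
move=> mF [r [K hK]].
have K0 := poly_growth_ge0 hK.
(* [None] indexes the summand 1 of [1 + normsq M]. *)
pose J := option coordT.
pose y M (j : J) : R := if j is Some c then rcoordmx c M ^+ 2 else 1.
have yE M : 1 + normsq M = \sum_j y M j.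
  rewrite (bigD1 None) //= (reindex_omap Some id) /=; last by case.
  by congr (_ + _); apply: eq_bigl => c; rewrite eqxx.
pose K' := K * #|{: J}|%:R ^+ r.
apply: (@le_integrable _ _ _ P _ measurableT _
  (fun t => (K' * \sum_j y (Z t) j ^+ r)%:E)) => //.
- by apply/measurable_EFinP; apply: measurableT_comp.
- move=> t _ /=; rewrite lee_fin (le_trans (hK _)) // (le_trans _ (ler_norm _)) //.
  rewrite yE /K' -mulrA ler_wpM2l // sum_expr_le //.
    by case=> [c|] /=; rewrite ?sqr_ge0.
  by apply/card_gt0P; exists None.
- under eq_fun do rewrite EFinM.
  apply: integrableZl => //.
  under eq_fun do rewrite -sumEFin.
  apply: integrable_sum => //= -[c|] _ /=.
    by under eq_fun do rewrite -exprM; exact: integrable_coord_pow.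
  under eq_fun do rewrite expr1n.
  exact: finite_measure_integrable_cst.
Qed.

Lemma normsq_line c M : exists2 K, 0 <= K & forall v,
  1 + normsq (M + v%:C%C *: dirmx c) <= K * (1 + v ^+ 2).
Proof.
exists (3 * (1 + normsq M)) => [|v]; first by have := normsq_ge0 M; lra.
rewrite /normsq (bigD1 c) //= [in leRHS](bigD1 c) //= !rcoordmx_line eqxx mulr1n.
rewrite (eq_bigr (fun c' => rcoordmx c' M ^+ 2)); last first.
  by move=> c' /negbTE c'c; rewrite rcoordmx_line c'c mulr0n addr0.
set s := \sum_(_ | _) _; have s0 : 0 <= s by apply: sumr_ge0 => *; exact: sqr_ge0.
set x := rcoordmx c M; have := sqr_ge0 (x - v); have := sqr_ge0 x; have := sqr_ge0 v.
move=> v0 x0 xv; have := mulr_ge0 x0 v0; have := mulr_ge0 s0 v0; nra.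
Qed.

(** Given the other coordinates, [u] runs along the line through the matrix whose coordinate [c] is
    reset to 0; there the coordinate equals [u] and the one-dimensional formula applies. *)
Lemma ibp_gaussian c (F F' : mxspace -> R) :
  measurable_fun setT F -> measurable_fun setT F' ->
  poly_growth F -> poly_growth F' ->
  (forall M (v : R), is_derive v 1 (fun v : R => F (M + v%:C%C *: dirmx c))
     (F' (M + v%:C%C *: dirmx c))) ->
  (forall M, continuous (fun v : R => F' (M + v%:C%C *: dirmx c))) ->
  (\int[P]_t (rcoordmx c (Z t) * F (Z t))%:E = \int[P]_t (2^-1 * F' (Z t))%:E)%E.
Proof.
move=> mF mF' gF gF' dF cF'.
have mc : measurable_fun setT (rcoordmx c : mxspace -> R) by exact: measurable_rcoordmx.
have e1 := @integral_resample _ _ _ _ _ _ _ gZ c (fun M => rcoordmx c M * F M).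
have e2 := @integral_resample _ _ _ _ _ _ _ gZ c (fun M => 2^-1 * F' M).
rewrite e1; last 2 first.
- exact: measurable_funM.
- apply: (@integrable_gaussian (fun M => rcoordmx c M * F M)); first exact: measurable_funM.
  by apply: poly_growthM => //; exact: poly_growth_coord.
rewrite e2; last 2 first.
- exact: measurable_funM.
- apply: (@integrable_gaussian (fun M => 2^-1 * F' M)); first exact: measurable_funM.
  apply: (@poly_growthM (fun _ => 2^-1)) => //.
  by apply: (@poly_growth_bounded _ 2^-1) => M; rewrite ger0_norm // invr_ge0.
apply: eq_integral => t _; set M := set_coord c 0 (Z t).
have sE u : set_coord c u (Z t) = M + u%:C%C *: dirmx c by exact: set_coord_line.
under eq_integral do rewrite rcoordmx_set eqxx sE.
under [RHS]eq_integral do rewrite sE.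
have pg F0 : poly_growth F0 -> poly_growth1 (fun u => F0 (M + u%:C%C *: dirmx c)).
  move=> [r [K hK]]; have [K' K'0 hK'] := normsq_line c M.
  exists r; exists (K * K' ^+ r); move=> u; rewrite (le_trans (hK _)) //.
  rewrite -mulrA -exprMn ler_wpM2l ?(poly_growth_ge0 hK) //.
  have le1 := hK' u; rewrite lerXn2r // nnegrE.
    by rewrite (le_trans ler01) // normsq1_ge1.
  by rewrite mulr_ge0 // addr_ge0 // sqr_ge0.
apply: (@ibp_normal R (fun u => F (M + u%:C%C *: dirmx c))
  (fun u => F' (M + u%:C%C *: dirmx c))).
- exact: cF'.
- exact: pg.
- exact: pg.
Qed.

End GaussianIBP.

(** * Complex-valued random variables and Wirtinger derivatives *)

Section ComplexParts.
Context {R : realType}.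
Local Notation C := R[i].
Local Notation Re := (@complex.Re R).
Local Notation Im := (@complex.Im R).
Implicit Types (x y : C).

Lemma cReD x y : Re (x + y) = Re x + Re y. Proof. by case: x y => [a b] []. Qed.
Lemma cImD x y : Im (x + y) = Im x + Im y. Proof. by case: x y => [a b] []. Qed.
Lemma cReM x y : Re (x * y) = Re x * Re y - Im x * Im y.
Proof. by case: x y => [a b] []. Qed.
Lemma cImM x y : Im (x * y) = Re x * Im y + Im x * Re y.
Proof. by case: x y => [a b] []. Qed.
Lemma cReJ x : Re x^* = Re x. Proof. by case: x. Qed.
Lemma cImJ x : Im x^* = - Im x. Proof. by case: x. Qed.
Lemma cReV x : Re x^-1 = Re x * (Re x ^+ 2 + Im x ^+ 2)^-1. Proof. by case: x. Qed.
Lemma cImV x : Im x^-1 = - (Im x * (Re x ^+ 2 + Im x ^+ 2)^-1). Proof. by case: x. Qed.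

Lemma complexP x y : Re x = Re y -> Im x = Im y -> x = y.
Proof. by case: x y => [a b] [a' b'] /= -> ->. Qed.

Lemma Re_Im_sq_gt0 x : x != 0 -> 0 < Re x ^+ 2 + Im x ^+ 2.
Proof.
case: x => [a b]; rewrite eq_complex /= negb_and => ab.
rewrite lt_neqAle addr_ge0 ?sqr_ge0 // andbT eq_sym paddr_eq0 ?sqr_ge0 //.
by rewrite !sqrf_eq0 negb_and.
Qed.

End ComplexParts.

Lemma eq_fun_prop (X A : Type) (K : (X -> A) -> Prop) f g : f =1 g -> K f -> K g.
Proof. by move=> /funext ->. Qed.

Section BigClosed.
Context {X A : Type} (op : A -> A -> A) (idx : A) (K : (X -> A) -> Prop).

Lemma big_fun_closed (I : Type) (r : seq I) (Q : pred I) (F : I -> X -> A) :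
  K (fun=> idx) -> (forall f g, K f -> K g -> K (fun t => op (f t) (g t))) ->
  (forall i, Q i -> K (F i)) -> K (fun t => \big[op/idx]_(i <- r | Q i) F i t).
Proof.
move=> K0 Kop KF; elim: r => [|i r IH].
  by apply: eq_fun_prop K0 => t; rewrite big_nil.
case: (boolP (Q i)) => Qi.
  by apply: eq_fun_prop (Kop _ _ (KF i Qi) IH) => t; rewrite big_cons Qi.
by apply: eq_fun_prop IH => t; rewrite big_cons (negbTE Qi).
Qed.

End BigClosed.

Section ComplexIntegral.
Context {R : realType} {d : measure_display} {T : measurableType d}.
Variable P : probability T R.
Local Notation C := R[i].
Local Notation Re := (@complex.Re R).
Local Notation Im := (@complex.Im R).
Implicit Types (f g : T -> C).

Definition cmeasurable f :=
  measurable_fun setT (Re \o f) /\ measurable_fun setT (Im \o f).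

Lemma cmeasurable_parts (f : T -> C) (u v : T -> R) :
  (forall t, Re (f t) = u t) -> (forall t, Im (f t) = v t) ->
  measurable_fun setT u -> measurable_fun setT v -> cmeasurable f.
Proof.
by move=> fu fv mu mv; split;
  [rewrite (_ : Re \o f = u)|rewrite (_ : Im \o f = v)] => //; apply/funext.
Qed.

Lemma cmeasurableD f g : cmeasurable f -> cmeasurable g -> cmeasurable (fun t => f t + g t).
Proof.
move=> [f1 f2] [g1 g2]; apply: (cmeasurable_parts (fun t => cReD _ _) (fun t => cImD _ _)).
  exact: (measurable_funD f1 g1).
exact: (measurable_funD f2 g2).
Qed.

Lemma cmeasurableM f g : cmeasurable f -> cmeasurable g -> cmeasurable (fun t => f t * g t).
Proof.
move=> [f1 f2] [g1 g2]; apply: (cmeasurable_parts (fun t => cReM _ _) (fun t => cImM _ _)).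
  exact: (measurable_funB (measurable_funM f1 g1) (measurable_funM f2 g2)).
exact: (measurable_funD (measurable_funM f1 g2) (measurable_funM f2 g1)).
Qed.

Lemma cmeasurable_cst (z : C) : cmeasurable (fun=> z).
Proof. by split; exact: measurable_cst. Qed.

Lemma cmeasurableJ f : cmeasurable f -> cmeasurable (fun t => (f t)^*).
Proof.
move=> [f1 f2]; apply: (cmeasurable_parts (fun t => cReJ _) (fun t => cImJ _)) => //.
by apply: measurableT_comp f2; exact: oppr_measurable.
Qed.

Lemma cmeasurableV f : (forall t, f t != 0) -> cmeasurable f ->
  cmeasurable (fun t => (f t)^-1).
Proof.
move=> f0 [f1 f2].
have mV : measurable_fun setT (fun t => (Re (f t) ^+ 2 + Im (f t) ^+ 2)^-1).
  (* On positive reals inversion is [exp (- ln x)], a composition of measurable functions. *)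
  rewrite (_ : (fun t => _) = (fun t => expR (- ln (Re (f t) ^+ 2 + Im (f t) ^+ 2)))).
    apply: measurableT_comp => //; apply: measurableT_comp => //.
    apply: measurableT_comp; first exact: measurable_ln.
    by apply: measurable_funD; [exact: (measurable_funX 2 f1)|exact: (measurable_funX 2 f2)].
  by apply/funext => t; rewrite expRN lnK // posrE Re_Im_sq_gt0.
apply: (cmeasurable_parts (fun t => cReV _) (fun t => cImV _)).
  exact: (measurable_funM f1 mV).
by apply: measurableT_comp (measurable_funM f2 mV); exact: oppr_measurable.
Qed.

Lemma cmeasurable_sum (I : Type) (r : seq I) (Q : pred I) (F : I -> T -> C) :
  (forall i, Q i -> cmeasurable (F i)) -> cmeasurable (fun t => \sum_(i <- r | Q i) F i t).
Proof.
move=> mF; apply: big_fun_closed => //; [exact: cmeasurable_cst|exact: cmeasurableD].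
Qed.

Lemma cintegrableD f g : cintegrable P f -> cintegrable P g ->
  cintegrable P (fun t => f t + g t).
Proof.
move=> [f1 f2] [g1 g2]; split.
  have := integrableD measurableT f1 g1; apply: eq_integrable => // t _ /=.
  by rewrite cReD EFinD.
have := integrableD measurableT f2 g2; apply: eq_integrable => // t _ /=.
by rewrite cImD EFinD.
Qed.

Lemma cintegrableZ (z : C) f : cintegrable P f -> cintegrable P (fun t => z * f t).
Proof.
move=> [f1 f2]; split.
  have := integrableB measurableT (integrableZl measurableT (Re z) f1)
    (integrableZl measurableT (Im z) f2).
  by apply: eq_integrable => // t _ /=; rewrite cReM EFinB !EFinM.
have := integrableD measurableT (integrableZl measurableT (Re z) f2)
    (integrableZl measurableT (Im z) f1).
by apply: eq_integrable => // t _ /=; rewrite cImM EFinD !EFinM.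
Qed.

Lemma cintegrable_cst (z : C) : cintegrable P (fun=> z).
Proof. by split; exact: finite_measure_integrable_cst. Qed.

Lemma cintegrable_sum (I : Type) (r : seq I) (Q : pred I) (F : I -> T -> C) :
  (forall i, Q i -> cintegrable P (F i)) ->
  cintegrable P (fun t => \sum_(i <- r | Q i) F i t).
Proof.
move=> mF; apply: big_fun_closed => //; [exact: cintegrable_cst|exact: cintegrableD].
Qed.

Lemma Re_cexpectation f : Re (cexpectation P f) = \int[P]_t (Re (f t)).
Proof. by rewrite /cexpectation /= unlock. Qed.

Lemma Im_cexpectation f : Im (cexpectation P f) = \int[P]_t (Im (f t)).
Proof. by rewrite /cexpectation /= unlock. Qed.

Lemma cexpectationD f g : cintegrable P f -> cintegrable P g ->
  cexpectation P (fun t => f t + g t) = cexpectation P f + cexpectation P g.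
Proof.
move=> [f1 f2] [g1 g2]; apply: complexP; rewrite ?cReD ?cImD !(Re_cexpectation, Im_cexpectation).
  by rewrite -RintegralD //; apply: eq_Rintegral => t _; rewrite cReD.
by rewrite -RintegralD //; apply: eq_Rintegral => t _; rewrite cImD.
Qed.

Lemma cexpectationZ (z : C) f : cintegrable P f ->
  cexpectation P (fun t => z * f t) = z * cexpectation P f.
Proof.
move=> [f1 f2].
have iZ (a : R) (u : T -> R) : P.-integrable setT (EFin \o u) ->
    P.-integrable setT (EFin \o (fun t => a * u t)).
  by move=> iu; have := integrableZl measurableT a iu; apply: eq_integrable.
apply: complexP; rewrite ?cReM ?cImM !(Re_cexpectation, Im_cexpectation) -!RintegralZl //.
  rewrite -RintegralB //; [|exact: iZ|exact: iZ].
  by apply: eq_Rintegral => t _; rewrite cReM.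
rewrite -RintegralD //; [|exact: iZ|exact: iZ].
by apply: eq_Rintegral => t _; rewrite cImM.
Qed.

Lemma cexpectation_cst (z : C) : cexpectation P (fun=> z) = z.
Proof.
have Pc (r : R) : \int[P]_t r = r.
  have -> : \int[P]_t r = \int[P]_t (cst r t) by [].
  by rewrite Rintegral_cst //= probability_setT mulr1.
by apply: complexP; rewrite !(Re_cexpectation, Im_cexpectation).
Qed.

Lemma cexpectation_sum (I : Type) (r : seq I) (Q : pred I) (F : I -> T -> C) :
  (forall i, Q i -> cintegrable P (F i)) ->
  cexpectation P (fun t => \sum_(i <- r | Q i) F i t) =
  \sum_(i <- r | Q i) cexpectation P (F i).
Proof.
move=> mF; elim: r => [|i r IH].
  rewrite big_nil -[RHS]cexpectation_cst; congr cexpectation.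
  by apply/funext => t; rewrite big_nil.
rewrite big_cons; case: (boolP (Q i)) => Qi; last first.
  rewrite -IH; congr cexpectation; apply/funext => t.
  by rewrite big_cons (negbTE Qi).
rewrite -IH -cexpectationD; [|exact: mF|exact: cintegrable_sum].
by congr cexpectation; apply/funext => t; rewrite big_cons Qi.
Qed.

Lemma cintegrableN f : cintegrable P f -> cintegrable P (fun t => - f t).
Proof.
by move=> /(cintegrableZ (-1)); apply: eq_fun_prop => t; rewrite mulN1r.
Qed.

Lemma cexpectationB f g : cintegrable P f -> cintegrable P g ->
  cexpectation P (fun t => f t - g t) = cexpectation P f - cexpectation P g.
Proof.
move=> fi gi; rewrite cexpectationD //; last exact: cintegrableN.
rewrite -[in RHS](mulN1r (cexpectation P g)) -cexpectationZ //.
by congr (_ + cexpectation P _); apply/funext => t; rewrite mulN1r.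
Qed.

Lemma cintegrableB f g : cintegrable P f -> cintegrable P g ->
  cintegrable P (fun t => f t - g t).
Proof. by move=> fi gi; apply: cintegrableD => //; exact: cintegrableN. Qed.

Lemma le_cexpectation f g : cintegrable P f -> cintegrable P g ->
  (forall t, Re (f t) <= Re (g t)) -> Re (cexpectation P f) <= Re (cexpectation P g).
Proof. by move=> [f1 f2] [g1 g2] fg; rewrite !Re_cexpectation; apply: le_Rintegral. Qed.

End ComplexIntegral.

(** * Derivatives of complex functions of a real variable *)

Section LineDerivative.
Context {R : realType}.
Local Notation C := R[i].
Local Notation Re := (@complex.Re R).
Local Notation Im := (@complex.Im R).
Implicit Types (f g : R -> C).

Definition is_cderive (f f' : R -> C) := forall u : R,
  is_derive u 1 (fun v => Re (f v)) (Re (f' u)) /\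
  is_derive u 1 (fun v => Im (f v)) (Im (f' u)).

Definition cderivable f := exists f', is_cderive f f'.

Lemma is_cderive_parts f (u v u' v' : R -> R) f' :
  (forall t, Re (f t) = u t) -> (forall t, Im (f t) = v t) ->
  (forall t, Re (f' t) = u' t) -> (forall t, Im (f' t) = v' t) ->
  (forall t : R, is_derive t 1 u (u' t)) -> (forall t : R, is_derive t 1 v (v' t)) ->
  is_cderive f f'.
Proof.
move=> fu fv fu' fv' du dv t; split.
  by rewrite fu'; apply: (eq_fun_prop (K := fun h => is_derive t 1 h (u' t))) (du t) => x; rewrite fu.
by rewrite fv'; apply: (eq_fun_prop (K := fun h => is_derive t 1 h (v' t))) (dv t) => x; rewrite fv.
Qed.

Lemma is_cderive_cst (z : C) : is_cderive (fun=> z) (fun=> 0).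
Proof. by move=> u; split; apply: is_derive_cst. Qed.

Lemma is_cderiveD f g f' g' : is_cderive f f' -> is_cderive g g' ->
  is_cderive (fun t => f t + g t) (fun t => f' t + g' t).
Proof.
move=> df dg; apply: (is_cderive_parts (fun t => cReD _ _) (fun t => cImD _ _)
  (fun t => cReD _ _) (fun t => cImD _ _)) => t.
  by have [? _] := df t; have [? _] := dg t; apply: is_deriveD.
by have [_ ?] := df t; have [_ ?] := dg t; apply: is_deriveD.
Qed.

Lemma is_cderiveM f g f' g' : is_cderive f f' -> is_cderive g g' ->
  is_cderive (fun t => f t * g t) (fun t => f' t * g t + f t * g' t).
Proof.
move=> df dg; apply: (is_cderive_parts (fun t => cReM _ _) (fun t => cImM _ _)
  (fun t => erefl) (fun t => erefl)) => t; have [? ?] := df t; have [? ?] := dg t.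
  by apply: is_derive_eq; rewrite cReD !cReM /GRing.scale /=; ring.
by apply: is_derive_eq; rewrite cImD !cImM /GRing.scale /=; ring.
Qed.

Lemma is_cderiveJ f f' : is_cderive f f' ->
  is_cderive (fun t => (f t)^*) (fun t => (f' t)^*).
Proof.
move=> df; apply: (is_cderive_parts (fun t => cReJ _) (fun t => cImJ _)
  (fun t => cReJ _) (fun t => cImJ _)) => t; have [? ?] := df t => //.
exact: is_deriveN.
Qed.

Lemma is_cderive_line (a b : C) : is_cderive (fun t => a + t%:C%C * b) (fun=> b).
Proof.
apply: (@is_cderive_parts _ (fun t => Re a + t * Re b) (fun t => Im a + t * Im b)
  (fun=> Re b) (fun=> Im b)) => // t.
- by rewrite cReD cReM /= mul0r subr0.
- by rewrite cImD cImM /= mul0r addr0.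
- by apply: is_derive_eq; rewrite /GRing.scale /=; ring.
- by apply: is_derive_eq; rewrite /GRing.scale /=; ring.
Qed.

(** Existence suffices: the formula for the derivative of an inverse matrix is recovered from
    [F F^-1 = 1] in [is_mderive_inv]. *)
Lemma cderivableV f : (forall t, f t != 0) -> cderivable f -> cderivable (fun t => (f t)^-1).
Proof.
move=> f0 [f' df].
pose s t := Re (f t) ^+ 2 + Im (f t) ^+ 2.
pose s' t := - s t ^- 2 * (2 * Re (f t) * Re (f' t) + 2 * Im (f t) * Im (f' t)).
have dsV (t : R) : is_derive t 1 (fun v => (s v)^-1) (s' t).
  have [? ?] := df t; have s0 : s t != 0 by rewrite gt_eqF // Re_Im_sq_gt0.
  have ds : is_derive t 1 s (2 * Re (f t) * Re (f' t) + 2 * Im (f t) * Im (f' t)).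
    by apply: is_derive_eq; rewrite /GRing.scale /=; ring.
  by apply: (is_derive_eq (is_deriveV s0 ds)).
exists (fun t => (Re (f' t) * (s t)^-1 + Re (f t) * s' t) +i*
   (- (Im (f' t) * (s t)^-1 + Im (f t) * s' t)))%C.
apply: (is_cderive_parts (fun t => cReV _) (fun t => cImV _)
  (fun t => erefl) (fun t => erefl)) => t; have [? ?] := df t; have ? := dsV t.
  by apply: is_derive_eq; rewrite /GRing.scale /=; ring.
by apply: is_derive_eq; rewrite /GRing.scale /=; ring.
Qed.

Lemma is_cderive_unique f f1 f2 : is_cderive f f1 -> is_cderive f f2 -> f1 = f2.
Proof.
move=> d1 d2; apply/funext => t; have [a1 b1] := d1 t; have [a2 b2] := d2 t.
apply: complexP.
  by rewrite -(@derive_val _ _ _ _ _ _ _ a1) (@derive_val _ _ _ _ _ _ _ a2).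
by rewrite -(@derive_val _ _ _ _ _ _ _ b1) (@derive_val _ _ _ _ _ _ _ b2).
Qed.

Lemma is_cderive_eq f f1 f2 : is_cderive f f1 -> f1 =1 f2 -> is_cderive f f2.
Proof. by move=> df /funext <-. Qed.

Lemma is_cderive_eq2 f1 f2 g1 g2 :
  f1 =1 f2 -> g1 =1 g2 -> is_cderive f1 g1 -> is_cderive f2 g2.
Proof. by move=> /funext -> /funext ->. Qed.

Lemma is_cderive_sum (I : Type) (r : seq I) (Q : pred I) (F F' : I -> R -> C) :
  (forall i, is_cderive (F i) (F' i)) ->
  is_cderive (fun t => \sum_(i <- r | Q i) F i t) (fun t => \sum_(i <- r | Q i) F' i t).
Proof.
move=> dF; elim: r => [|i r IH].
  by apply: is_cderive_eq2 (is_cderive_cst 0) => t; rewrite big_nil.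
case: (boolP (Q i)) => Qi.
  by apply: is_cderive_eq2 (is_cderiveD (dF i) IH) => t; rewrite big_cons Qi.
by apply: is_cderive_eq2 IH => t; rewrite big_cons (negbTE Qi).
Qed.

Lemma cderivable_continuous f : cderivable f ->
  continuous (fun v => Re (f v)) /\ continuous (fun v => Im (f v)).
Proof.
move=> [f' df]; split=> u; have [a b] := df u;
  by apply: differentiable_continuous; apply/derivable1_diffP; case: a b => // ? ? [].
Qed.

Lemma cderivableM f g : cderivable f -> cderivable g -> cderivable (fun t => f t * g t).
Proof. by move=> [f' df] [g' dg]; eexists; exact: is_cderiveM. Qed.

Lemma cderivableD f g : cderivable f -> cderivable g -> cderivable (fun t => f t + g t).
Proof. by move=> [f' df] [g' dg]; eexists; exact: is_cderiveD. Qed.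

Lemma cderivable_cst z : cderivable (fun=> z).
Proof. by eexists; exact: is_cderive_cst. Qed.

Lemma cderivableJ f : cderivable f -> cderivable (fun t => (f t)^*).
Proof. by move=> [f' df]; eexists; exact: is_cderiveJ. Qed.

End LineDerivative.

(** * Wirtinger calculus and complex integration by parts *)

Section Smooth.
Context {R : realType} {n p : nat}.
Local Notation C := R[i].
Local Notation coordT := ('I_n * 'I_p * bool)%type.
Local Notation mx := 'M[C]_(n, p).
Local Notation mxspace := (g_sigma_algebraType (@boxes R n p)).
Local Notation Re := (@complex.Re R).
Local Notation Im := (@complex.Im R).
Implicit Types (c : coordT) (M : mx) (F G : mx -> C).

Definition line c M (u : R) : mx := M + u%:C%C *: dirmx c.

(** Kept apart from growth because regularity passes to inverses while growth does not; for the
    resolvent the growth bound comes from [e * rtr <= n] instead. *)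
Definition regular F :=
  cmeasurable (F : mxspace -> C) /\ forall c M, cderivable (fun u => F (line c M u)).

Definition cgrowth F := poly_growth (Re \o F) /\ poly_growth (Im \o F).

Definition tame F := regular F /\ cgrowth F.

Lemma regular_cst (z : C) : regular (fun=> z).
Proof. by split=> [|c M]; [exact: cmeasurable_cst|exact: cderivable_cst]. Qed.

Lemma regularD F G : regular F -> regular G -> regular (fun M => F M + G M).
Proof.
by move=> [mF dF] [mG dG]; split=> [|c M]; [exact: cmeasurableD|exact: cderivableD].
Qed.

Lemma regularM F G : regular F -> regular G -> regular (fun M => F M * G M).
Proof.
by move=> [mF dF] [mG dG]; split=> [|c M]; [exact: cmeasurableM|exact: cderivableM].
Qed.

Lemma regularJ F : regular F -> regular (fun M => (F M)^*).
Proof.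
by move=> [mF dF]; split=> [|c M]; [exact: cmeasurableJ|exact: cderivableJ].
Qed.

Lemma regularV F : (forall M, F M != 0) -> regular F -> regular (fun M => (F M)^-1).
Proof.
by move=> F0 [mF dF]; split=> [|c M]; [exact: cmeasurableV|exact: cderivableV].
Qed.

Lemma regular_sum (I : Type) (r : seq I) (Q : pred I) (F : I -> mx -> C) :
  (forall i, Q i -> regular (F i)) -> regular (fun M => \sum_(i <- r | Q i) F i M).
Proof. by move=> hF; apply: big_fun_closed => //; [exact: regular_cst|exact: regularD]. Qed.

Lemma regular_prod (I : Type) (r : seq I) (Q : pred I) (F : I -> mx -> C) :
  (forall i, Q i -> regular (F i)) -> regular (fun M => \prod_(i <- r | Q i) F i M).
Proof. by move=> hF; apply: big_fun_closed => //; [exact: regular_cst|exact: regularM]. Qed.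

Lemma unit_dirE c M u a b :
  line c M u a b = M a b + u%:C%C * (@unit_dir R c.2 * (c.1 == (a, b))%:R).
Proof.
case: c => [[a' b'] e]; rewrite !mxE /= xpair_eqE.
by rewrite (eq_sym a') (eq_sym b').
Qed.

Lemma regular_entry a b : regular (fun M => M a b).
Proof.
split=> [|c M].
  by split; [exact: (measurable_rcoordmx (a, b, false))|exact: (measurable_rcoordmx (a, b, true))].
eexists; apply: is_cderive_eq2 (is_cderive_line (M a b) (@unit_dir R c.2 * (c.1 == (a, b))%:R)) => //.
by move=> u; rewrite unit_dirE.
Qed.

Lemma cgrowth_parts F (u v : mx -> R) : (forall M, Re (F M) = u M) -> (forall M, Im (F M) = v M) ->
  poly_growth u -> poly_growth v -> cgrowth F.
Proof.
by move=> fu fv gu gv; split; [apply: eq_fun_prop gu => M; rewrite /= fu|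
  apply: eq_fun_prop gv => M; rewrite /= fv].
Qed.

Lemma cgrowthD F G : cgrowth F -> cgrowth G -> cgrowth (fun M => F M + G M).
Proof.
move=> [f1 f2] [g1 g2]; apply: (cgrowth_parts (fun M => cReD _ _) (fun M => cImD _ _)).
  exact: (poly_growthD f1 g1).
exact: (poly_growthD f2 g2).
Qed.

Lemma cgrowthM F G : cgrowth F -> cgrowth G -> cgrowth (fun M => F M * G M).
Proof.
move=> [f1 f2] [g1 g2]; apply: (cgrowth_parts (fun M => cReM (F M) (G M)) (fun M => cImM (F M) (G M))).
  exact: (poly_growthD (poly_growthM f1 g1) (poly_growthN (poly_growthM f2 g2))).
exact: (poly_growthD (poly_growthM f1 g2) (poly_growthM f2 g1)).
Qed.

Lemma cgrowth_bounded F (K : R) : (forall M, `|F M| <= K%:C%C) -> cgrowth F.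
Proof.
move=> h; split; apply: (@poly_growth_bounded _ _ _ _ K) => M;
  have := h M; rewrite normc_def lecR; apply: le_trans;
  by rewrite -sqrtr_sqr ler_wsqrtr // ?lerDl ?lerDr sqr_ge0.
Qed.

Lemma cgrowthJ F : cgrowth F -> cgrowth (fun M => (F M)^*).
Proof.
move=> [f1 f2]; apply: (cgrowth_parts (fun M => cReJ _) (fun M => cImJ _)) => //.
exact: poly_growthN.
Qed.

Lemma tame_cst (z : C) : tame (fun=> z).
Proof.
split; first exact: regular_cst.
apply: (@cgrowth_bounded _ (Num.sqrt (Re z ^+ 2 + Im z ^+ 2))) => M.
by rewrite normc_def.
Qed.

Lemma tameD F G : tame F -> tame G -> tame (fun M => F M + G M).
Proof. by move=> [? ?] [? ?]; split; [exact: regularD|exact: cgrowthD]. Qed.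

Lemma tameM F G : tame F -> tame G -> tame (fun M => F M * G M).
Proof. by move=> [? ?] [? ?]; split; [exact: regularM|exact: cgrowthM]. Qed.

Lemma tameJ F : tame F -> tame (fun M => (F M)^*).
Proof. by move=> [? ?]; split; [exact: regularJ|exact: cgrowthJ]. Qed.

Lemma tameN F : tame F -> tame (fun M => - F M).
Proof.
by move=> tF; apply: eq_fun_prop (tameM (tame_cst (-1)) tF) => M; rewrite mulN1r.
Qed.

Lemma tameB F G : tame F -> tame G -> tame (fun M => F M - G M).
Proof. by move=> tF tG; apply: tameD => //; exact: tameN. Qed.

Lemma tame_sum (I : Type) (r : seq I) (Q : pred I) (F : I -> mx -> C) :
  (forall i, Q i -> tame (F i)) -> tame (fun M => \sum_(i <- r | Q i) F i M).
Proof. by move=> hF; apply: big_fun_closed => //; [exact: tame_cst|exact: tameD]. Qed.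

Lemma tame_prod (I : Type) (r : seq I) (Q : pred I) (F : I -> mx -> C) :
  (forall i, Q i -> tame (F i)) -> tame (fun M => \prod_(i <- r | Q i) F i M).
Proof. by move=> hF; apply: big_fun_closed => //; [exact: tame_cst|exact: tameM]. Qed.

Lemma tame_entry a b : tame (fun M => M a b).
Proof.
split; first exact: regular_entry.
by split; [exact: (poly_growth_coord (a, b, false))|exact: (poly_growth_coord (a, b, true))].
Qed.

(* [dF a b] and [dbF a b] are the Wirtinger derivatives of [F] with respect to
   the entry [z_ab] and to its conjugate. *)
Record smooth F (dF dbF : 'I_n -> 'I_p -> mx -> C) : Prop := Smooth {
  smooth_tame : tame F;
  smooth_d : forall a b, tame (dF a b);
  smooth_db : forall a b, tame (dbF a b);
  smooth_der : forall c M, is_cderive (fun u => F (line c M u))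
    (fun u => @unit_dir R c.2 * dF c.1.1 c.1.2 (line c M u)
            + (@unit_dir R c.2)^* * dbF c.1.1 c.1.2 (line c M u)) }.

Lemma smooth_cst (z : C) : smooth (fun=> z) (fun _ _ _ => 0) (fun _ _ _ => 0).
Proof.
split=> [|a b|a b|c M]; try exact: tame_cst.
by apply: is_cderive_eq (is_cderive_cst z) _ => u; rewrite !mulr0 addr0.
Qed.

Lemma smoothD F dF dbF G dG dbG : smooth F dF dbF -> smooth G dG dbG ->
  smooth (fun M => F M + G M) (fun a b M => dF a b M + dG a b M)
    (fun a b M => dbF a b M + dbG a b M).
Proof.
move=> [tF t1 t2 d] [tG s1 s2 e]; split=> [|a b|a b|c M]; try exact: tameD.
apply: is_cderive_eq (is_cderiveD (d c M) (e c M)) _ => u.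
by rewrite !mulrDr addrACA.
Qed.

Lemma smoothM F dF dbF G dG dbG : smooth F dF dbF -> smooth G dG dbG ->
  smooth (fun M => F M * G M) (fun a b M => dF a b M * G M + F M * dG a b M)
    (fun a b M => dbF a b M * G M + F M * dbG a b M).
Proof.
move=> [tF t1 t2 d] [tG s1 s2 e]; split=> [|a b|a b|c M]; try exact: tameM.
- by apply: tameD; exact: tameM.
- by apply: tameD; exact: tameM.
apply: is_cderive_eq (is_cderiveM (d c M) (e c M)) _ => u.
by rewrite mulrDl !mulrDr !mulrA addrACA !(mulrC (F _) (unit_dir _)) !(mulrC (F _) (_^*)).
Qed.

Lemma smoothJ F dF dbF : smooth F dF dbF ->
  smooth (fun M => (F M)^*) (fun a b M => (dbF a b M)^*) (fun a b M => (dF a b M)^*).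
Proof.
move=> [tF t1 t2 d]; split=> [|a b|a b|c M]; try exact: tameJ.
apply: is_cderive_eq (is_cderiveJ (d c M)) _ => u.
by rewrite rmorphD !rmorphM /= conjCK addrC.
Qed.

Lemma smooth_entry a b : smooth (fun M => M a b)
  (fun a' b' _ => ((a', b') == (a, b))%:R) (fun _ _ _ => 0).
Proof.
split=> [|a' b'|a' b'|c M]; [exact: tame_entry|exact: tame_cst|exact: tame_cst|].
apply: is_cderive_eq2 (is_cderive_line (M a b) (@unit_dir R c.2 * (c.1 == (a, b))%:R)) => u.
  by rewrite unit_dirE.
by rewrite mulr0 addr0 -surjective_pairing.
Qed.

Lemma smooth_eq F dF dbF F' dF' dbF' : smooth F dF dbF -> (forall M, F M = F' M) ->
  (forall a b M, dF a b M = dF' a b M) -> (forall a b M, dbF a b M = dbF' a b M) ->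
  smooth F' dF' dbF'.
Proof.
move=> h e0 e1 e2; have -> : dF' = dF by do 3!apply/funext=> ?; rewrite e1.
have -> : dbF' = dbF by do 3!apply/funext=> ?; rewrite e2.
by have -> : F' = F by apply/funext.
Qed.

Lemma smooth_sum (I : Type) (r : seq I) (F : I -> mx -> C) dF dbF :
  (forall i, smooth (F i) (dF i) (dbF i)) ->
  smooth (fun M => \sum_(i <- r) F i M) (fun a b M => \sum_(i <- r) dF i a b M)
    (fun a b M => \sum_(i <- r) dbF i a b M).
Proof.
move=> sF; elim: r => [|i r IH].
  by apply: (smooth_eq (smooth_cst 0)) => [M|a b M|a b M]; rewrite big_nil.
by apply: (smooth_eq (smoothD (sF i) IH)) => [M|a b M|a b M]; rewrite big_cons.
Qed.

Lemma smooth_prod (I : finType) (Q : pred I) (F : I -> mx -> C) dF dbF :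
  (forall i, smooth (F i) (dF i) (dbF i)) ->
  smooth (fun M => \prod_(i | Q i) F i M)
    (fun a b M => \sum_(i | Q i) dF i a b M * \prod_(j | Q j && (j != i)) F j M)
    (fun a b M => \sum_(i | Q i) dbF i a b M * \prod_(j | Q j && (j != i)) F j M).
Proof.
move=> sF.
(* The induction runs over duplicate-free lists, so that [j != i] removes exactly one factor. *)
have seqv (r : seq I) : uniq r -> smooth (fun M => \prod_(i <- r | Q i) F i M)
    (fun a b M => \sum_(i <- r | Q i) dF i a b M * \prod_(j <- r | Q j && (j != i)) F j M)
    (fun a b M => \sum_(i <- r | Q i) dbF i a b M * \prod_(j <- r | Q j && (j != i)) F j M).
  elim: r => [_|i r IH /= /andP[ir ur]].
    by apply: (smooth_eq (smooth_cst 1)) => [M|a b M|a b M]; rewrite big_nil.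
  have sIH := IH ur.
  have rest (D : I -> 'I_n -> 'I_p -> mx -> C) a b M : Q i ->
      \sum_(i0 <- i :: r | Q i0) D i0 a b M * \prod_(j <- i :: r | Q j && (j != i0)) F j M
      = D i a b M * \prod_(j <- r | Q j) F j M +
        F i M * \sum_(i0 <- r | Q i0) D i0 a b M * \prod_(j <- r | Q j && (j != i0)) F j M.
    move=> Qi; rewrite big_cons Qi big_cons eqxx andbF; congr (_ * _ + _).
      rewrite big_seq_cond [RHS]big_seq_cond; apply: eq_bigl => j.
      by case: (boolP (j \in r)) => //= jr; rewrite (memPn ir) ?andbT.
    rewrite mulr_sumr big_seq_cond [RHS]big_seq_cond; apply: eq_bigr => i0 /andP[i0r _].
    by rewrite big_cons Qi eq_sym (memPn ir) //= mulrCA.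
  have rest' (D : I -> 'I_n -> 'I_p -> mx -> C) a b M : ~~ Q i ->
      \sum_(i0 <- i :: r | Q i0) D i0 a b M * \prod_(j <- i :: r | Q j && (j != i0)) F j M
      = \sum_(i0 <- r | Q i0) D i0 a b M * \prod_(j <- r | Q j && (j != i0)) F j M.
    move=> /negbTE Qi; rewrite big_cons Qi; apply: eq_bigr => i0 _.
    by rewrite big_cons Qi.
  case: (boolP (Q i)) => Qi.
    by apply: (smooth_eq (smoothM (sF i) sIH)) => [M|a b M|a b M];
      [rewrite big_cons Qi|rewrite rest|rewrite rest].
  by apply: (smooth_eq sIH) => [M|a b M|a b M];
    [rewrite big_cons (negbTE Qi)|rewrite rest'|rewrite rest'].
exact: (seqv _ (index_enum_uniq I)).
Qed.

Section IBP.
Context {d : measure_display} {T : measurableType d} (P : probability T R).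
Variable Z : T -> mxspace.
Hypothesis gZ : gaussian_mx P Z.

Lemma cintegrable_tame F : tame F -> cintegrable P (F \o Z).
Proof.
by move=> [[[m1 m2] _] [g1 g2]]; split;
  [exact: (integrable_gaussian gZ m1 g1)|exact: (integrable_gaussian gZ m2 g2)].
Qed.

Lemma real_ibp c F dF dbF : smooth F dF dbF ->
  cexpectation P (fun t => (rcoordmx c (Z t))%:C%C * F (Z t)) =
  cexpectation P (fun t => 2^-1%:C%C * (@unit_dir R c.2 * dF c.1.1 c.1.2 (Z t)
            + (@unit_dir R c.2)^* * dbF c.1.1 c.1.2 (Z t))).
Proof.
move=> [[[[m1 m2] _] [g1 g2]] td tdb der].
pose D M := @unit_dir R c.2 * dF c.1.1 c.1.2 M + (@unit_dir R c.2)^* * dbF c.1.1 c.1.2 M.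
have [[[mD1 mD2] derD] [gD1 gD2]] : tame D.
  by apply: tameD; apply: tameM => //; exact: tame_cst.
have dRe M (v : R) : is_derive v 1 (fun v : R => Re (F (line c M v))) (Re (D (line c M v))).
  by have [] := der c M v.
have dIm M (v : R) : is_derive v 1 (fun v : R => Im (F (line c M v))) (Im (D (line c M v))).
  by have [] := der c M v.
have e1 := @ibp_gaussian _ _ _ _ _ P Z gZ c (Re \o F) (Re \o D) m1 mD1 g1 gD1 dRe
  (fun M => proj1 (cderivable_continuous (derD c M))).
have e2 := @ibp_gaussian _ _ _ _ _ P Z gZ c (Im \o F) (Im \o D) m2 mD2 g2 gD2 dIm
  (fun M => proj2 (cderivable_continuous (derD c M))).
apply: complexP; rewrite !(Re_cexpectation, Im_cexpectation); congr fine.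
  apply: etrans (etrans e1 _); apply: eq_integral => t _.
    by rewrite cReM /= mul0r subr0.
  by rewrite cReM /= mul0r subr0.
apply: etrans (etrans e2 _); apply: eq_integral => t _.
  by rewrite cImM /= mul0r addr0.
by rewrite cImM /= mul0r addr0.
Qed.

(** With [z = x + i y], [d/dx = d + db] and [d/dy = i (d - db)]; in the combination [x + i y] the
    [d] parts cancel and the two halves of [db] add up. The conjugate is symmetric. *)
Lemma complex_ibp F dF dbF a b : smooth F dF dbF ->
  cexpectation P (fun t => Z t a b * F (Z t)) = cexpectation P (dbF a b \o Z) /\
  cexpectation P (fun t => (Z t a b)^* * F (Z t)) = cexpectation P (dF a b \o Z).
Proof.
move=> sF; have [tF td tdb _] := sF.
have h1 := real_ibp (a, b, false) sF; have h2 := real_ibp (a, b, true) sF.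
have ix e : cintegrable P (fun t => (rcoordmx (a, b, e) (Z t))%:C%C * F (Z t)).
  apply: (@cintegrable_tame (fun M => (rcoordmx (a, b, e) M)%:C%C * F M)).
  apply: tameM => //; split; last first.
    apply: (@cgrowth_parts _ (rcoordmx (a, b, e)) (fun=> 0)) => //.
      exact: poly_growth_coord.
    by apply: (@poly_growth_bounded _ _ _ _ 0) => M; rewrite normr0.
  split; first by split; [exact: measurable_rcoordmx|exact: measurable_cst].
  move=> c M; eexists; apply: is_cderive_eq2
    (is_cderive_line (rcoordmx (a, b, e) M)%:C%C ((1 : R) *+ ((a, b, e) == c))%:C%C) => // u.
  rewrite /line rcoordmx_line; apply: complexP => /=.
    by case: (_ == c); rewrite /= ?mulr1n ?mulr0n; ring.
  by ring.
have id := cintegrable_tame (td a b); have idb := cintegrable_tame (tdb a b).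
have half : (2^-1)%:C%C * 2 = 1 :> C.
  by apply: complexP => /=; lra.
have e1 : cexpectation P (fun t => (rcoordmx (a, b, false) (Z t))%:C%C * F (Z t)) =
    (2^-1)%:C%C * (cexpectation P (dF a b \o Z) + cexpectation P (dbF a b \o Z)).
  rewrite h1 /= -cexpectationD // -cexpectationZ; last exact: cintegrableD.
  by congr cexpectation; apply/funext => t; rewrite conjC1 !mul1r.
have e2 : cexpectation P (fun t => (rcoordmx (a, b, true) (Z t))%:C%C * F (Z t)) =
    (2^-1)%:C%C * ('i%C * (cexpectation P (dF a b \o Z) - cexpectation P (dbF a b \o Z))).
  rewrite h2 /= -cexpectationB // -!cexpectationZ; first last.
  - exact: cintegrableB.
  - by apply: cintegrableZ; exact: cintegrableB.
  congr cexpectation; apply/funext => t; congr (_ * _).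
  rewrite mulrBr; congr (_ + _); rewrite -mulNr; congr (_ * _).
  by apply: complexP => /=; lra.
have zE t : Z t a b = (rcoordmx (a, b, false) (Z t))%:C%C +
    'i%C * (rcoordmx (a, b, true) (Z t))%:C%C.
  by apply: complexP; rewrite /rcoordmx /= ?(cReD, cImD, cReM, cImM) /=; ring.
have zJ t : (Z t a b)^* = (rcoordmx (a, b, false) (Z t))%:C%C -
    'i%C * (rcoordmx (a, b, true) (Z t))%:C%C.
  rewrite zE; apply: complexP => /=; by ring.
have ii : 'i%C * 'i%C = -1 :> C by apply: complexP => /=; ring.
have iy := cintegrableZ 'i%C (ix true).
have split1 : cexpectation P (fun t => Z t a b * F (Z t)) =
   cexpectation P (fun t => (rcoordmx (a, b, false) (Z t))%:C%C * F (Z t)) +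
   'i%C * cexpectation P (fun t => (rcoordmx (a, b, true) (Z t))%:C%C * F (Z t)).
  rewrite -cexpectationZ // -cexpectationD //; congr cexpectation; apply/funext => t.
  by rewrite zE mulrDl mulrA.
have split2 : cexpectation P (fun t => (Z t a b)^* * F (Z t)) =
   cexpectation P (fun t => (rcoordmx (a, b, false) (Z t))%:C%C * F (Z t)) -
   'i%C * cexpectation P (fun t => (rcoordmx (a, b, true) (Z t))%:C%C * F (Z t)).
  rewrite -cexpectationZ // -cexpectationB //; congr cexpectation; apply/funext => t.
  by rewrite zJ mulrBl mulrA.
rewrite split1 split2 e1 e2.
set x := cexpectation P (dF a b \o Z); set y := cexpectation P (dbF a b \o Z).
have -> : 'i%C * ((2^-1)%:C%C * ('i%C * (x - y))) = (2^-1)%:C%C * (y - x) :> C.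
  by rewrite mulrCA (mulrA 'i%C) ii mulN1r opprB.
rewrite -mulrDr -mulrBr.
have -> : x + y + (y - x) = 2 * y by rewrite addrC addrA subrK mulrDl mul1r.
have -> : x + y - (y - x) = 2 * x.
  by rewrite opprB addrA addrAC addrK mulrDl mul1r.
by rewrite !mulrA half !mul1r.
Qed.

End IBP.
End Smooth.

(** * Schwinger-Dyson equations for the resolvent *)

Section SmoothResolvent.
Context {R : realType} {n p : nat}.
Local Notation C := R[i].
Local Notation mx := 'M[C]_(n, p).

Definition mregular a b (F : mx -> 'M[C]_(a, b)) := forall i j, regular (fun M => F M i j).

Lemma mregularM a b c (F : mx -> 'M[C]_(a, b)) (G : mx -> 'M[C]_(b, c)) :
  mregular F -> mregular G -> mregular (fun M => F M *m G M).
Proof.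
move=> hF hG i j; apply: eq_fun_prop (regular_sum (index_enum _) (Q := xpredT)
  (F := fun l M => F M i l * G M l j) _) => [M|l _]; first by rewrite mxE.
exact: regularM.
Qed.

Lemma mregular_adj a b (F : mx -> 'M[C]_(a, b)) : mregular F -> mregular (fun M => (F M)^t*).
Proof.
by move=> hF i j; apply: eq_fun_prop (regularJ (hF j i)) => M; rewrite adjmxE.
Qed.

Lemma regular_det a (F : mx -> 'M[C]_a) : mregular F -> regular (fun M => \det (F M)).
Proof.
move=> hF; apply: regular_sum => s _; apply: regularM; first exact: regular_cst.
by apply: regular_prod => i _; exact: hF.
Qed.

(** Cramer's rule: the entries are cofactors over the determinant. *)
Lemma mregular_inv a (F : mx -> 'M[C]_a) : (forall M, F M \in unitmx) ->
  mregular F -> mregular (fun M => invmx (F M)).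
Proof.
move=> uF hF i j.
apply: eq_fun_prop (regularM (regularV (F := fun M => \det (F M)) _ (regular_det hF))
  (G := fun M => (\adj (F M)) i j) _).
- by move=> M; rewrite /invmx uF !mxE.
- by move=> M; have := uF M; rewrite unitmxE unitfE.
apply: eq_fun_prop (regularM (regular_cst ((-1) ^+ (j + i)))
  (regular_det (F := fun M => row' j (col' i (F M))) _)) => [M|l m].
  by rewrite mxE.
by apply: eq_fun_prop (hF (lift j l) (lift i m)) => M; rewrite !mxE.
Qed.

Definition is_mderive a b (F F' : R -> 'M[C]_(a, b)) :=
  forall i j, is_cderive (fun u => F u i j) (fun u => F' u i j).

Lemma is_mderiveM a b c (F F' : R -> 'M[C]_(a, b)) (G G' : R -> 'M[C]_(b, c)) :
  is_mderive F F' -> is_mderive G G' ->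
  is_mderive (fun u => F u *m G u) (fun u => F' u *m G u + F u *m G' u).
Proof.
move=> dF dG i j; apply: is_cderive_eq2 (is_cderive_sum (index_enum _) xpredT
  (fun l => is_cderiveM (dF i l) (dG l j))) => u; rewrite ?mxE //.
by rewrite big_split.
Qed.

Lemma is_mderive_unique a b (F F1 F2 : R -> 'M[C]_(a, b)) :
  is_mderive F F1 -> is_mderive F F2 -> forall u, F1 u = F2 u.
Proof.
move=> d1 d2 u; apply/matrixP => i j.
exact: (congr1 (fun f => f u) (is_cderive_unique (d1 i j) (d2 i j))).
Qed.

Lemma is_mderive_inv a (F F' : R -> 'M[C]_a) : (forall u, F u \in unitmx) ->
  is_mderive F F' -> (forall i j, cderivable (fun u => invmx (F u) i j)) ->
  is_mderive (fun u => invmx (F u)) (fun u => - (invmx (F u) *m F' u *m invmx (F u))).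
Proof.
move=> uF dF dI.
(* The entrywise derivatives exist by hypothesis; differentiating [F F^-1 = 1] identifies them. *)
pose D i j := sval (cid (dI i j)).
have dD : is_mderive (fun u => invmx (F u)) (fun u => \matrix_(i, j) D i j u).
  move=> i j; apply: is_cderive_eq (svalP (cid (dI i j))) _ => u; by rewrite mxE.
have d1 := is_mderiveM dF dD.
have d0 : is_mderive (fun u => F u *m invmx (F u)) (fun u => 0).
  move=> i j; apply: is_cderive_eq2 (is_cderive_cst ((1%:M : 'M[C]_a) i j)) => u.
    by rewrite mulmxV.
  by rewrite mxE.
have e u : (\matrix_(i, j) D i j u) = - (invmx (F u) *m F' u *m invmx (F u)).
  have /eqP := is_mderive_unique d1 d0 u; rewrite addrC addr_eq0 => /eqP e.
  by rewrite -[LHS](mulKmx (uF u)) e mulmxN mulmxA.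
by move=> i j; apply: is_cderive_eq (dD i j) _ => u; rewrite -e.
Qed.

Variable e : R.
Hypothesis e0 : 0 < e.
Local Notation ec := (e%:C%C : C).

Let ec0 : 0 < ec. Proof. by rewrite ltcR. Qed.
Let uA (M : mx) : shifted_gram ec M \in unitmx. Proof. exact: shifted_gram_unit. Qed.
Local Notation Rz := (resolvent ec).
Local Notation Y := (reg_pinv ec).

Lemma mregular_id : mregular (fun M : mx => M).
Proof. by move=> i j; exact: regular_entry. Qed.

Lemma mregular_gram : mregular (fun M : mx => shifted_gram ec M).
Proof.
move=> i j; apply: eq_fun_prop (regularD (mregularM mregular_id (mregular_adj mregular_id) i j)
  (regular_cst ((ec%:M : 'M[C]_n) i j))) => M; by rewrite [RHS]mxE.
Qed.

Lemma mregular_resolvent : mregular (fun M : mx => Rz M).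
Proof. exact: (mregular_inv uA mregular_gram). Qed.

Lemma mregular_reg_pinv : mregular (fun M : mx => Y M).
Proof. exact: (mregularM (mregular_adj mregular_id) mregular_resolvent). Qed.

Lemma tame_resolvent i j : tame (fun M : mx => Rz M i j).
Proof.
split; first exact: mregular_resolvent.
apply: (@cgrowth_bounded _ _ _ _ (n%:R / e)) => M.
rewrite (le_trans (resolvent_le_rtr (ltW ec0) (uA M) i j)) //.
rewrite rmorphM /= fmorphV /= ler_pdivlMr // mulrC.
by rewrite (le_trans (e_rtr_le (ltW ec0) (uA M))) // rmorph_nat.
Qed.

Lemma tame_reg_pinv i j : tame (fun M : mx => Y M i j).
Proof.
split; first exact: mregular_reg_pinv.
(* [1 + n / e] stands in for the square root of [n / e]: its square dominates [n / e]. *)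
apply: (@cgrowth_bounded _ _ _ _ (1 + n%:R / e)) => M.
have t0 : 0 <= (n%:R / e : R) by rewrite divr_ge0 // ltW.
have h : `|Y M i j| ^+ 2 <= (n%:R / e)%:C%C.
  rewrite (le_trans (reg_pinv_le_rtr (ltW ec0) (uA M) i j)) //.
  rewrite rmorphM /= fmorphV /= ler_pdivlMr // mulrC.
  by rewrite (le_trans (e_rtr_le (ltW ec0) (uA M))) // rmorph_nat.
have K0 : 0 <= (1 + n%:R / e)%:C%C :> C by rewrite lecR addr_ge0.
suff : `|Y M i j| ^+ 2 <= (1 + n%:R / e)%:C%C ^+ 2 by rewrite ler_pXn2r ?nnegrE.
by apply: (le_trans h); rewrite -rmorphXn /= lecR; nra.
Qed.

Lemma is_mderive_resolvent (c : 'I_n * 'I_p * bool) M :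
  let xi := @unit_dir R c.2 in let E := delta_mx c.1.1 c.1.2 in
  is_mderive (fun u => Rz (line c M u)) (fun u => - (Rz (line c M u) *m
    (xi *: (E *m (line c M u)^t*) + xi^* *: (line c M u *m E^t*)) *m Rz (line c M u))).
Proof.
move=> xi E.
have dM : is_mderive (fun u => line c M u) (fun=> xi *: E).
  move=> i j; apply: is_cderive_eq2 (is_cderive_line (M i j) ((xi *: E) i j)) => // u.
  by rewrite !mxE.
have dMt : is_mderive (fun u => (line c M u)^t*) (fun=> xi^* *: E^t*).
  move=> i j; apply: is_cderive_eq2 (is_cderiveJ (dM j i)) => u; rewrite ?adjmxE //.
  by rewrite -adjmxE adjmxZ.
apply: is_mderive_inv => [u|i j|i j]; first exact: uA.
  apply: is_cderive_eq2 (is_cderiveD (is_mderiveM dM dMt i j) (is_cderive_cst ((ec%:M : 'M[C]_n) i j))) => u.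
    by rewrite [RHS]mxE.
  by rewrite addr0 -scalemxAl -scalemxAr.
by have [_] := mregular_resolvent i j; apply.
Qed.

End SmoothResolvent.

Lemma mul_delta_mx_entry (A : pzSemiRingType) m n k l (X : 'M[A]_(m, n)) (Z : 'M[A]_(k, l)) a b i j :
  (X *m delta_mx a b *m Z) i j = X i a * Z b j.
Proof.
rewrite mxE (bigD1 b) //= big1 ?addr0 => [|c cb].
  congr (_ * _); rewrite mxE (bigD1 a) //= big1 ?addr0 => [|c ca].
    by rewrite mxE !eqxx mulr1.
  by rewrite mxE (negbTE ca) mulr0.
by rewrite mxE big1 ?mul0r // => d _; rewrite mxE (negbTE cb) andbF mulr0.
Qed.

Lemma perturbed_gram_entry (A : comPzRingType) n p (X B : 'M[A]_n) (M D : 'M[A]_(n, p))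
  (N E : 'M[A]_(p, n)) (z w : A) i j :
  (X *m (z *: (D *m N) + w *: (M *m E)) *m B) i j =
  z * (X *m D *m N *m B) i j + w * (X *m M *m E *m B) i j.
Proof.
rewrite mulmxDr mulmxDl -!scalemxAr -!scalemxAl mxE [X in X + _]mxE [X in _ + X]mxE.
by rewrite !mulmxA.
Qed.

Section SchwingerDyson.
Context {R : realType} {n p : nat}.
Local Notation C := R[i].
Local Notation mx := 'M[C]_(n, p).
Local Notation mxspace := (g_sigma_algebraType (@boxes R n p)).

Variable e : R.
Hypothesis e0 : 0 < e.
Local Notation ec := (e%:C%C : C).

Let ec0 : 0 < ec. Proof. by rewrite ltcR. Qed.
Let ec_ge0 : 0 <= ec. Proof. exact: ltW. Qed.
Let uA (M : mx) : shifted_gram ec M \in unitmx. Proof. exact: shifted_gram_unit. Qed.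
Local Notation Rz := (resolvent ec).
Local Notation Y := (reg_pinv ec).

(** From [dR = - R dM M^* R - R M dM^* R]: the first term is linear in [dM] and gives the derivative
    in [z_ab], the second is antilinear and gives the one in its conjugate; [M^* R] and [R M] are
    [Y] and [Y^*]. *)
Lemma smooth_resolvent i j : smooth (fun M : mx => Rz M i j)
  (fun a b M => - (Rz M i a * Y M b j)) (fun a b M => - ((Y M b i)^* * Rz M a j)).
Proof.
split=> [|a b|a b|c M]; first exact: tame_resolvent.
- by apply: tameN; apply: tameM; [exact: tame_resolvent|exact: tame_reg_pinv].
- by apply: tameN; apply: tameM; [apply: tameJ; exact: tame_reg_pinv|exact: tame_resolvent].
apply: is_cderive_eq (is_mderive_resolvent e0 c M i j) _ => u /=.
set N := line c M u; set xi := unit_dir _.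
rewrite mxE perturbed_gram_entry -(mulmxA _ (N^t*)) mul_delta_mx_entry.
rewrite [X in _ + _ * X](_ : _ = (Y N c.1.2 i)^* * Rz N c.1.1 j); last first.
  have -> : (delta_mx c.1.1 c.1.2 : mx)^t* = delta_mx c.1.2 c.1.1.
    by rewrite trmx_delta map_delta_mx.
  by rewrite mul_delta_mx_entry -(reg_pinv_adj N ec_ge0) adjmxE.
by rewrite !mulrN opprD.
Qed.

(** Product rule for [M^* R]. The conjugate derivative sees both factors, hence the factor
    [1 - Y M]. *)
Lemma smooth_reg_pinv i j : smooth (fun M : mx => Y M i j)
  (fun a b M => - (Y M i a * Y M b j))
  (fun a b M => ((i == b)%:R - (Y M *m M) i b) * Rz M a j).
Proof.
have sm l : smooth (fun M : mx => (M l i)^* * Rz M l j)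
    (fun a b M => - ((M l i)^* * (Rz M l a * Y M b j)))
    (fun a b M => ((a, b) == (l, i))%:R * Rz M l j - (M l i)^* * ((Y M b l)^* * Rz M a j)).
  apply: (smooth_eq (smoothM (smoothJ (smooth_entry l i)) (smooth_resolvent l j))) => // a b M.
    by rewrite conjC0 mul0r add0r mulrN.
  by rewrite conjC_nat mulrN.
apply: (smooth_eq (smooth_sum (index_enum _) sm)) => [M|a b M|a b M].
- by rewrite mxE; apply: eq_bigr => l _; rewrite adjmxE.
- rewrite sumrN; congr (- _); rewrite [in RHS]mxE mulr_suml; apply: eq_bigr => l _.
  by rewrite adjmxE mulrA.
- rewrite sumrB mulrBl; congr (_ - _).
    rewrite (bigD1 a) //= big1 ?addr0 => [|l la].
      by rewrite xpair_eqE eqxx /= eq_sym.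
    by rewrite xpair_eqE eq_sym (negbTE la) mul0r.
  have -> : (Y M *m M) i b = \sum_l (M l i)^* * (Y M b l)^*.
    have -> : Y M *m M = M^t* *m (Y M)^t*.
      by rewrite (reg_pinv_adj M ec_ge0) mulmxA.
    by rewrite mxE; apply: eq_bigr => l _; rewrite !adjmxE.
  by rewrite mulr_suml; apply: eq_bigr => l _; rewrite mulrA.
Qed.

Section Expectation.
Context {d : measure_display} {T : measurableType d} (P : probability T R).
Variable Z : T -> mxspace.
Hypothesis gZ : gaussian_mx P Z.

Lemma tame_expectation_sum (I : Type) (r : seq I) (Q : pred I) (F : I -> mx -> C) :
  (forall i, Q i -> tame (F i)) ->
  cexpectation P (fun t => \sum_(i <- r | Q i) F i (Z t)) =
  \sum_(i <- r | Q i) cexpectation P (F i \o Z).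
Proof.
by move=> tF; apply: cexpectation_sum => i Qi; exact: (cintegrable_tame gZ (tF i Qi)).
Qed.

(* Two computations of [E[sum_b z_ab Y_bj F]]: directly, [Z Y] being [1 - e R],
   and by [complex_ibp]. *)
Lemma wishart_equation F dF dbF (a j : 'I_n) : smooth F dF dbF ->
  cexpectation P (fun t => (((a == j)%:R - ec * Rz (Z t) a j) * F (Z t)
     - (p%:R - n%:R + ec * rtr ec (Z t)) * Rz (Z t) a j * F (Z t)
     - \sum_b Y (Z t) b j * dbF a b (Z t))) = 0.
Proof.
move=> sF; have [tF _ tdb _] := sF.
pose G b (M : mx) := Y M b j * F M.
pose dbG b (M : mx) := (1 - (Y M *m M) b b) * Rz M a j * F M + Y M b j * dbF a b M.
have key b : cexpectation P (fun t => Z t a b * G b (Z t)) = cexpectation P (dbG b \o Z).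
  have [-> _] := complex_ibp gZ a b (smoothM (smooth_reg_pinv b j) sF).
  by congr cexpectation; apply/funext => t; rewrite /dbG /= eqxx.
have tG b : tame (fun M : mx => M a b * G b M).
  by apply: tameM; [exact: tame_entry|apply: tameM => //; exact: tame_reg_pinv].
have tdbG b : tame (dbG b).
  have := smooth_db (smoothM (smooth_reg_pinv b j) sF) a b.
  by apply: eq_fun_prop => M; rewrite /dbG eqxx.
have : \sum_b cexpectation P (fun t => Z t a b * G b (Z t)) =
    \sum_b cexpectation P (dbG b \o Z) by apply: eq_bigr => b _; exact: key.
rewrite -(tame_expectation_sum _ (F := fun b M => M a b * G b M)) // -tame_expectation_sum //.
move/eqP; rewrite -subr_eq0 -cexpectationB; last 2 first.
- by apply: cintegrable_sum => b _; exact: (cintegrable_tame gZ (tG b)).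
- by apply: cintegrable_sum => b _; exact: (cintegrable_tame gZ (tdbG b)).
move=> /eqP h; rewrite -[RHS]h; congr cexpectation; apply/funext => t; move: (Z t) => M.
rewrite /G /dbG big_split /= opprD addrA; congr (_ - _); congr (_ - _).
  under [RHS]eq_bigr do rewrite mulrA.
  rewrite -mulr_suml; congr (_ * _); have := congr1 (fun X : 'M[C]_n => X a j) (gram_resolvent (uA M)).
  by rewrite mxE => ->; rewrite !mxE.
rewrite -!mulr_suml; congr (_ * _ * _).
rewrite sumrB sumr_const card_ord -[X in _ = _ - X]/(\tr (Y M *m M)).
by rewrite mxtrace_mulC gram_resolvent // linearB linearZ /= mxtrace1 opprB addrA [RHS]addrAC.
Qed.

(** The expectation of [conj z_ac * z_ab * F] is computed by integrating by parts in either of the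
    first two factors; both produce the same [delta_bc] term, and the rest is the equation. It is
    the invariance of the law under [Z -> Z U] to first order. *)
Lemma rotation_equation F dF dbF (b c : 'I_p) : smooth F dF dbF ->
  cexpectation P (fun t => \sum_a (Z t a b * dF a c (Z t) - (Z t a c)^* * dbF a b (Z t))) = 0.
Proof.
move=> sF; have [tF td tdb _] := sF.
have tz a : tame (fun M : mx => M a b * dF a c M).
  by apply: tameM => //; exact: tame_entry.
have tzb a : tame (fun M : mx => (M a c)^* * dbF a b M).
  by apply: tameM => //; apply: tameJ; exact: tame_entry.
have tF' (x : C) : tame (fun M : mx => x * F M) by apply: tameM => //; exact: tame_cst.
have tB a : tame (fun M : mx => M a b * dF a c M - (M a c)^* * dbF a b M).
  exact: tameB.
rewrite (tame_expectation_sum _ (F := fun a M => M a b * dF a c M - (M a c)^* * dbF a b M)) //.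
rewrite big1 // => a _.
rewrite (cexpectationB (cintegrable_tame gZ (tz a)) (cintegrable_tame gZ (tzb a))).
have [_ h1] := complex_ibp gZ a c (smoothM (smooth_entry a b) sF).
have [h2 _] := complex_ibp gZ a b (smoothM (smoothJ (smooth_entry a c)) sF).
have e1 : cexpectation P (fun t => (Z t a c)^* * (Z t a b * F (Z t))) =
    cexpectation P (fun t => ((a, c) == (a, b))%:R * F (Z t)) +
    cexpectation P (fun t => Z t a b * dF a c (Z t)).
  by rewrite h1 -cexpectationD //; [exact: (cintegrable_tame gZ (tF' _))|exact: (cintegrable_tame gZ (tz a))].
have e2 : cexpectation P (fun t => Z t a b * ((Z t a c)^* * F (Z t))) =
    cexpectation P (fun t => ((a, c) == (a, b))%:R * F (Z t)) +
    cexpectation P (fun t => (Z t a c)^* * dbF a b (Z t)).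
  rewrite h2 -cexpectationD //; [|exact: (cintegrable_tame gZ (tF' _))|exact: (cintegrable_tame gZ (tzb a))].
  by congr cexpectation; apply/funext => t; rewrite /= conjC_nat eq_sym.
have : cexpectation P (fun t => (Z t a c)^* * (Z t a b * F (Z t))) =
       cexpectation P (fun t => Z t a b * ((Z t a c)^* * F (Z t))).
  by congr cexpectation; apply/funext => t; rewrite mulrCA.
rewrite e1 e2 => /addrI h; apply/eqP; rewrite subr_eq0; apply/eqP.
exact: h.
Qed.

End Expectation.
End SchwingerDyson.

(** Read with [a = n], [b = q], [c = e], [x = tau], [y = tau^m], [z = tau^(m-1)]: it isolates the
    terms in [e], all nonnegative. Keeping [z] independent of [y] includes [m = 0], where [m.-1]
    truncates. *)
Lemma moment_identity (A : comPzRingType) (a b c m x y z r2 r3 : A) :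
  a * y - x * y - ((a - c * x) * y - (b + c * x) * (x * y) + m * z * (r2 - c * r3)) =
  c * (x * y) + c * (x * (x * y)) + m * z * (c * r3) + ((b - 1) * (x * y) - m * z * r2).
Proof. ring. Qed.

(** * Uniform moment bounds for the resolvent trace *)

Section MomentBound.
Context {R : realType} {n q : nat}.
Local Notation p := (n + q)%N.
Local Notation C := R[i].
Local Notation mx := 'M[C]_(n, p).
Local Notation mxspace := (g_sigma_algebraType (@boxes R n p)).
Context {d : measure_display} {T : measurableType d} (P : probability T R).
Variable Z : T -> mxspace.
Hypothesis gZ : gaussian_mx P Z.

Section Fixed.
Variable e : R.
Hypothesis e0 : 0 < e.
Local Notation ec := (e%:C%C : C).
Let ec0 : 0 < ec. Proof. by rewrite ltcR. Qed.
Let ec_ge0 : 0 <= ec. Proof. exact: ltW. Qed.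
Let uA (M : mx) : shifted_gram ec M \in unitmx. Proof. exact: shifted_gram_unit. Qed.
Local Notation Rz := (resolvent ec).
Local Notation Y := (reg_pinv ec).
Local Notation tau := (rtr ec).

Lemma smooth_rtr : smooth (fun M : mx => tau M)
  (fun a b M => \sum_l - (Rz M l a * Y M b l))
  (fun a b M => \sum_l - ((Y M b l)^* * Rz M a l)).
Proof. by apply: smooth_sum => l; exact: smooth_resolvent. Qed.

Lemma tame_rtr_pow m : tame (fun M : mx => tau M ^+ m).
Proof.
elim: m => [|m IH]; first exact: tame_cst.
by apply: eq_fun_prop (tameM (smooth_tame smooth_rtr) IH) => M; rewrite exprS.
Qed.

Lemma smooth_rtr_pow m : smooth (fun M : mx => tau M ^+ m)
  (fun a b M => m%:R * tau M ^+ m.-1 * \sum_l - (Rz M l a * Y M b l))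
  (fun a b M => m%:R * tau M ^+ m.-1 * \sum_l - ((Y M b l)^* * Rz M a l)).
Proof.
have h (i : 'I_m) : #|[pred j : 'I_m | true && (j != i)]| = m.-1.
  by have := cardC1 i; rewrite card_ord => <-; apply: eq_card => j; rewrite !inE.
have := @smooth_prod R n p 'I_m xpredT (fun _ M => tau M) _ _ (fun _ => smooth_rtr).
move=> sp; apply: (smooth_eq sp) => [M|a b M|a b M].
- by rewrite prodr_const card_ord.
- under eq_bigr => i _ do rewrite prodr_const h.
  rewrite sumr_const card_ord -[LHS]mulr_natl -[RHS]mulrA.
  by congr (_ * _); rewrite mulrC.
- under eq_bigr => i _ do rewrite prodr_const h.
  rewrite sumr_const card_ord -[LHS]mulr_natl -[RHS]mulrA.
  by congr (_ * _); rewrite mulrC.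
Qed.

(** The left side is the trace of [Y^* Y R], and [Y^* Y = R - e R^2]. *)
Lemma tr_gram_resolvent (M : mx) : \sum_j \sum_b Y M b j * \sum_l (Y M b l)^* * Rz M j l =
  \tr (Rz M *m Rz M) - ec * \tr (Rz M *m Rz M *m Rz M).
Proof.
have -> : \tr (Rz M *m Rz M) - ec * \tr (Rz M *m Rz M *m Rz M) =
    \tr ((Y M)^t* *m Y M *m Rz M).
  have -> : (Y M)^t* *m Y M = Rz M - ec *: (Rz M *m Rz M).
    by rewrite [X in _ = X - _](resolventE ec_ge0 (uA M)) addrK.
  by rewrite mulmxBl -scalemxAl raddfB /= mxtraceZ.
rewrite /mxtrace; under [RHS]eq_bigr do rewrite mxE.
rewrite [RHS]exchange_big /=; apply: eq_bigr => j _.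
under [RHS]eq_bigr do rewrite mxE mulr_suml.
rewrite [RHS]exchange_big /=; apply: eq_bigr => b _; rewrite mulr_sumr.
by apply: eq_bigr => l _; rewrite adjmxE mulrCA mulrA.
Qed.

(* Sum over [a = j] of [wishart_equation] with [F = tau^m]; the terms in [e] have
   a favourable sign, and [m tau^(m-1) tr R^2 <= m tau^(m+1)] leaves the coefficient
   [q - m >= 1] in front of [E tau^(m+1)]. *)
Lemma rtr_moment_step m : (m < q)%N ->
  complex.Re (cexpectation P (fun t => tau (Z t) ^+ m.+1)) <=
  complex.Re (cexpectation P (fun t => n%:R * tau (Z t) ^+ m)).
Proof.
move=> mq.
pose h j (M : mx) := ((j == j)%:R - ec * Rz M j j) * tau M ^+ m
   - (p%:R - n%:R + ec * tau M) * Rz M j j * tau M ^+ m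
   - \sum_b Y M b j * (m%:R * tau M ^+ m.-1 * \sum_l - ((Y M b l)^* * Rz M j l)).
have tR j : tame (fun M : mx => Rz M j j) by exact: tame_resolvent.
have tt : tame (fun M : mx => tau M) by exact: (smooth_tame smooth_rtr).
have tp := tame_rtr_pow m.
have th j : tame (h j).
  apply: tameB; first (apply: tameB; apply: tameM => //).
  - by apply: tameB; [exact: tame_cst|apply: tameM => //; exact: tame_cst].
  - apply: tameM => //; apply: tameD; first exact: tame_cst.
    by apply: tameM => //; exact: tame_cst.
  apply: tame_sum => b _; apply: tameM; first exact: tame_reg_pinv.
  exact: (smooth_db (smooth_rtr_pow m) j b).
have hE (M : mx) : \sum_j h j M = (n%:R - ec * tau M) * tau M ^+ m
    - (q%:R + ec * tau M) * tau M ^+ m.+1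
    + m%:R * tau M ^+ m.-1 * (\tr (Rz M *m Rz M) - ec * \tr (Rz M *m Rz M *m Rz M)).
  rewrite /h !sumrB -!mulr_suml; congr (_ * _ - _ + _).
  - rewrite sumrB -mulr_sumr; congr (_ - _).
    by under eq_bigr do rewrite eqxx; rewrite sumr_const card_ord.
  - by rewrite -mulr_sumr -/(tau M) exprS mulrA natrD (addrC n%:R) addrK.
  - have e1 j : \sum_b Y M b j * (m%:R * tau M ^+ m.-1 * \sum_l - ((Y M b l)^* * Rz M j l)) =
        - (m%:R * tau M ^+ m.-1 * \sum_b Y M b j * \sum_l (Y M b l)^* * Rz M j l).
      rewrite -mulrN -sumrN mulr_sumr; apply: eq_bigr => b _.
      by rewrite sumrN !mulrN mulrCA.
    under eq_bigr do rewrite e1.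
    by rewrite sumrN opprK -mulr_sumr tr_gram_resolvent.
have Eh : cexpectation P (fun t => \sum_j h j (Z t)) = 0.
  rewrite (tame_expectation_sum gZ _ (F := h)) // big1 // => j _.
  exact: (wishart_equation e0 gZ j j (smooth_rtr_pow m)).
have ih : cintegrable P (fun t => \sum_j h j (Z t)).
  by apply: cintegrable_sum => j _; exact: (cintegrable_tame gZ (th j)).
have i1 := cintegrable_tame gZ (tame_rtr_pow m.+1).
have i2 : cintegrable P (fun t => n%:R * tau (Z t) ^+ m).
  by apply: cintegrableZ; exact: (cintegrable_tame gZ (tame_rtr_pow m)).
rewrite -subr_ge0.
have -> : complex.Re (cexpectation P (fun t => n%:R * tau (Z t) ^+ m))
     - complex.Re (cexpectation P (fun t => tau (Z t) ^+ m.+1)) =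
   complex.Re (cexpectation P (fun t => n%:R * tau (Z t) ^+ m - tau (Z t) ^+ m.+1)).
  by rewrite cexpectationB //; case: (cexpectation _ _) (cexpectation _ _) => ? ? [].
(* Replacing 0 by the expectation of the sum of the [h j] reduces the claim to a pointwise
   inequality between traces. *)
have -> : 0 = complex.Re (cexpectation P (fun t => \sum_j h j (Z t))) by rewrite Eh.
apply: le_cexpectation => // [|t]; first exact: cintegrableB.
suff : \sum_j h j (Z t) <= n%:R * tau (Z t) ^+ m - tau (Z t) ^+ m.+1.
  by rewrite lecE => /andP[].
rewrite hE; move: (Z t) => M.
have t0 := rtr_ge0 ec_ge0 (uA M).
have := tr_resolvent2 ec_ge0 (uA M); have := tr_resolvent3 ec_ge0 (uA M).
set r3 := \tr (_ *m _ *m _); set r2 := \tr (_ *m _) => r30 r2le.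
rewrite -subr_ge0.
have -> : n%:R * tau M ^+ m - tau M ^+ m.+1 - ((n%:R - ec * tau M) * tau M ^+ m -
    (q%:R + ec * tau M) * tau M ^+ m.+1 + m%:R * tau M ^+ m.-1 * (r2 - ec * r3)) =
    ec * tau M ^+ m.+1 + ec * tau M ^+ m.+2 + m%:R * tau M ^+ m.-1 * (ec * r3) +
    ((q%:R - 1) * tau M ^+ m.+1 - m%:R * tau M ^+ m.-1 * r2).
  rewrite !exprS; exact: moment_identity.
have tX l : 0 <= tau M ^+ l by exact: exprn_ge0.
apply: addr_ge0.
  by apply: addr_ge0; [apply: addr_ge0|]; repeat (apply: mulr_ge0 => //).
rewrite subr_ge0; apply: (@le_trans _ _ (m%:R * tau M ^+ m.+1)).
  (* For [m = 0] the coefficient vanishes; otherwise [tau^(m-1) tau^2 = tau^(m+1)]. *)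
  case: (m) => [|m']; first by rewrite !mul0r.
  by rewrite -mulrA ler_wpM2l // [leRHS]exprS [leRHS]mulrC !exprSr -!mulrA ler_wpM2l ?exprn_ge0 // -expr2.
rewrite ler_wpM2r ?exprn_ge0 // lerBrDr natr1 ler_nat //.
Qed.

End Fixed.
End MomentBound.

(** * Removing the regularisation *)

Section ComplexLimits.
Context {R : realType}.
Local Notation C := R[i].
Local Notation Re := (@complex.Re R).
Local Notation Im := (@complex.Im R).
Implicit Types (u v : nat -> C) (l m : C).

Definition ccvg u l := ((fun N => Re (u N)) @ \oo --> Re l) /\ ((fun N => Im (u N)) @ \oo --> Im l).

Lemma ccvg_cst l : ccvg (fun=> l) l.
Proof. by split; exact: cvg_cst. Qed.

Lemma ccvg_parts u l (f g : nat -> R) : (forall N, Re (u N) = f N) -> (forall N, Im (u N) = g N) ->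
  f @ \oo --> Re l -> g @ \oo --> Im l -> ccvg u l.
Proof.
move=> uf ug fl gl; split; first by apply: cvg_trans fl; apply: near_eq_cvg; apply: nearW.
by apply: cvg_trans gl; apply: near_eq_cvg; apply: nearW.
Qed.

Lemma ccvgD u v l m : ccvg u l -> ccvg v m -> ccvg (fun N => u N + v N) (l + m).
Proof.
move=> [u1 u2] [v1 v2]; apply: (ccvg_parts (fun N => cReD _ _) (fun N => cImD _ _)).
  by rewrite cReD; exact: cvgD.
by rewrite cImD; exact: cvgD.
Qed.

Lemma ccvgM u v l m : ccvg u l -> ccvg v m -> ccvg (fun N => u N * v N) (l * m).
Proof.
move=> [u1 u2] [v1 v2]; apply: (ccvg_parts (fun N => cReM _ _) (fun N => cImM _ _)).
  by rewrite cReM; apply: cvgB; exact: cvgM.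
by rewrite cImM; apply: cvgD; exact: cvgM.
Qed.

Lemma ccvgJ u l : ccvg u l -> ccvg (fun N => (u N)^*) l^*.
Proof.
move=> [u1 u2]; apply: (ccvg_parts (fun N => cReJ _) (fun N => cImJ _)).
  by rewrite cReJ.
by rewrite cImJ; exact: cvgN.
Qed.

Lemma ccvg_sum (I : Type) (r : seq I) (Q : pred I) (u : I -> nat -> C) (l : I -> C) :
  (forall i, ccvg (u i) (l i)) ->
  ccvg (fun N => \sum_(i <- r | Q i) u i N) (\sum_(i <- r | Q i) l i).
Proof.
move=> ul; elim: r => [|i r IH].
  by rewrite big_nil; apply: (eq_fun_prop (K := fun f => ccvg f 0)) (ccvg_cst 0) => N; rewrite big_nil.
rewrite big_cons; case: (boolP (Q i)) => Qi.
  apply: (eq_fun_prop (K := fun f => ccvg f _)) (ccvgD (ul i) IH) => N.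
  by rewrite big_cons Qi.
apply: (eq_fun_prop (K := fun f => ccvg f _)) IH => N.
by rewrite big_cons (negbTE Qi).
Qed.

Definition eps (N : nat) : R := N.+1%:R^-1.

Lemma eps_gt0 N : 0 < eps N. Proof. by rewrite invr_gt0. Qed.

Lemma epsC_gt0 N : 0 < (eps N)%:C%C :> C. Proof. by rewrite ltcR eps_gt0. Qed.

Lemma Re_Im_le_norm (z : C) (c : R) : `|z| <= c%:C%C -> `|Re z| <= c /\ `|Im z| <= c.
Proof.
rewrite normc_def lecR => h; split; apply: le_trans h;
  by rewrite -sqrtr_sqr ler_wsqrtr // ?lerDl ?lerDr sqr_ge0.
Qed.

Lemma ccvg_bound u l (K : R) : (forall N, `|u N - l| <= (eps N)%:C%C * K%:C%C) -> ccvg u l.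
Proof.
move=> h.
have lim0 : eps N * K @[N --> \oo] --> (0 : R).
  suff : eps N * K @[N --> \oo] --> 0 * K by rewrite mul0r.
  by apply: cvgM; [exact: cvg_harmonic|exact: cvg_cst].
have part (f : nat -> R) (a : R) : (forall N, `|f N - a| <= eps N * K) -> f @ \oo --> a.
  move=> fa; apply/cvgrPdist_le => e e0.
  move/cvgrPdist_le : lim0 => /(_ e e0); apply: filterS => N.
  rewrite sub0r normrN => hN; rewrite distrC (le_trans (fa N)) //.
  exact: le_trans (ler_norm _) hN.
have h' N := @Re_Im_le_norm (u N - l) (eps N * K) (eq_ind _ (fun x => `|u N - l| <= x) (h N) _ (esym (rmorphM _ _ _))).
split; apply: part => N; have [h1 h2] := h' N.
  by move: h1; rewrite cReD; case: (l) => ? ?.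
by move: h2; rewrite cImD; case: (l) => ? ?.
Qed.

Lemma ccvg_unique u l m : ccvg u l -> ccvg u m -> l = m.
Proof.
by move=> [u1 u2] [u3 u4]; apply: complexP; [exact: (cvg_unique _ u1 u3)|exact: (cvg_unique _ u2 u4)].
Qed.

Lemma ge0_RRe (z : C) : 0 <= z -> z = (Re z)%:C%C.
Proof. by case: z => a b; rewrite lecE /= => /andP[/eqP -> _]. Qed.

End ComplexLimits.

Section ResolventLimits.
Context {R : realType} {n p : nat}.
Local Notation C := R[i].
Variable M : 'M[C]_(n, p).
Hypothesis uW : shifted_gram 0 M \in unitmx.

(** The error is [eps N] times entries that [le_rtr0] bounds by the trace at 0, uniformly in [N]. *)
Lemma ccvg_perturb m (U V : 'M[C]_(m, n)) (UN : nat -> 'M[C]_(m, n)) i j :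
  (forall N, U - UN N = (eps N)%:C%C *: (V *m resolvent (eps N)%:C%C M)) ->
  ccvg (fun N => UN N i j) (U i j).
Proof.
move=> UE.
pose K := \sum_l `|V i l| * rtr 0 M.
have K0 : 0 <= K by apply: sumr_ge0 => l _; rewrite mulr_ge0 // rtr_ge0.
apply: (@ccvg_bound _ _ _ (complex.Re K)) => N; rewrite -(ge0_RRe K0) distrC.
have := congr1 (fun X : 'M[C]_(m, n) => X i j) (UE N); rewrite !mxE => ->.
rewrite normrM ger0_norm ?ler_wpM2l ?(ltW (epsC_gt0 N)) //.
rewrite (le_trans (ler_norm_sum _ _ _)) // ler_sum // => l _.
have e0 : 0 < (eps N)%:C%C :> C := epsC_gt0 N; rewrite normrM; apply: ler_wpM2l => //.
apply: le_trans (resolvent_le_rtr (ltW e0) (shifted_gram_unit M e0) l j) _.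
exact: le_rtr0 e0 uW.
Qed.

Lemma ccvg_resolvent i j : ccvg (fun N => resolvent (eps N)%:C%C M i j) (resolvent 0 M i j).
Proof. by apply: (@ccvg_perturb _ _ (resolvent 0 M)) => N; exact: resolvent_diff (epsC_gt0 N) uW. Qed.

Lemma ccvg_reg_pinv i j : ccvg (fun N => reg_pinv (eps N)%:C%C M i j) (reg_pinv 0 M i j).
Proof. by apply: (@ccvg_perturb _ _ (reg_pinv 0 M)) => N; exact: reg_pinv_diff (epsC_gt0 N) uW. Qed.

Lemma ccvg_rtr : ccvg (fun N => rtr (eps N)%:C%C M) (rtr 0 M).
Proof. by apply: ccvg_sum => l; exact: ccvg_resolvent. Qed.

End ResolventLimits.

(** * Almost sure invertibility and inverse moments *)

Section InverseMoments.
Context {R : realType} {n q : nat}.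
Local Notation p := (n + q)%N.
Local Notation C := R[i].
Local Notation mxspace := (g_sigma_algebraType (@boxes R n p)).
Local Notation Re := (@complex.Re R).
Context {d : measure_display} {T : measurableType d} (P : probability T R).
Variable Z : T -> mxspace.
Hypothesis gZ : gaussian_mx P Z.
Local Notation tau N t := (rtr (eps N)%:C%C (Z t)).

Lemma rtr_moment_bound N m : (m <= q)%N ->
  Re (cexpectation P (fun t => tau N t ^+ m)) <= n%:R ^+ m.
Proof.
elim: m => [|m IH] mq.
  have -> : (fun t => tau N t ^+ 0) = (fun=> 1) by apply/funext => t; rewrite expr0.
  by rewrite cexpectation_cst.
apply: le_trans (rtr_moment_step gZ (eps_gt0 N) mq) _.
rewrite cexpectationZ; last exact: (cintegrable_tame gZ (tame_rtr_pow (eps_gt0 N) m)).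
have -> : n%:R = (n%:R)%:C%C :> C by rewrite rmorph_nat.
rewrite cReM /= mul0r subr0 exprS ler_wpM2l ?ler0n //; exact: IH (ltnW mq).
Qed.

Lemma Re_exp (z : C) m : 0 <= z -> Re (z ^+ m) = Re z ^+ m.
Proof. by move=> /ge0_RRe ->; rewrite -rmorphXn. Qed.

Lemma tau_ge0 N t : 0 <= tau N t.
Proof. exact: rtr_ge0 (ltW (epsC_gt0 N)) (shifted_gram_unit _ (epsC_gt0 N)). Qed.

Lemma Re_ge0 (z : C) : 0 <= z -> 0 <= Re z.
Proof. by rewrite lecE /= => /andP[]. Qed.

(* Where [Z Z^*] is singular the traces tend to [+oo], so Fatou's lemma also gives
   the almost sure invertibility. *)
Lemma inverse_moment k : (0 < k <= q)%N ->
  exists2 g : T -> \bar R, P.-integrable setT g &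
  {ae P, forall t, shifted_gram 0 (Z t) \in unitmx /\ ((Re (rtr 0 (Z t)) ^+ k)%:E <= g t)%E}.
Proof.
move=> /andP[k0 kq].
pose u N t := (Re (tau N t) ^+ k)%:E.
pose L t := limn_einf (u ^~ t).
have iu N : cintegrable P (fun t => tau N t ^+ k).
  exact: (cintegrable_tame gZ (tame_rtr_pow (eps_gt0 N) k)).
have iu' N : P.-integrable setT (u N).
  apply: (eq_fun_prop (K := fun f => P.-integrable setT f) _ (iu N).1) => t /=.
  by rewrite Re_exp // tau_ge0.
have u0 N t : (0 <= u N t)%E by rewrite lee_fin exprn_ge0 // Re_ge0 // tau_ge0.
have mu N : measurable_fun setT (u N) := measurable_int P (iu' N).
have mL : measurable_fun setT L.
  (* [limn_einf] is the opposite of the [limn_esup] of the opposites. *)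
  apply: (measurableT_comp (@oppe_measurable _ setT)).
  apply: (@measurable_fun_limn_esup _ _ _ setT (fun N t => (- u N t)%E)) => N.
  exact: measurableT_comp (@oppe_measurable _ setT) (mu N).
have L0 t : (0 <= L t)%E.
  rewrite /L limn_einf_lim; apply: lime_ge; first exact: is_cvg_einfs.
  by apply: nearW => N; apply: le_ereal_inf_tmp => _ [m _ <-]; exact: u0.
have iL : P.-integrable setT L.
  apply/integrableP; split=> //.
  under eq_integral do rewrite gee0_abs //.
  apply: le_lt_trans (fatou P measurableT mu (fun N t _ => u0 N t)) _.
  apply: (@le_lt_trans _ _ ((n%:R : R) ^+ k)%:E); last exact: ltry.
  rewrite limn_einf_lim; apply: lime_le; first exact: is_cvg_einfs.
  apply: nearW => N; apply: (@le_trans _ _ (\int[P]_t (u N t))%E).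
    by apply: ereal_inf_lbound; exists N => /=.
  rewrite -[leLHS]fineK; last exact: integrable_fin_num.
  rewrite lee_fin; apply: le_trans (rtr_moment_bound N kq).
  rewrite Re_cexpectation /Rintegral le_eqVlt; apply/orP; left; apply/eqP; congr fine.
  by apply: eq_integral => t _; rewrite Re_exp // tau_ge0.
exists L => //; apply: filterS (integrable_ae measurableT iL) => t /(_ Logic.I) Lt.
(* Where [L] is finite the Gram matrix is invertible: otherwise [c <= e * rtr] makes the [k]-th
   powers at least [((N+1) c)^k], which tend to infinity because [0 < k]. *)
have uW : shifted_gram 0 (Z t) \in unitmx.
  case: (boolP (shifted_gram 0 (Z t) \in unitmx)) => // /singular_gram_rtr[c c0 hc].
  suff Ly : L t = +oo%E by move: Lt; rewrite Ly.
  have : u ^~ t @ \oo --> +oo%E.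
    apply/cvgeyPge => A.
    have [N0 hN0] : exists N0 : nat, `|A| / Re c ^+ k <= N0%:R.
      by eexists; apply: ltW; exact: truncnS_gt.
    have rc : 0 < Re c by move: c0; rewrite ltcE /= => /andP[].
    exists N0 => // N /= N0N; rewrite lee_fin.
    have h : N.+1%:R * Re c <= Re (tau N t).
      have := hc _ (epsC_gt0 N); rewrite (ge0_RRe (ltW c0)) (ge0_RRe (tau_ge0 N t)) -rmorphM lecR.
      by rewrite /eps ler_pdivlMl.
    apply: le_trans (ler_norm A) _.
    apply: (@le_trans _ _ ((N.+1%:R * Re c) ^+ k)); last first.
      by rewrite lerXn2r ?nnegrE // ?mulr_ge0 ?(ltW rc) //; apply: Re_ge0; exact: tau_ge0.
    rewrite exprMn -ler_pdivrMr ?exprn_gt0 // (le_trans hN0) //.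
    apply: (@le_trans _ _ (N.+1%:R)); first by rewrite ler_nat ltnW.
    by rewrite ler_eXnr // ler1n.
  by move/cvg_limn_einf_sup => [].
split=> //.
have : u ^~ t @ \oo --> (Re (rtr 0 (Z t)) ^+ k)%:E.
  apply/cvg_EFin; first by apply: nearW.
  have [h _] := ccvg_rtr uW.
  by apply: (@continuous_cvg _ _ _ _ _ _ (fun x : R => x ^+ k)) h; exact: exprn_continuous.
by move/cvg_limn_einf_sup => [h _]; rewrite /L h.
Qed.

End InverseMoments.

(** * Passage to the limit by degree counting *)

Section DominatedLimits.
Context {R : realType} {n q k : nat}.
Local Notation p := (n + q)%N.
Local Notation C := R[i].
Local Notation mxspace := (g_sigma_algebraType (@boxes R n p)).
Local Notation Re := (@complex.Re R).
Local Notation Im := (@complex.Im R).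
Context {d : measure_display} {T : measurableType d} (P : probability T R).
Variable Z : T -> mxspace.
Hypothesis gZ : gaussian_mx P Z.
Hypothesis kq : (0 < k <= q)%N.
Local Notation tau0 t := (rtr 0 (Z t)).
Local Notation inv_gram t := (shifted_gram 0 (Z t) \in unitmx).

Lemma dominated_climit (h : nat -> T -> C) (l : T -> C) (c : R) : 0 <= c ->
  (forall N, cmeasurable (h N)) -> cmeasurable l ->
  (forall t, inv_gram t -> ccvg (h ^~ t) (l t)) ->
  (forall N t, inv_gram t -> `|h N t| <= (c * (1 + Re (tau0 t) ^+ k))%:C%C) ->
  cintegrable P l /\ ccvg (fun N => cexpectation P (h N)) (cexpectation P l).
Proof.
move=> c0 mh ml hl hc.
have [g ig gP] := inverse_moment gZ kq.
have iG : P.-integrable setT (fun t => c%:E * (1 + g t))%E.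
  by apply: integrableZl => //; apply: integrableD => //; exact: finite_measure_integrable_cst.
have part (f : C -> R) : (forall z c, `|z| <= c%:C%C -> `|f z| <= c) ->
    (forall N, measurable_fun setT (f \o h N)) -> measurable_fun setT (f \o l) ->
    (forall t, inv_gram t -> (fun N => f (h N t)) @ \oo --> f (l t)) ->
    P.-integrable setT (EFin \o (f \o l)) /\
    (fun N => \int[P]_t f (h N t)) @ \oo --> \int[P]_t f (l t).
  move=> fb mfh mfl fl.
  have [] := @dominated_convergence _ T R P setT measurableT
    (fun N t => (f (h N t))%:E) (fun t => (f (l t))%:E) (fun t => c%:E * (1 + g t))%E.
  - by move=> N; apply/measurable_EFinP; exact: mfh.
  - by apply/measurable_EFinP; exact: mfl.
  - by apply: filterS gP => t [uW _] _; apply: cvg_EFin; [exact: nearW|exact: fl].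
  - exact: iG.
  - apply: filterS gP => t [uW gt] N _ /=.
    apply: (@le_trans _ _ (c * (1 + Re (tau0 t) ^+ k))%:E).
      by rewrite lee_fin; apply: fb; exact: hc.
    rewrite EFinM lee_wpmul2l //.
    by rewrite EFinD leeD.
  move=> il _ lim; split=> //.
  apply: fine_cvg; rewrite fineK; last exact: integrable_fin_num.
  exact: lim.
have [i1 l1] := part Re (fun z c h => (Re_Im_le_norm h).1) (fun N => (mh N).1) ml.1 (fun t u => (hl t u).1).
have [i2 l2] := part Im (fun z c h => (Re_Im_le_norm h).2) (fun N => (mh N).2) ml.2 (fun t u => (hl t u).2).
split; first by split.
by apply: (ccvg_parts (fun N => Re_cexpectation _ _) (fun N => Im_cexpectation _ _));
  rewrite ?Re_cexpectation ?Im_cexpectation.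
Qed.

(** The unit of degree: entries of [Y] have degree 1 and entries of the inverse Gram matrix degree
    2. The summand 1 makes the weight at least 1, so that degrees can be raised freely. *)
Definition rtr_weight t : C := 1 + sqrtC (tau0 t).
Local Notation s := rtr_weight.

Lemma sqrt_rtr_ge0 t : inv_gram t -> 0 <= sqrtC (tau0 t).
Proof. by move=> u; rewrite sqrtC_ge0; exact: rtr_ge0 (lexx 0) u. Qed.

Lemma rtr_weight_ge1 t : inv_gram t -> 1 <= s t.
Proof. by move=> u; rewrite lerDl sqrt_rtr_ge0. Qed.

(* [h N] is the quantity regularised at [eps N] and [l] its limit.  Degrees add up
   under products, so integrability of the limit becomes a degree count. *)
Record admissible r (h : nat -> T -> C) (l : T -> C) : Prop := Admissible {
  adm_measurable : forall N, cmeasurable (h N);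
  adm_measurable_lim : cmeasurable l;
  adm_cvg : forall t, inv_gram t -> ccvg (h ^~ t) (l t);
  adm_bound : exists2 c : R, 0 <= c & forall N t, inv_gram t -> `|h N t| <= c%:C%C * s t ^+ r }.

Lemma admissible_limit r h l : (r <= 2 * k)%N -> admissible r h l ->
  cintegrable P l /\ ccvg (fun N => cexpectation P (h N)) (cexpectation P l).
Proof.
move=> rk [mh ml hl [c c0 hc]].
apply: (@dominated_climit h l (c * 2 ^+ (2 * k))) => // [|N t u].
  by rewrite mulr_ge0 ?exprn_ge0.
apply: le_trans (hc N t u) _; have s0 := sqrt_rtr_ge0 u; have w1 := rtr_weight_ge1 u.
have -> : (c * 2 ^+ (2 * k) * (1 + Re (tau0 t) ^+ k))%:C%C =
    c%:C%C * (2 ^+ (2 * k) * (1 + sqrtC (tau0 t) ^+ (2 * k))).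
  rewrite -mulrA rmorphM rmorphM rmorphD rmorph1 !rmorphXn /= -ge0_RRe ?(rtr_ge0 (lexx 0) u) //.
  by rewrite rmorph_nat [X in _ = _ * (_ * (_ + X))]exprM sqrtCK.
rewrite ler_wpM2l ?lecR //.
apply: (@le_trans _ _ (s t ^+ (2 * k))); first exact: ler_weXn2l.
(* Either [s <= 2] or [s <= 2 sqrt tau], according to the position of [sqrt tau] with respect to
   1. *)
have [s1|s1] := real_leP (ger0_real s0) (@real1 C).
  apply: (@le_trans _ _ (2 ^+ (2 * k))).
    by rewrite lerXn2r ?nnegrE ?(le_trans ler01 w1) // /rtr_weight -[2]/(1 + 1) lerD2l.
  by rewrite ler_peMr ?exprn_ge0 // lerDl exprn_ge0.
apply: (@le_trans _ _ ((2 * sqrtC (tau0 t)) ^+ (2 * k))).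
  rewrite lerXn2r ?nnegrE ?mulr_ge0 ?(le_trans ler01 w1) // /rtr_weight mulr_natl mulr2n lerD2r.
  exact: ltW.
by rewrite exprMn ler_wpM2l ?exprn_ge0 // lerDr.
Qed.

Lemma admissible_weaken r r' h l : (r <= r')%N -> admissible r h l -> admissible r' h l.
Proof.
move=> rr' [m1 m2 m3 [c c0 hc]]; split=> //; exists c => // N t u.
apply: le_trans (hc N t u) _; rewrite ler_wpM2l ?lecR //.
by apply: ler_weXn2l => //; exact: rtr_weight_ge1.
Qed.

Lemma admissible_cst z : admissible 0 (fun _ _ => z) (fun=> z).
Proof.
split=> [N||t _|]; try exact: cmeasurable_cst; first exact: ccvg_cst.
exists (Re `|z|) => [|N t _]; first by apply: Re_ge0.
by rewrite expr0 mulr1 -ge0_RRe.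
Qed.

Lemma admissibleD r h l h' l' : admissible r h l -> admissible r h' l' ->
  admissible r (fun N t => h N t + h' N t) (fun t => l t + l' t).
Proof.
move=> [m1 m2 m3 [c c0 hc]] [m1' m2' m3' [c' c0' hc']].
split=> [N||t u|]; try exact: cmeasurableD; first by apply: ccvgD; [exact: m3|exact: m3'].
exists (c + c') => [|N t u]; first exact: addr_ge0.
by rewrite rmorphD mulrDl (le_trans (ler_normD _ _)) // lerD // ?hc ?hc'.
Qed.

Lemma admissibleM r r' h l h' l' : admissible r h l -> admissible r' h' l' ->
  admissible (r + r') (fun N t => h N t * h' N t) (fun t => l t * l' t).
Proof.
move=> [m1 m2 m3 [c c0 hc]] [m1' m2' m3' [c' c0' hc']].
split=> [N||t u|]; try exact: cmeasurableM; first by apply: ccvgM; [exact: m3|exact: m3'].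
exists (c * c') => [|N t u]; first exact: mulr_ge0.
by rewrite rmorphM exprD mulrACA normrM ler_pM // ?hc ?hc'.
Qed.

Lemma admissibleJ r h l : admissible r h l -> admissible r (fun N t => (h N t)^*) (fun t => (l t)^*).
Proof.
move=> [m1 m2 m3 [c c0 hc]].
split=> [N||t u|]; try exact: cmeasurableJ; first by apply: ccvgJ; exact: m3.
by exists c => // N t u; rewrite norm_conjC hc.
Qed.

Lemma admissible_eq r h l h' l' : (forall N t, h N t = h' N t) -> (forall t, l t = l' t) ->
  admissible r h l -> admissible r h' l'.
Proof.
move=> hh ll; suff [-> ->] : h' = h /\ l' = l by [].
by split; apply/funext => x; [apply/funext => t|]; rewrite (hh, ll).
Qed.

Lemma admissibleZ z r h l : admissible r h l -> admissible r (fun N t => z * h N t) (fun t => z * l t).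
Proof. exact: (admissibleM (admissible_cst z)). Qed.

Lemma admissibleB r h l h' l' : admissible r h l -> admissible r h' l' ->
  admissible r (fun N t => h N t - h' N t) (fun t => l t - l' t).
Proof.
move=> a1 /(admissibleZ (-1)) /(admissibleD a1).
by apply: admissible_eq => [N t|t]; rewrite mulN1r.
Qed.

Lemma admissible0 r : admissible r (fun _ _ => 0) (fun=> 0).
Proof.
split=> [N||t _|]; try exact: cmeasurable_cst; first exact: ccvg_cst.
by exists 0 => // N t _; rewrite normr0 mul0r.
Qed.

Lemma admissible_sum (I : Type) (e : seq I) (Q : pred I) r (h : I -> nat -> T -> C) (l : I -> T -> C) :
  (forall i, Q i -> admissible r (h i) (l i)) ->
  admissible r (fun N t => \sum_(i <- e | Q i) h i N t) (fun t => \sum_(i <- e | Q i) l i t).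
Proof.
move=> a; elim: e => [|i e IH].
  by apply: admissible_eq (admissible0 r) => [N t|t]; rewrite big_nil.
case Qi: (Q i).
  by apply: admissible_eq (admissibleD (a i Qi) IH) => [N t|t]; rewrite big_cons Qi.
by apply: admissible_eq IH => [N t|t]; rewrite big_cons Qi.
Qed.

Lemma admissible_prod (I : Type) (e : seq I) (Q : pred I) r (h : I -> nat -> T -> C) (l : I -> T -> C) :
  (forall i, admissible r (h i) (l i)) ->
  admissible (\sum_(i <- e | Q i) r) (fun N t => \prod_(i <- e | Q i) h i N t)
    (fun t => \prod_(i <- e | Q i) l i t).
Proof.
move=> a; elim: e => [|i e IH].
  by rewrite big_nil; apply: admissible_eq (admissible_cst 1) => [N t|t]; rewrite big_nil.
rewrite big_cons; case Qi: (Q i).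
  by apply: admissible_eq (admissibleM (a i) IH) => [N t|t]; rewrite big_cons Qi.
by apply: admissible_eq IH => [N t|t]; rewrite big_cons Qi.
Qed.

Lemma cmeasurable_tame F : tame F -> cmeasurable (F \o Z).
Proof.
by move=> /(cintegrable_tame gZ)[/measurable_int/measurable_EFinP m1 /measurable_int/measurable_EFinP m2].
Qed.

Let uE N t : shifted_gram (eps N)%:C%C (Z t) \in unitmx.
Proof. exact: shifted_gram_unit (epsC_gt0 N). Qed.
Let e0 N : 0 <= (eps N)%:C%C :> C. Proof. exact: ltW (epsC_gt0 N). Qed.

Lemma ccvg_eps : ccvg (fun N => (eps N)%:C%C) (0 : C).
Proof. by split; [exact: cvg_harmonic|exact: cvg_cst]. Qed.

(** Degree 0, not 2: [e * rtr <= n] bounds this vanishing term by a constant, so the factors [e] of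
    the recursion cost no moments. *)
Lemma admissible_e_resolvent i j :
  admissible 0 (fun N t => (eps N)%:C%C * resolvent (eps N)%:C%C (Z t) i j) (fun=> 0).
Proof.
split=> [N||t u|].
- by apply: cmeasurableM; [exact: cmeasurable_cst|exact: cmeasurable_tame (tame_resolvent (eps_gt0 N) i j)].
- exact: cmeasurable_cst.
- by have := ccvgM ccvg_eps (ccvg_resolvent u i j); rewrite mul0r.
- exists n%:R => [|N t u]; first exact: ler0n.
  rewrite expr0 mulr1 normrM (ger0_norm (e0 N)) rmorph_nat.
  by apply: le_trans (e_rtr_le (e0 N) (uE N t)); rewrite ler_wpM2l // resolvent_le_rtr.
Qed.

Lemma admissible_e_rtr :
  admissible 0 (fun N t => (eps N)%:C%C * rtr (eps N)%:C%C (Z t)) (fun=> 0).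
Proof.
have := @admissible_sum _ (index_enum 'I_n) xpredT 0 _ _ (fun i _ => admissible_e_resolvent i i).
apply: admissible_eq => [N t|t]; first by rewrite -mulr_sumr.
by rewrite big1.
Qed.

(** The pseudo-inverse of the theorem times the square root of Sigma will be substituted here; its
    formula is known only where the Gram matrix is invertible. *)
Variable Ym : T -> 'M[C]_(p, n).
Hypothesis mYm : forall i j, cmeasurable (fun t => Ym t i j).
Hypothesis YmE : forall t, inv_gram t -> Ym t = reg_pinv 0 (Z t).

Lemma admissible_reg_pinv i j :
  admissible 1 (fun N t => reg_pinv (eps N)%:C%C (Z t) i j) (fun t => Ym t i j).
Proof.
split=> [N||t u|] //.
- exact: cmeasurable_tame (tame_reg_pinv (eps_gt0 N) i j).
- by rewrite YmE //; exact: ccvg_reg_pinv.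
- exists 1 => // N t u; rewrite rmorph1 mul1r expr1.
  apply: (@le_trans _ _ (sqrtC (tau0 t))); last by rewrite lerDr.
  rewrite -(@ler_pXn2r _ 2) ?nnegrE ?sqrt_rtr_ge0 // sqrtCK.
  by apply: le_trans (reg_pinv_le_rtr (e0 N) (uE N t) i j) _; exact: le_rtr0 (epsC_gt0 N) u.
Qed.

(** The limit is written [Y^* Y] and not [resolvent 0]: this is what contracting monomials produces,
    and its measurability is inherited from [Ym]. *)
Lemma admissible_resolvent i j :
  admissible 2 (fun N t => resolvent (eps N)%:C%C (Z t) i j) (fun t => ((Ym t)^t* *m Ym t) i j).
Proof.
split=> [N||t u|].
- exact: cmeasurable_tame (tame_resolvent (eps_gt0 N) i j).
- apply: (eq_fun_prop (K := cmeasurable)) (_ : cmeasurable (fun t => \sum_l (Ym t l i)^* * Ym t l j)) => [t|].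
    by rewrite mxE; apply: eq_bigr => l _; rewrite adjmxE.
  by apply: cmeasurable_sum => l _; apply: cmeasurableM => //; exact: cmeasurableJ.
- rewrite YmE //; have := resolventE (lexx 0) u; rewrite scale0r addr0 => <-.
  exact: ccvg_resolvent.
- exists 1 => // N t u; rewrite rmorph1 mul1r.
  apply: (@le_trans _ _ (sqrtC (tau0 t) ^+ 2)); last first.
    by rewrite lerXn2r ?nnegrE ?sqrt_rtr_ge0 ?(le_trans ler01 (rtr_weight_ge1 u)) // lerDr.
  rewrite sqrtCK.
  by apply: le_trans (resolvent_le_rtr (e0 N) (uE N t) i j) _; exact: le_rtr0 (epsC_gt0 N) u.
Qed.

End DominatedLimits.

(** * Infinitesimal rotations acting on monomials *)

Section Monomials.
Context {R : realType} {n p : nat}.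
Local Notation C := R[i].
Local Notation mx := 'M[C]_(n, p).

Definition monomial k (Y : 'M[C]_(p, n)) (i i' : {ffun 'I_k -> 'I_p}) (j j' : {ffun 'I_k -> 'I_n}) : C :=
  (\prod_s Y (i s) (j s)) * \prod_s (Y (i' s) (j' s))^*.

(** Derivation along the complexified Lie algebra of the rotations [M -> M U]: the matrix unit
    [E_bc] moves [M] by [M E_bc] and its entrywise conjugate by minus itself times [E_cb]. *)
Definition rotated (b c : 'I_p) (dF dbF : 'I_n -> 'I_p -> mx -> C) (M : mx) :=
  \sum_a (M a b * dF a c M - (M a c)^* * dbF a b M).

Lemma rotated_prod b c (I : finType) (Q : pred I) (F : I -> mx -> C) dF dbF M :
  rotated b c (fun a b M => \sum_(i | Q i) dF i a b M * \prod_(j | Q j && (j != i)) F j M)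
    (fun a b M => \sum_(i | Q i) dbF i a b M * \prod_(j | Q j && (j != i)) F j M) M =
  \sum_(i | Q i) rotated b c (dF i) (dbF i) M * \prod_(j | Q j && (j != i)) F j M.
Proof.
rewrite /rotated; under [RHS]eq_bigr do rewrite mulr_suml.
rewrite [RHS]exchange_big /=; apply: eq_bigr => a _.
by rewrite !mulr_sumr -sumrB; apply: eq_bigr => i _; rewrite mulrBl !mulrA.
Qed.

Lemma rotatedM b c F dF dbF G dG dbG M :
  rotated b c (fun a b M => dF a b M * G M + F M * dG a b M)
    (fun a b M => dbF a b M * G M + F M * dbG a b M) M =
  rotated b c dF dbF M * G M + F M * rotated b c dG dbG M.
Proof.
rewrite /rotated mulr_suml mulr_sumr -big_split; apply: eq_bigr => a _ /=.
move: (M a b) (M a c)^* (F M) (G M) (dF a c M) (dG a c M) (dbF a b M) (dbG a b M).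
by move=> *; ring.
Qed.

Lemma rotatedJ b c dF dbF M :
  rotated b c (fun a b M => (dbF a b M)^*) (fun a b M => (dF a b M)^*) M = - (rotated c b dF dbF M)^*.
Proof.
rewrite /rotated rmorph_sum -sumrN; apply: eq_bigr => a _.
by rewrite rmorphB !rmorphM /= conjCK opprB.
Qed.

Variable e : R.
Hypothesis e0 : 0 < e.
Local Notation ec := (e%:C%C : C).
Let ec0 : 0 < ec. Proof. by rewrite ltcR. Qed.
Local Notation Rz := (resolvent ec).
Local Notation Y := (reg_pinv ec).

(** The contributions containing [Y M] cancel, so [Y], although regularised, transforms linearly in
    its row index alone. *)
Lemma rotated_reg_pinv b c i j M :
  rotated b c (fun a b M => - (Y M i a * Y M b j))
    (fun a b M => ((i == b)%:R - (Y M *m M) i b) * Rz M a j) M = - (i == b)%:R * Y M c j.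
Proof.
rewrite /rotated sumrB.
have -> : \sum_a M a b * - (Y M i a * Y M c j) = - (Y M *m M) i b * Y M c j.
  rewrite [(Y M *m M) i b]mxE mulNr mulr_suml -sumrN; apply: eq_bigr => a _.
  by rewrite mulrN mulrA (mulrC (M a b)).
have -> : \sum_a (M a c)^* * (((i == b)%:R - (Y M *m M) i b) * Rz M a j) =
    ((i == b)%:R - (Y M *m M) i b) * Y M c j.
  rewrite [Y M c j]mxE mulr_sumr; apply: eq_bigr => a _.
  by rewrite adjmxE mulrCA.
by rewrite -mulrBl opprB addrA addNr add0r.
Qed.

Context {d : measure_display} {T : measurableType d} (P : probability T R).
Variable Z : T -> g_sigma_algebraType (@boxes R n p).
Hypothesis gZ : gaussian_mx P Z.

Lemma rotated_expectation F dF dbF (b c : 'I_p) : smooth F dF dbF ->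
  cexpectation P (fun t => rotated b c dF dbF (Z t)) = 0.
Proof. exact: rotation_equation. Qed.

(** Apply the derivation to the monomial and take expectations. Each plain factor gives
    [- (i s == b)] with its index changed to [c]; each conjugated one gives [+ (i' s == c)] with its
    index changed to [b], since [rotatedJ] flips the sign and swaps [b] and [c]. *)
Lemma reg_pinv_invariant k (j j' : {ffun 'I_k -> 'I_n}) :
  gl_invariant (fun i i' => cexpectation P (fun t => monomial (Y (Z t)) i i' j j')).
Proof.
move=> i i' b c.
have s1 s := smooth_reg_pinv e0 (i s) (j s).
have s2 s := smoothJ (smooth_reg_pinv e0 (i' s) (j' s)).
have := rotated_expectation b c (smoothM (smooth_prod xpredT s1) (smooth_prod xpredT s2)).
have tm ii ii' : tame (fun M : mx => monomial (Y M) ii ii' j j').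
  apply: tameM; apply: tame_prod => s _; first exact: (tame_reg_pinv e0).
  by apply: tameJ; exact: (tame_reg_pinv e0).
have updE (A : finType) (f : A -> 'I_k -> C) (u : {ffun 'I_k -> A}) s x :
    \prod_r f (upd u s x r) r = f x s * \prod_(r | r != s) f (u r) r.
  rewrite (bigD1 s) //= ffunE eqxx; congr (_ * _); apply: eq_bigr => r rs.
  by rewrite ffunE (negbTE rs).
pose G M := - (\sum_s (i s == b)%:R * monomial (Y M) (upd i s c) i' j j') +
    \sum_s (i' s == c)%:R * monomial (Y M) i (upd i' s b) j j'.
rewrite (_ : (fun t => _) = G \o Z); last first.
  apply/funext => t; rewrite /= rotatedM !rotated_prod /G; move: (Z t) => M.
  congr (_ + _).
    rewrite mulr_suml -sumrN; apply: eq_bigr => s _.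
    rewrite rotated_reg_pinv /monomial (updE _ (fun x r => Y M x (j r))) !mulNr !mulrA.
    by congr (- (_ * _ * _)).
  rewrite mulr_sumr; apply: eq_bigr => s _.
  rewrite rotatedJ rotated_reg_pinv /monomial (updE _ (fun x r => (Y M x (j' r))^*)).
  by rewrite mulNr rmorphN opprK rmorphM /= conjC_nat !mulrA [X in X * _ * _]mulrC.
have iS (w : 'I_k -> bool) (u : 'I_k -> {ffun 'I_k -> 'I_p} * {ffun 'I_k -> 'I_p}) :
    cintegrable P (fun t => \sum_s (w s)%:R * monomial (Y (Z t)) (u s).1 (u s).2 j j') /\
    cexpectation P (fun t => \sum_s (w s)%:R * monomial (Y (Z t)) (u s).1 (u s).2 j j') =
    \sum_s (w s)%:R * cexpectation P (fun t => monomial (Y (Z t)) (u s).1 (u s).2 j j').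
  have i0 s : cintegrable P (fun t => monomial (Y (Z t)) (u s).1 (u s).2 j j').
    exact: (cintegrable_tame gZ (tm (u s).1 (u s).2)).
  have i1 s : cintegrable P (fun t => (w s)%:R * monomial (Y (Z t)) (u s).1 (u s).2 j j').
    exact: cintegrableZ.
  split; first exact: cintegrable_sum.
  by rewrite cexpectation_sum //; apply: eq_bigr => s _; rewrite cexpectationZ.
have [iA eA] := iS (fun s => i s == b) (fun s => (upd i s c, i')).
have [iB eB] := iS (fun s => i' s == c) (fun s => (i, upd i' s b)).
rewrite (_ : G \o Z = fun t => \sum_s (i' s == c)%:R * monomial (Y (Z t)) i (upd i' s b) j j' -
  \sum_s (i s == b)%:R * monomial (Y (Z t)) (upd i s c) i' j j').
  by rewrite cexpectationB // eA eB => /eqP; rewrite subr_eq0 => /eqP.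
by apply/funext => t; rewrite /G /= addrC.
Qed.

End Monomials.

(** * Moments of the pseudo-inverse in the standard case *)

Section PinvMoments.
Context {R : realType} {n q k : nat}.
Local Notation p := (n + q)%N.
Local Notation C := R[i].
Local Notation mxspace := (g_sigma_algebraType (@boxes R n p)).
Context {d : measure_display} {T : measurableType d} (P : probability T R).
Variable Z : T -> mxspace.
Hypothesis gZ : gaussian_mx P Z.
Hypothesis kq : (0 < k <= q)%N.
Variable Ym : T -> 'M[C]_(p, n).
Hypothesis mYm : forall i j, cmeasurable (fun t => Ym t i j).
Hypothesis YmE : forall t, shifted_gram 0 (Z t) \in unitmx -> Ym t = reg_pinv 0 (Z t).
Local Notation J := {ffun 'I_k -> 'I_n}.
Local Notation I := {ffun 'I_k -> 'I_p}.
Local Notation Rm t := ((Ym t)^t* *m Ym t).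
Local Notation E := (cexpectation P).
Local Notation adm := (admissible Z).

Lemma admissible_monomial (i i' : I) (j j' : J) :
  adm (2 * k) (fun N t => monomial (reg_pinv (eps N)%:C%C (Z t)) i i' j j')
    (fun t => monomial (Ym t) i i' j j').
Proof.
have := admissibleM
  (admissible_prod (index_enum 'I_k) xpredT (fun s => admissible_reg_pinv gZ mYm YmE (i s) (j s)))
  (admissible_prod (index_enum 'I_k) xpredT
     (fun s => admissibleJ (admissible_reg_pinv gZ mYm YmE (i' s) (j' s)))).
by rewrite sum_nat_const card_ord muln1 addnn -mul2n.
Qed.

Lemma monomial_limit (i i' : I) (j j' : J) :
  cintegrable P (fun t => monomial (Ym t) i i' j j') /\
  ccvg (fun N => E (fun t => monomial (reg_pinv (eps N)%:C%C (Z t)) i i' j j'))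
    (E (fun t => monomial (Ym t) i i' j j')).
Proof. exact: admissible_limit gZ kq _ _ _ _ (admissible_monomial i i' j j'). Qed.

Definition moment (i i' : I) (j j' : J) := E (fun t => monomial (Ym t) i i' j j').

(** Both tuples keep length [k] at every order [m], so that permutations of all [k] slots act
    throughout the recursion. The order of the indices comes from [(Y^* Y) j' j], the sum of
    [conj Y_lj' * Y_lj]. *)
Definition gram_prod m (M : 'M[C]_n) (j j' : J) := \prod_(s < k | (s < m)%N) M (j' s) (j s).

Definition gram_moment m (j j' : J) := E (fun t => gram_prod m (Rm t) j j').

Lemma moment_invariant j j' : gl_invariant (fun i i' => moment i i' j j').
Proof.
move=> i i' b c.
have lim (w : 'I_k -> bool) (u : 'I_k -> I * I) :
    ccvg (fun N => \sum_s (w s)%:R * E (fun t => monomial (reg_pinv (eps N)%:C%C (Z t)) (u s).1 (u s).2 j j'))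
      (\sum_s (w s)%:R * moment (u s).1 (u s).2 j j').
  by apply: ccvg_sum => s; apply: ccvgM; [exact: ccvg_cst|exact: (monomial_limit _ _ _ _).2].
have l1 := lim (fun s => i s == b) (fun s => (upd i s c, i')).
have l2 := lim (fun s => i' s == c) (fun s => (i, upd i' s b)).
apply: ccvg_unique l1 _.
apply: (eq_fun_prop (K := fun f => ccvg f _)) l2 => N.
by rewrite /= (reg_pinv_invariant (eps_gt0 N) gZ j j' i i' b c).
Qed.

(** Slot [s] of [i] meets the conjugated slot [pi^-1 s]; summing over their common value makes an
    entry of [Y^* Y]. *)
Lemma moment_contract j j' (pi : 'S_k) :
  \sum_l moment l (permf l pi) j j' = gram_moment k j (permf j' pi^-1%g).
Proof.
rewrite /moment -cexpectation_sum; last by move=> l _; exact: (monomial_limit _ _ _ _).1.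
congr cexpectation; apply/funext => t; rewrite /gram_prod /monomial.
under [RHS]eq_bigl do rewrite ltn_ord.
under [RHS]eq_bigr do rewrite mxE.
rewrite bigA_distr_bigA /=; apply: eq_bigr => l _.
rewrite [X in _ * X](reindex_inj (@perm_inj _ pi^-1%g)) /= -big_split; apply: eq_bigr => s _ /=.
by rewrite !ffunE permKV adjmxE mulrC.
Qed.

Lemma gram_moment0 j j' : gram_moment 0 j j' = 1.
Proof.
rewrite /gram_moment (_ : (fun t => _) = fun=> 1) ?cexpectation_cst //.
by apply/funext => t; rewrite /gram_prod big_pred0.
Qed.

Lemma sum2_ltn m : (m <= k)%N -> (\sum_(s < k | (s < m)%N) 2 = 2 * m)%N.
Proof. by move=> mk; rewrite -(big_ord_widen k (fun=> 2%N) mk) sum_nat_const card_ord mulnC. Qed.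

Lemma admissible_gram_prod m j j' : (m <= k)%N ->
  adm (2 * m) (fun N t => gram_prod m (resolvent (eps N)%:C%C (Z t)) j j')
    (fun t => gram_prod m (Rm t) j j').
Proof.
move=> mk; have := admissible_prod (index_enum 'I_k) (fun s => (s < m)%N)
  (fun s => admissible_resolvent gZ mYm YmE (j' s) (j s)).
by rewrite sum2_ltn.
Qed.

Lemma gram_prodS (m : 'I_k) M j j' : gram_prod m.+1 M j j' = M (j' m) (j m) * gram_prod m M j j'.
Proof.
rewrite /gram_prod (bigD1 m) ?ltnS //=; congr (_ * _); apply: eq_bigl => s.
by rewrite ltnS [RHS]ltn_neqAle andbC.
Qed.

Lemma gram_prod_tperm (m s : 'I_k) M j j' : (s < m)%N ->
  gram_prod m.+1 M j (permf j' (tperm s m)) =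
  M (j' s) (j m) * (M (j' m) (j s) * \prod_(r < k | (r < m)%N && (r != s)) M (j' r) (j r)).
Proof.
move=> sm; rewrite gram_prodS /gram_prod (bigD1 s) //= !ffunE tpermR tpermL; congr (_ * (_ * _)).
apply: eq_bigr => r /andP[rm rs]; rewrite ffunE tpermD // 1?eq_sym //.
by rewrite neq_ltn rm.
Qed.

(** The limit of [wishart_equation] for the product of the first [m] resolvent entries, with row
    [j' m] and column [j m]. Differentiating the factor [s] reproduces the product of order [m+1]
    with [j' s] and [j' m] exchanged. *)
Lemma gram_moment_step (m : 'I_k) j j' :
  q%:R * gram_moment m.+1 j j' - \sum_(s < k | (s < m)%N) gram_moment m.+1 j (permf j' (tperm s m))
  = (j m == j' m)%:R * gram_moment m j j'.
Proof.
pose a := j' m; have mk := ltn_ord m.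
(* The terms with a factor [e] are parameters of [W], so that the regularised integrand and its
   limit are instances of one expression. *)
pose W (e tau : C) (Y : 'M[C]_(p, n)) (M : 'M[C]_n) (eR : C) :=
  ((a == j m)%:R - eR) * gram_prod m M j j'
  - (p%:R - n%:R + tau) * M a (j m) * gram_prod m M j j'
  - \sum_b Y b (j m) * \sum_(s < k | (s < m)%N) - ((Y b (j' s))^* * M a (j s)) *
      \prod_(r < k | (r < m)%N && (r != s)) M (j' r) (j r).
pose WN N t := W (eps N)%:C%C ((eps N)%:C%C * rtr (eps N)%:C%C (Z t)) (reg_pinv (eps N)%:C%C (Z t))
  (resolvent (eps N)%:C%C (Z t)) ((eps N)%:C%C * resolvent (eps N)%:C%C (Z t) a (j m)).
have EN N : E (WN N) = 0.
  exact: (wishart_equation (eps_gt0 N) gZ a (j m)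
    (smooth_prod (fun s : 'I_k => (s < m)%N) (fun s => smooth_resolvent (eps_gt0 N) (j' s) (j s)))).
have aW : adm (2 * m.+1) WN (fun t => W 0 0 (Ym t) (Rm t) 0).
  have aR i l := admissible_resolvent gZ mYm YmE i l.
  have aY i l := admissible_reg_pinv gZ mYm YmE i l.
  have aG := admissible_gram_prod j j' (ltnW mk).
  (* Since the factors [e R] and [e tau] have degree 0, every summand has degree at most
     [2 m + 2 <= 2 k]. *)
  rewrite mulnS; apply: admissibleB; first apply: admissibleB.
  - apply: (admissible_weaken (leq_addl 2 (0 + 2 * m))); apply: admissibleM => //.
    by apply: admissibleB; [exact: admissible_cst|exact: (admissible_e_resolvent gZ)].
  - apply: admissibleM => //; apply: (admissibleM (r := 0)) => //.
    by apply: admissibleD; [exact: admissible_cst|exact: (admissible_e_rtr gZ)].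
  - apply: admissible_sum => b _.
    rewrite -[(2 + 2 * m)%N]/(1 + (1 + 2 * m))%N; apply: admissibleM => //.
    apply: admissible_sum => s sm.
    have -> : (1 + 2 * m = 1 + 2 + \sum_(r < k | (r < m)%N && (r != s)) 2)%N.
      by rewrite -(sum2_ltn (ltnW mk)) (bigD1 s) //= addnA.
    apply: admissibleM; last exact: admissible_prod.
    have := admissibleZ (-1) (admissibleM (admissibleJ (aY b (j' s))) (aR a (j s))).
    by apply: admissible_eq => [N t|t]; rewrite mulN1r.
have k2 : (2 * m.+1 <= 2 * k)%N by rewrite leq_mul2l.
have [iW lW] := admissible_limit gZ kq k2 aW.
have EW : E (fun t => W 0 0 (Ym t) (Rm t) 0) = 0.
  apply: ccvg_unique lW _.
  by apply: (eq_fun_prop (K := fun f => ccvg f _)) (ccvg_cst 0) => N; rewrite EN.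
have iG l jj jj' : (l <= k)%N -> cintegrable P (fun t => gram_prod l (Rm t) jj jj').
  move=> lk; apply: (admissible_limit gZ kq _ (admissible_gram_prod jj jj' lk)).1.
  by rewrite leq_mul2l.
have WE t : W 0 0 (Ym t) (Rm t) 0 = (j m == j' m)%:R * gram_prod m (Rm t) j j'
    - q%:R * gram_prod m.+1 (Rm t) j j'
    + \sum_(s < k | (s < m)%N) gram_prod m.+1 (Rm t) j (permf j' (tperm s m)).
  have pn : (n + q)%:R - n%:R = q%:R :> C by rewrite natrD addrAC subrr add0r.
  rewrite /W subr0 addr0 pn gram_prodS mulrA /a eq_sym; congr (_ + _).
  rewrite -sumrN; under eq_bigr do rewrite -mulrN -sumrN mulr_sumr.
  rewrite exchange_big /=; apply: eq_bigr => s sm; rewrite gram_prod_tperm //.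
  rewrite [(Rm t) (j' s) (j m)]mxE mulr_suml; apply: eq_bigr => b _.
  by rewrite adjmxE mulNr opprK -!mulrA mulrCA.
move: EW; under eq_fun do rewrite WE.
have i1 : cintegrable P (fun t => (j m == j' m)%:R * gram_prod m (Rm t) j j').
  by apply: cintegrableZ; apply: iG; exact: ltnW.
have i2 : cintegrable P (fun t => q%:R * gram_prod m.+1 (Rm t) j j').
  by apply: cintegrableZ; exact: iG.
rewrite cexpectationD; [|exact: cintegrableB|by apply: cintegrable_sum => s _; exact: iG].
rewrite cexpectationB // !cexpectationZ; [|exact: iG|by apply: iG; exact: ltnW].
rewrite cexpectation_sum; last by move=> s _; exact: iG.
rewrite -/(gram_moment _ _ _) -/(gram_moment _ _ _).
by move=> h; apply/eqP; rewrite -subr_eq0 -oppr_eq0 opprB opprB addrA addrAC h.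
Qed.

Hypothesis kn : (k <= n)%N.

Lemma pinv_moment i i' j j' :
  E (fun t => monomial (Ym t) i i' j j') =
    (-1) ^+ k * \sum_(sigma : 'S_k) \sum_(rho : 'S_k)
      (permf i sigma == i')%:R * Wg2 p%:R (- q%:R) (comp_perm sigma^-1%g rho)
      * (permf j rho == j')%:R.
Proof.
have /andP[k0 kq'] := kq.
apply: (@weingarten_of_relations _ _ _ _ q moment gram_moment) => //.
- exact: leq_trans kn (leq_addr _ _).
- exact: moment_invariant.
- exact: moment_contract.
- exact: gram_moment0.
- exact: gram_moment_step.
Qed.

End PinvMoments.

(** * Reduction to a standard Gaussian matrix *)

Section PinvMeasurable.
Context {R : realType} {n p : nat}.
Local Notation C := R[i].
Local Notation mxspace := (g_sigma_algebraType (@boxes R n p)).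

(** [B = K A A^*] and [B A A^* = A^*] give [B - Y_e = e K (1 - e R)], whose entries are of order [e]
    because those of [e R] are at most [n]. Convergence holds also at singular matrices, hence
    measurability without an exceptional set. *)
Lemma pinv_limit (A : 'M[C]_(n, p)) (B : 'M[C]_(p, n)) i j : is_pseudo_inverse A B ->
  ccvg (fun N => reg_pinv (eps N)%:C%C A i j) (B i j).
Proof.
move=> AB; have BA := pinv_mul_gram AB; have [K KE] := pinv_factor_gram AB.
pose c := \sum_l `|K i l| * (1 + n%:R).
have c0 : 0 <= c by apply: sumr_ge0 => l _; rewrite mulr_ge0 // addr_ge0.
apply: (@ccvg_bound _ _ _ (complex.Re c)) => N; rewrite -(ge0_RRe c0) distrC.
set e := (eps N)%:C%C; have e_gt0 : 0 < e := epsC_gt0 N; have e_ge0 := ltW e_gt0.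
have uA := shifted_gram_unit A e_gt0.
have gE : (A *m A^t*) *m resolvent e A = 1%:M - e *: resolvent e A.
  by rewrite -mulmxA; exact: gram_resolvent.
have -> : B i j - reg_pinv e A i j = (e *: (K *m (1%:M - e *: resolvent e A))) i j.
  have -> : B i j - reg_pinv e A i j = (B - reg_pinv e A) i j by rewrite !mxE.
  congr (fun_of_matrix _ i j); rewrite /reg_pinv -BA -mulmxA gE mulmxBr mulmx1 opprB addrC subrK.
  by rewrite -scalemxAr {1}KE -mulmxA gE.
rewrite mxE normrM (ger0_norm e_ge0) ler_wpM2l // mxE.
rewrite (le_trans (ler_norm_sum _ _ _)) // ler_sum // => l _.
rewrite normrM ler_wpM2l // !mxE (le_trans (ler_normB _ _)) // lerD //.
  by case: eqP => _; rewrite ?normr1 ?normr0.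
rewrite normrM (ger0_norm e_ge0); apply: le_trans (e_rtr_le e_ge0 uA).
by rewrite ler_wpM2l // resolvent_le_rtr.
Qed.

Lemma cmeasurable_pinv d (T : measurableType d) (G : T -> mxspace) (B : T -> 'M[C]_(p, n)) i j :
  measurable_fun setT G -> (forall t, is_pseudo_inverse (G t) (B t)) ->
  cmeasurable (fun t => B t i j).
Proof.
move=> mG GB.
have [mr mi] : (forall N, measurable_fun setT (fun t => complex.Re (reg_pinv (eps N)%:C%C (G t) i j))) /\
    (forall N, measurable_fun setT (fun t => complex.Im (reg_pinv (eps N)%:C%C (G t) i j))).
  by split=> N; have [[m1 m2] _] := @mregular_reg_pinv R n p _ (eps_gt0 N) i j;
    [exact: (measurableT_comp m1 mG)|exact: (measurableT_comp m2 mG)].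
split.
  apply: (@measurable_fun_cvg _ _ _ _ (fun N t => complex.Re (reg_pinv (eps N)%:C%C (G t) i j))) => // t _.
  exact: (pinv_limit i j (GB t)).1.
apply: (@measurable_fun_cvg _ _ _ _ (fun N t => complex.Im (reg_pinv (eps N)%:C%C (G t) i j))) => // t _.
exact: (pinv_limit i j (GB t)).2.
Qed.

End PinvMeasurable.

(** * Whitening of a Ginibre matrix *)

Section Whitening.
Context {R : realType} {n p : nat}.
Local Notation C := R[i].
Local Notation mxspace := (g_sigma_algebraType (@boxes R n p)).
Local Notation coordT := ('I_n * bool)%type.

Definition cvec_generators : set (set 'cV[C]_n) :=
  \bigcup_(c in [set: coordT]) preimage_set_system [set: 'cV[C]_n] (rcoord c) measurable.

Local Notation cvspace := (g_sigma_algebraType cvec_generators).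

Lemma cmeasurable_cvec a : cmeasurable (fun x : cvspace => (x : 'cV[C]_n) a 0).
Proof.
have m c : measurable_fun setT (rcoord c : cvspace -> R).
  move=> _ B mB; apply: sub_sigma_algebra; exists c => //.
  by exists B.
by split; [exact: (m (a, false))|exact: (m (a, true))].
Qed.

Definition colbox (A : 'I_n * bool -> set R) : set 'cV[C]_n := [set x | forall c, A c (rcoord c x)].

Lemma colbox_borel A (K : 'M[C]_n) : (forall c, measurable (A c)) ->
  cvec_borel ((fun x => K *m x) @^-1` colbox A).
Proof.
move=> mA; have mK i : cmeasurable (fun x : cvspace => (K *m (x : 'cV[C]_n)) i 0).
  apply: (eq_fun_prop (K := cmeasurable))
    (_ : cmeasurable (fun x : cvspace => \sum_l K i l * (x : 'cV[C]_n) l 0)) => [x|].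
    by rewrite mxE.
  apply: cmeasurable_sum => l _; apply: cmeasurableM; first exact: cmeasurable_cst.
  exact: cmeasurable_cvec.
have mr c : measurable_fun setT (fun x : cvspace => rcoord c (K *m (x : 'cV[C]_n))).
  by rewrite /rcoord; case: c => i [] /=; [exact: (mK i).2|exact: (mK i).1].
have -> : (fun x => K *m x) @^-1` colbox A =
    \bigcap_(c in [set: coordT]) ((fun x : cvspace => rcoord c (K *m (x : 'cV[C]_n))) @^-1` A c).
  by apply/seteqP; split=> [x h c _|x h c]; [exact: h|exact: (h c Logic.I)].
suff : measurable (\bigcap_(c in [set: coordT])
    ((fun x : cvspace => rcoord c (K *m (x : 'cV[C]_n))) @^-1` A c) : set cvspace) by [].
apply: fin_bigcap_measurable => [|c _]; first exact: finite_finset.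
by rewrite -[X in measurable X]setTI; exact: mr.
Qed.

Context {d : measure_display} {T : measurableType d} (P : probability T R).

Lemma std_complex_normal_colbox (d' : measure_display) (T' : measurableType d') (P' : probability T' R)
    (Z : T' -> 'cV[C]_n) A : std_complex_normal P' Z -> (forall c, measurable (A c)) ->
  P' (Z @^-1` colbox A) = \big[*%E/1%E]_c normal_prob 0 (Num.sqrt 2^-1) (A c).
Proof.
move=> [_ ind law] mA; rewrite (_ : Z @^-1` _ = \bigcap_(c in [set: coordT]) ((rcoord c \o Z) @^-1` A c)).
  by rewrite ind //; apply: eq_bigr => c _; exact: law.
by apply/seteqP; split=> [x h c _|x h c]; [exact: h|exact: (h c Logic.I)].
Qed.

Lemma ginibre_measurable (S : 'M[C]_n) (G : T -> mxspace) : ginibre P S G -> measurable_fun setT G.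
Proof.
move=> [_ Gj]; apply: measurable_to_mxspace => -[[a b] c].
have [/(_ (a, c)) m _] := Gj b.
apply: (eq_fun_prop (K := fun f => measurable_fun setT f) _ m) => t.
by rewrite /= /rcoord /rcoordmx mxE /=.
Qed.

(** A box for the whitened matrix is an intersection of events on single columns; independence of
    the columns splits it, and the law of each column splits over its real coordinates. *)
Lemma ginibre_whiten (S H : 'M[C]_n) (G : T -> 'M[C]_(n, p)) : S \in unitmx -> is_sqrtmx S H ->
  ginibre P S G -> gaussian_mx P ((fun t => invmx H *m G t) : T -> mxspace).
Proof.
move=> uS SH gG; have [ind Gj] := gG.
have uH : H \in unitmx.
  by have [_ HS] := SH; move: uS; rewrite -HS unitmx_mul andbb.
split.
  apply: measurable_to_mxspace => -[[a b] c].
  have mG l : cmeasurable (fun t => G t l b).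
    have [m _] := Gj b.
    by split; [apply: (eq_fun_prop (K := fun f => measurable_fun setT f) _ (m (l, false))) => t|
               apply: (eq_fun_prop (K := fun f => measurable_fun setT f) _ (m (l, true))) => t];
      rewrite /= /rcoord /= mxE.
  have [m1 m2] : cmeasurable (fun t => (invmx H *m G t) a b).
    apply: (eq_fun_prop (K := cmeasurable)) (_ : cmeasurable (fun t => \sum_l invmx H a l * G t l b)) => [t|].
      by rewrite mxE.
    by apply: cmeasurable_sum => l _; apply: cmeasurableM => //; exact: cmeasurable_cst.
  by rewrite /rcoordmx /rpart; case: c.
move=> A mA.
pose B b : set 'cV[C]_n := (fun x => invmx H *m x) @^-1` colbox (fun c => A (c.1, b, c.2)).
have mB b : cvec_borel (B b) by apply: colbox_borel.
rewrite (_ : _ @^-1` _ = \bigcap_(b in [set: 'I_p]) ((fun t => col b (G t)) @^-1` B b)); last first.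
  have colM (M : 'M[C]_(n, p)) a b : (invmx H *m col b M) a 0 = (invmx H *m M) a b.
    by rewrite !mxE; apply: eq_bigr => l _; rewrite mxE.
  apply/seteqP; split=> [t h b _ c|t h [[a b] c]] /=.
    by have := h (c.1, b, c.2); rewrite /rcoord /rcoordmx /rpart /= colM.
  by have := h b Logic.I (a, c); rewrite /rcoord /rcoordmx /rpart /= colM.
rewrite ind //.
have PB b : P ((fun t => col b (G t)) @^-1` B b) =
    \big[*%E/1%E]_(c : coordT) normal_prob 0 (Num.sqrt 2^-1) (A (c.1, b, c.2)).
  (* The square root [H'] attached to column [b] is existential; uniqueness identifies it with [H],
     so [invmx H] undoes it. *)
  have [_ [H' [d' [T' [P' [Z [SH' sZ law]]]]]]] := Gj b.
  rewrite law // -(std_complex_normal_colbox sZ) //; congr (P' _).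
  by apply/seteqP; split=> t; rewrite /B /= -(sqrtmx_unique uS SH SH') mulKmx.
under eq_bigr do rewrite PB.
rewrite pair_big /= (reindex (fun c : 'I_n * 'I_p * bool => (c.1.2, (c.1.1, c.2)))) /=.
  by apply: eq_bigr => -[[a b] c] _.
by exists (fun x : 'I_p * ('I_n * bool) => (x.2.1, x.1, x.2.2)) => [[[a b] c]|[b [a c]]].
Qed.

End Whitening.

Section Whitened.
Context {R : realType} {n p : nat}.
Local Notation C := R[i].

Lemma delta_permE k (A : finType) (i i' : 'I_k -> A) (s : 'S_k) :
  delta_perm s i i' = (permf (finfun i) s == finfun i')%:R :> C.
Proof.
case: eqP => [/ffunP e|ne]; rewrite /delta_perm.
  by rewrite big1 // => r _; have := e r; rewrite !ffunE => ->; rewrite eqxx.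
have [r r0] : exists r, i (s r) != i' r.
  apply: contrapT => h; apply: ne; apply/ffunP => r; rewrite !ffunE.
  by apply/eqP/negPn/negP => ne; apply: h; exists r.
by rewrite (bigD1 r) //= (negbTE r0) mul0r.
Qed.

(** With [G = H Z], cancelling [H] on the right in [B G G^* = G^*] leaves [B H Z Z^* = Z^*]. *)
Lemma pinv_whiten (G : 'M[C]_(n, p)) (B : 'M[C]_(p, n)) (H : 'M[C]_n) :
  H \in unitmx -> H^t* = H -> is_pseudo_inverse G B ->
  shifted_gram 0 (invmx H *m G) \in unitmx -> B *m H = reg_pinv 0 (invmx H *m G).
Proof.
move=> uH Hh GB uW; have := pinv_mul_gram GB.
have : G = H *m (invmx H *m G) by rewrite mulKVmx.
move: (invmx H *m G) uW => Z uW ->.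
have WE : shifted_gram 0 Z = Z *m Z^t* by rewrite /shifted_gram raddf0 addr0.
rewrite adjmxM Hh => /(congr1 (mulmx^~ (invmx H))); rewrite !mulmxA.
rewrite !mulmxK // => BZ.
by rewrite /reg_pinv -BZ -(mulmxA _ Z) -WE /resolvent mulmxK.
Qed.

Lemma prod_mulmx k (A : 'M[C]_(p, n)) (K : 'M[C]_n) (i : 'I_k -> 'I_p) (j : 'I_k -> 'I_n) :
  \prod_s (A *m K) (i s) (j s) =
  \sum_(l : {ffun 'I_k -> 'I_n}) (\prod_s A (i s) (l s)) * \prod_s K (l s) (j s).
Proof.
under eq_bigr do rewrite mxE.
by rewrite bigA_distr_bigA; apply: eq_bigr => l _; rewrite big_split.
Qed.

Lemma monomial_mulmx k (A : 'M[C]_(p, n)) (K : 'M[C]_n) (i i' : 'I_k -> 'I_p) (j j' : 'I_k -> 'I_n) :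
  (\prod_s (A *m K) (i s) (j s)) * (\prod_s (A *m K) (i' s) (j' s))^* =
  \sum_(l : {ffun 'I_k -> 'I_n}) \sum_(l' : {ffun 'I_k -> 'I_n}) ((\prod_s K (l s) (j s)) * \prod_s (K (l' s) (j' s))^*) *
    monomial A (finfun i) (finfun i') l l'.
Proof.
rewrite !prod_mulmx rmorph_sum mulr_suml; apply: eq_bigr => l _; rewrite mulr_sumr.
apply: eq_bigr => l' _; rewrite rmorphM !rmorph_prod /= /monomial.
rewrite mulrC mulrACA mulrC; congr (_ * _); first by rewrite mulrC.
by rewrite mulrC; congr (_ * _); apply: eq_bigr => s _; rewrite !ffunE.
Qed.

(** Summing over each entry of [l] rebuilds an entry of [K^* K], which is the inverse of Sigma when
    [K] is the inverse of its square root. *)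
Lemma sum_perm_sqrt k (K : 'M[C]_n) (rho : 'S_k) (j j' : 'I_k -> 'I_n) :
  \sum_(l : {ffun 'I_k -> 'I_n}) (\prod_s K (l s) (j s)) * \prod_s (K (permf l rho s) (j' s))^* =
  (\prod_s (K^t* *m K) (j (rho s)) (j' s))^*.
Proof.
rewrite rmorph_prod [RHS](reindex_inj (@perm_inj _ rho^-1%g)) /=.
under [RHS]eq_bigr do rewrite permKV mxE rmorph_sum.
rewrite bigA_distr_bigA; apply: eq_bigr => l _.
rewrite [X in _ * X](reindex_inj (@perm_inj _ rho^-1%g)) /= -big_split; apply: eq_bigr => s _ /=.
by rewrite !ffunE permKV adjmxE rmorphM /= conjCK.
Qed.

End Whitened.

Theorem theorem4p1 (R : realType) (d : measure_display) (T : measurableType d)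
  (P : probability T R) (n p k : nat) (q : int)
  (Sigma : 'M[R[i]]_n) (G : T -> 'M[R[i]]_(n, p)) (Gm : T -> 'M[R[i]]_(p, n))
  (Sigma_pos : posdefmx Sigma)
  (G_ginibre : ginibre P Sigma G)
  (Gm_pinv : forall t : T, is_pseudo_inverse (G t) (Gm t))
  (qE : q = p%:Z - n%:Z)
  (k_ge1 : (1 <= k)%N) (le_k_n : (k <= n)%N) (le_k_q : k%:Z <= q)
  (i i' : 'I_k -> 'I_p) (j j' : 'I_k -> 'I_n) :
  let X := fun t : T =>
    (\prod_(s < k) Gm t (i s) (j s)) * (\prod_(s < k) Gm t (i' s) (j' s))^* in
  cintegrable P X /\
  cexpectation P X =
    (-1) ^+ k * \sum_(sigma : 'S_k) \sum_(rho : 'S_k)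
      delta_perm sigma i i'
      * Wg2 p%:R (- q%:~R) (comp_perm sigma^-1%g rho)
      * (\prod_(s < k) (invmx Sigma) (j (rho s)) (j' s))^*.
Proof.
have [m qm] : exists m : nat, q = m%:Z.
  by exists `|q|%N; rewrite gez0_abs // (le_trans _ le_k_q).
have pE : p = (n + m)%N.
  have : (p%:Z = (n + m)%N%:Z)%R by rewrite PoszD -qm qE addrC subrK.
  by case.
have km : (0 < k <= m)%N by rewrite k_ge1 -lez_nat -qm.
rewrite qm; clear q qE le_k_q qm; subst p => X.
have uS := posdefmx_unit Sigma_pos.
(* A column is needed to get hold of the square root [H]; there is one because
   [1 <= k <= n <= p]. *)
have p_gt0 : (0 < n + m)%N by rewrite (leq_trans k_ge1) // (leq_trans le_k_n) ?leq_addr.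
have [_ [H [_ [_ [_ [_ [SH _ _]]]]]]] := G_ginibre.2 (Ordinal p_gt0).
have [[/is_hermitianmxP Hh _] HS] := SH.
have {}Hh : H^t* = H by move: Hh; rewrite expr0 scale1r => <-.
have uH : H \in unitmx by move: uS; rewrite -HS unitmx_mul andbb.
pose K := invmx H; pose Ym t := Gm t *m H.
have KK : K^t* *m K = invmx Sigma.
  rewrite adjmx_inv Hh; apply: (can_inj (mulKmx uS)).
  by rewrite mulmxV // -HS -mulmxA mulKVmx // mulmxV.
have gZ := ginibre_whiten uS SH G_ginibre.
have mYm a b : cmeasurable (fun t => Ym t a b).
  apply: (eq_fun_prop (K := cmeasurable)) (_ : cmeasurable (fun t => \sum_l Gm t a l * H l b)) => [t|].
    by rewrite mxE.
  apply: cmeasurable_sum => l _; apply: cmeasurableM; last exact: cmeasurable_cst.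
  exact: cmeasurable_pinv (ginibre_measurable G_ginibre) Gm_pinv.
have YmE t := pinv_whiten uH Hh (Gm_pinv t).
(* [Gm = Ym K], so [X] is a combination of monomials in [Ym] with deterministic coefficients. *)
have XE t : X t = \sum_(l : {ffun 'I_k -> 'I_n}) \sum_(l' : {ffun 'I_k -> 'I_n}) ((\prod_s K (l s) (j s)) * \prod_s (K (l' s) (j' s))^*) *
    monomial (Ym t) (finfun i) (finfun i') l l'.
  by rewrite -monomial_mulmx /Ym mulmxK.
have iM l l' := (monomial_limit gZ km mYm YmE (finfun i) (finfun i') l l').1.
have iX (l l' : {ffun 'I_k -> 'I_n}) : cintegrable P (fun t => ((\prod_s K (l s) (j s)) * \prod_s (K (l' s) (j' s))^*) *
    monomial (Ym t) (finfun i) (finfun i') l l') by exact: cintegrableZ.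
have -> : X = (fun t => \sum_(l : {ffun 'I_k -> 'I_n}) \sum_(l' : {ffun 'I_k -> 'I_n}) ((\prod_s K (l s) (j s)) * \prod_s (K (l' s) (j' s))^*) *
    monomial (Ym t) (finfun i) (finfun i') l l') by apply/funext.
have iXl (l : {ffun 'I_k -> 'I_n}) : cintegrable P (fun t => \sum_(l' : {ffun 'I_k -> 'I_n}) ((\prod_s K (l s) (j s)) * \prod_s (K (l' s) (j' s))^*) *
    monomial (Ym t) (finfun i) (finfun i') l l') by exact: cintegrable_sum.
split; first exact: cintegrable_sum.
have EE (l l' : {ffun 'I_k -> 'I_n}) : cexpectation P (fun t => ((\prod_s K (l s) (j s)) *
      \prod_s (K (l' s) (j' s))^*) * monomial (Ym t) (finfun i) (finfun i') l l') =
    (-1) ^+ k * \sum_(sigma : 'S_k) \sum_(rho : 'S_k) delta_perm sigma i i' *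
      Wg2 (n + m)%:R (- m%:R) (comp_perm sigma^-1%g rho) *
      (((\prod_s K (l s) (j s)) * \prod_s (K (l' s) (j' s))^*) * (permf l rho == l')%:R).
  rewrite cexpectationZ // (pinv_moment gZ km mYm YmE le_k_n) mulrCA; congr (_ * _).
  rewrite mulr_sumr; apply: eq_bigr => sigma _; rewrite mulr_sumr; apply: eq_bigr => rho _.
  by rewrite delta_permE mulrCA.
rewrite cexpectation_sum //.
transitivity (\sum_(l : {ffun 'I_k -> 'I_n}) \sum_(l' : {ffun 'I_k -> 'I_n})
    (-1) ^+ k * \sum_(sigma : 'S_k) \sum_(rho : 'S_k) delta_perm sigma i i' *
      Wg2 (n + m)%:R (- m%:R) (comp_perm sigma^-1%g rho) *
      (((\prod_s K (l s) (j s)) * \prod_s (K (l' s) (j' s))^*) * (permf l rho == l')%:R)).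
  by apply: eq_bigr => l _; rewrite cexpectation_sum //; apply: eq_bigr => l' _; exact: EE.
under eq_bigr do rewrite -mulr_sumr exchange_big /=.
rewrite -mulr_sumr exchange_big /=; congr (_ * _); apply: eq_bigr => sigma _.
under eq_bigr do rewrite exchange_big /=.
rewrite exchange_big /=; apply: eq_bigr => rho _.
under eq_bigr do rewrite -mulr_sumr.
rewrite -mulr_sumr pmulrn; congr (_ * _).
rewrite -KK -sum_perm_sqrt; apply: eq_bigr => l _.
(* The delta leaves only [l' = permf l rho]. *)
rewrite (bigD1 (permf l rho)) //= eqxx mulr1 [X in _ + X]big1 ?addr0 // => l' /negbTE ne.
by rewrite eq_sym ne mulr0.
Qed.
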